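(* Let $p\in\mathbb{N}$ with $p\geq 3$ and consider the three-dimensional lens space $L(p;1)$ with a Riemannian metric of constant sectional curvature. Then $$6\leq \mathsf{GC}(L(p;1))\leq 7.$$
   Context: Lens space. $L(p;1)=\mathbb{S}^3/\mathbb{Z}_p$, where $\mathbb{S}^3\subset\mathbb{C}^2$ is the unit sphere and $\mathbb{Z}_p$ acts by $m\cdot(z_1,z_2)=(e^{2\pi i m/p}z_1,e^{2\pi i m/p}z_2)$. A metric of constant sectional curvature on $L(p;1)$ is one for which the quotient map $\mathbb{S}^3\to L(p;1)$ is a Riemannian covering with respect to the round metric on $\mathbb{S}^3$ (by the Killing-Hopf theorem all constant curvature metrics on $L(p;1)$ arise in this way, up to scaling and isometry). Geodesic complexity. A locally compact decomposition of a topological space $X$ is a finite cover $A_1,\dots,A_k$ of $X$ by pairwise disjoint subsets, each of which is a locally compact subspace of $X$. For a complete Riemannian manifold $M$ let $GM\subseteq C^0([0,1],M)$ be the space of length-minimizing geodesics in $M$ parametrized on $[0,1]$, with the subspace topology of the compact-open topology, and $p\colon GM\to M\times M$, $p(\gamma)=(\gamma(0),\gamma(1))$. $\mathsf{GC}(M)$ is the smallest integer $k$ for which there is a locally compact decomposition $A_1,\dots,A_k$ of $M\times M$ such that each $A_i$ admits a continuous local section $A_i\to GM$ of $p$ ($+\infty$ if there is none). *)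

(* Defs.v *)
From HB Require Import structures.
From mathcomp Require Import all_boot all_order all_algebra generic_quotient.
From mathcomp Require Import ring.
From mathcomp Require Import all_classical all_reals all_analysis.

Set Implicit Arguments.
Unset Strict Implicit.
Unset Printing Implicit Defensive.

Import Order.TTheory GRing.Theory Num.Theory.
Import numFieldNormedType.Exports.

Local Open Scope classical_set_scope.
Local Open Scope quotient_scope.
Local Open Scope ring_scope.

Definition unit_interval (R : realType) : set R := [set` `[0, 1]].

Lemma unit_interval0 (R : realType) : (0 : R) \in @unit_interval R.
Proof. by rewrite inE /unit_interval /= in_itv /= lexx ler01. Qed.

Lemma unit_interval1 (R : realType) : (1 : R) \in @unit_interval R.
Proof. by rewrite inE /unit_interval /= in_itv /= lexx ler01. Qed.

Definition path_start (R : realType) (M : Type) (g : @unit_interval R -> M) : M :=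
  g (SigSub (unit_interval0 R)).

Definition path_end (R : realType) (M : Type) (g : @unit_interval R -> M) : M :=
  g (SigSub (unit_interval1 R)).

Definition endpoints (R : realType) (M : topologicalType)
    (GM : set {compact-open, @unit_interval R -> M}) (g : GM) : M * M :=
  (path_start (\val g), path_end (\val g)).

(* Local compactness of A i refers to the subspace topology, hence [set: A i]:
   [locally_compact (A i)] would ask for neighbourhoods that are contained in
   compact sets of X, which always holds when X is compact. *)
Definition locally_compact_decomposition (X : topologicalType) (k : nat)
    (A : 'I_k -> set X) : Prop :=
  [/\ \bigcup_i A i = [set: X],
      trivIset [set: 'I_k] A &
      forall i, locally_compact [set: A i] ].

Definition has_local_section (R : realType) (M : topologicalType)
    (GM : set {compact-open, @unit_interval R -> M}) (A : set (M * M)) : Prop :=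
  exists2 s : A -> GM, continuous s & forall xy : A, endpoints (s xy) = \val xy.

(* The infimum in \bar R is +oo if there is no decomposition, and otherwise it
   is attained. *)
Definition GC (R : realType) (M : topologicalType)
    (GM : set {compact-open, @unit_interval R -> M}) : \bar R :=
  ereal_inf [set (k%:R)%:E | k in [set k : nat |
    exists2 A : 'I_k -> set (M * M),
      locally_compact_decomposition A & forall i, has_local_section GM (A i)]].

(* C^2 as a real vector space: row j of the matrix is (Re z_j, Im z_j). *)

Definition C2 (R : realType) : normedModType R := 'M[R]_2.

Definition inner (R : realType) (u v : C2 R) : R := \sum_i \sum_j u i j * v i j.

Definition sphere3 (R : realType) : set (C2 R) := [set z | inner z z = 1].

(* Right multiplication of (Re z, Im z) by this matrix is multiplication of z
   by e^(i theta). *)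
Definition rot (R : realType) (theta : R) : 'M[R]_2 :=
  \matrix_(i < 2, j < 2)
    if i == j then cos theta else if (i < j)%N then sin theta else - sin theta.

Definition lens_act (R : realType) (p : nat) (m : int) (z : C2 R) : C2 R :=
  z *m rot (2 * pi * m%:~R / p%:R).

(* The action of Z factors through Z_p, so for p > 0 the classes of lens_rel are
   the Z_p-orbits. *)
Definition lens_rel (R : realType) (p : nat) : rel (@sphere3 R) :=
  fun x y => `[< exists m : int, lens_act p m (\val x) = \val y >].

Lemma rot0 (R : realType) : rot 0 = 1%:M :> 'M[R]_2.
Proof.
apply/matrixP => i j; rewrite !mxE cos0 sin0 oppr0.
by case: (i == j) => //=; rewrite if_same.
Qed.

Lemma rotD (R : realType) (a b : R) : rot a *m rot b = rot (a + b).
Proof.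
apply/matrixP => i j; rewrite !mxE !big_ord_recl big_ord0 !mxE cosD sinD.
case: i => [[|[|//]] hi]; case: j => [[|[|//]] hj] /=; ring.
Qed.

Lemma lens_act0 (R : realType) p (z : C2 R) : lens_act p 0 z = z.
Proof. by rewrite /lens_act mulr0 mul0r rot0 mulmx1. Qed.

Lemma lens_actD (R : realType) p m n (z : C2 R) :
  lens_act p n (lens_act p m z) = lens_act p (m + n) z.
Proof.
by rewrite /lens_act -mulmxA rotD -mulrDl -mulrDr -intrD.
Qed.

Lemma lens_rel_equiv (R : realType) (p : nat) : equiv_class_of (@lens_rel R p).
Proof.
split=> [x|x y|y x z].
- by apply/asboolP; exists 0; rewrite lens_act0.
- apply: asbool_equiv_eq; split=> -[m <-]; exists (- m).
    by rewrite lens_actD addrN lens_act0.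
  by rewrite lens_actD addrN lens_act0.
- move=> /asboolP[m xy] /asboolP[n yz]; apply/asboolP; exists (m + n).
  by rewrite -lens_actD xy.
Qed.

Canonical lens_equiv (R : realType) (p : nat) :=
  EquivRelPack (lens_rel_equiv R p).

Definition lens_space (R : realType) (p : nat) : topologicalType :=
  quotient_topology {eq_quot (lens_equiv R p)}.

Definition lens_proj (R : realType) (p : nat) (x : @sphere3 R) : lens_space R p :=
  \pi_({eq_quot (lens_equiv R p)}) x.

(* The metric of curvature kappa > 0 on the sphere and on the lens space: it is
   kappa^-1 times the metric induced by [inner].  The quotient map is a
   Riemannian covering, so piecewise C^1 curves and geodesics of the lens space
   are the projections of those of the sphere, with the same lengths. *)

Definition emb (R : realType) (c : R -> @sphere3 R) : R -> C2 R :=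
  fun t => \val (c t).

Definition C1 (R : realType) (f : R -> C2 R) : Prop :=
  (forall t, derivable f t 1) /\ continuous (derive1 f).

Definition piecewise_C1 (R : realType) (c : R -> @sphere3 R) : Prop :=
  exists s : seq R, [/\ path <%R 0 s, last 0 s = 1 &
    forall i, (i < size s)%N ->
      exists2 f : R -> C2 R, C1 f &
        {in `[nth 0 (0 :: s) i, nth 0 s i], emb c =1 f} ].

(* The derivative may fail to exist at the break points, a null set. *)
Definition curve_length (R : realType) (kappa : R) (c : R -> @sphere3 R) : \bar R :=
  (\int[lebesgue_measure]_(t in `[0%R, 1%R])
    (Num.sqrt (kappa^-1 * inner (derive1 (emb c) t) (derive1 (emb c) t)))%:E)%E.

(* The Levi-Civita covariant derivative of the velocity: the component of the
   acceleration tangent to the sphere. *)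
Definition covariant_acceleration (R : realType) (c : R -> @sphere3 R) (t : R)
    : C2 R :=
  derive1n 2 (emb c) t - inner (derive1n 2 (emb c) t) (emb c t) *: emb c t.

Definition sphere_geodesic (R : realType) (c : R -> @sphere3 R) : Prop :=
  forall t, [/\ derivable (emb c) t 1, derivable (derive1 (emb c)) t 1 &
                covariant_acceleration c t = 0].

Definition minimizing_geodesics (R : realType) (p : nat) (kappa : R) :
    set {compact-open, @unit_interval R -> lens_space R p} :=
  [set g | continuous (g : @unit_interval R -> lens_space R p) /\
    exists c : R -> @sphere3 R,
    [/\ sphere_geodesic c,
        forall t, g t = lens_proj p (c (\val t)) &
        forall c', piecewise_C1 c' ->
          lens_proj p (c' 0) = path_start g ->
          lens_proj p (c' 1) = path_end g ->
          (curve_length kappa c <= curve_length kappa c')%E]].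

(* Main.v *)
From HB Require Import structures.
From mathcomp Require Import all_boot all_order all_algebra generic_quotient.
From mathcomp Require Import ring lra zify.
From mathcomp Require Import all_classical all_reals all_analysis measurable_realfun.
Require Import Defs.

(** Write [z] for e^(2 pi i / p).  A minimizing geodesic of the lens space from
    the class of [x] to that of [y] is the projection of a great arc from [x] to
    [z^m y], where the label [m], an integer modulo [p], maximizes the real inner
    product of [x] and [z^m y].  Replacing [(x, y)] by [(z^a x, z^b y)] replaces
    [m] by [m + a - b].  So a section over a set of pairs of the lens space is
    essentially a locally constant choice of a maximizing label over the preimage
    of that set, with this equivariance.

    Upper bound.  Let [h] be the Hermitian product of [x] and [y].  If [h] is not
    zero, the maximizing labels are read off from the position of [h] among [p]
    equal sectors of the plane; ties occur on [p] rays.  If [h = 0] every label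
    is maximizing, and [2 n - k] is an equivariant choice, with [n] the sector of
    the first non-zero coordinate of [x] and [k] the sector of the determinant of
    [x] and [y].  Counting the degeneracies (rays, a vanishing coordinate,
    [h = 0]) gives a [code] with values in {0, ..., 6} that is upper
    semicontinuous, and the chosen label is locally constant where the code is
    constant ([code_near]).  Hence the seven level sets of the code are locally
    compact ([stratum_locally_compact]) and the great arcs with the chosen labels
    form continuous sections over them ([stratum_section]).  That these arcs are
    minimizing rests on the comparison of length and angle on the sphere
    ([angle_le_length]).

    Lower bound.  Suppose that there are sections over at most five locally
    compact sets.  Every minimizing geodesic is a great arc, its midpoint is the
    class of [x + z^m y] up to a positive factor, and that class determines [m]
    as soon as [x] and [y] are linearly independent over the complex numbers; so
    the sections give a labelling of the independent pairs
    ([decomposition_labelling]).  Let the rank of a pair be the number of members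
    of the decomposition to which it adheres.  Locally compact means locally
    closed, so the label is locally constant where the rank is constant
    ([rk_near]).  Near a pair with [h = 0] two further labels are forced, on two
    further members, so its rank is 3, 4 or 5 ([rk_ge3]).

    It remains to see that the pairs with [h = 0] cannot be cut into three such
    levels.  Take the solid torus of pairs
    [x = (sin al e^(i ph), cos al)],
    [y = e^(i th) (- cos al, sin al e^(- i ph))] with [0 <= al <= pi / 2], and a
    fine grid on its parameters.  After thickening the levels, the vertices of
    the grid carry a level in {0, 1, 2} and a label in Z_p, and equal levels in a
    common cell imply equal labels.  The label moves by [2] when [ph] moves by
    [2 pi / p] along [al = pi / 2], and by [-1] when [th] moves by [2 pi / p].
    The differences of the labels, lifted to integers, form a 1-cochain whose
    coboundary is [p] times an integral 2-cochain (a Bockstein), supported on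
    the triangles that meet all three levels; its product with the label on level
    0 is a cocycle modulo [p].  Comparing the flux of this cocycle through two
    discs that differ by [2 pi / p] in [th] shows that the Bockstein has sum 0
    modulo [p] over a disc.  By Stokes the same sum is the total change of the
    label along an arc of length [2 pi / p] of the boundary circle, which is 2
    modulo [p], a contradiction because [p >= 3]
    ([no_equivariant_labelling]). *)

Set Implicit Arguments.
Unset Strict Implicit.
Unset Printing Implicit Defensive.

Import Order.TTheory GRing.Theory Num.Theory.
Import numFieldNormedType.Exports.

Local Open Scope classical_set_scope.
Local Open Scope ring_scope.

(** * The combinatorial obstruction *)

Section Cochains.
Variable p : nat.
Hypothesis p_gt1 : (1 < p)%N.

(** A vertex of the grid carries a level and a label. *)
Definition compatible (u v : nat * 'Z_p) := u.1 = v.1 -> u.2 = v.2.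

(** The difference of the labels is lifted to {0, ..., p - 1} in the direction of
    increasing level, which makes the lift antisymmetric. *)
Definition label_step (u v : nat * 'Z_p) : int :=
  if (u.1 < v.1)%N then (val (v.2 - u.2))%:Z
  else if (v.1 < u.1)%N then - (val (u.2 - v.2))%:Z else 0.

Lemma label_stepN u v : label_step u v = - label_step v u.
Proof. by rewrite /label_step; case: ltngtP; rewrite ?opprK ?oppr0. Qed.

Lemma Zp_intr (x : 'Z_p) : ((val x)%:Z)%:~R = x.
Proof. by rewrite -pmulrn natr_Zp. Qed.

Lemma label_step_mod u v : compatible u v -> (label_step u v)%:~R = v.2 - u.2 :> 'Z_p.
Proof.
rewrite /compatible /label_step => uv; case: ltngtP uv => [_ _|_ _|_ -> //].
- exact: Zp_intr.
- by rewrite rmorphN /= (Zp_intr (u.2 - v.2)) opprB.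
- by rewrite subrr.
Qed.

(** The coboundary of [label_step] divided by [p]; it vanishes modulo [p] before
    the division, hence the division is exact ([bocksteinE]). *)
Definition bockstein (u v w : nat * 'Z_p) : int :=
  ((label_step u v + label_step v w + label_step w u) %/ p%:Z)%Z.

(** The label of the vertices of level 0.  The last case is a default on the
    triangles that miss level 0; two levels coincide there and the Bockstein
    vanishes. *)
Definition bottom_label (u v w : nat * 'Z_p) : 'Z_p :=
  if u.1 == 0%N then u.2 else if v.1 == 0%N then v.2 else w.2.

Definition weight u v w : 'Z_p := (bockstein u v w)%:~R * bottom_label u v w.

Lemma intr_Zp_eq0 (k : int) : (k%:~R == 0 :> 'Z_p) = (p %| k)%Z.
Proof.
case: k => k.
  by rewrite -pmulrn -val_eqE /= val_Zp_nat // /dvdn dvdzE.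
rewrite NegzE rmorphN /= oppr_eq0 -pmulrn -val_eqE /= val_Zp_nat // dvdzE abszN.
Qed.

Lemma bocksteinE u v w : compatible u v -> compatible v w -> compatible w u ->
  p%:Z * bockstein u v w = label_step u v + label_step v w + label_step w u.
Proof.
move=> uv vw wu; rewrite /bockstein mulrC divzK // -intr_Zp_eq0.
by rewrite !rmorphD /= !label_step_mod //; apply/eqP; ring.
Qed.

Definition shift (s : 'Z_p) (u : nat * 'Z_p) := (u.1, u.2 + s).

Lemma addrKA2 (s x y : 'Z_p) : x + s - (y + s) = x - y.
Proof. ring. Qed.

Lemma label_step_shift s u v : label_step (shift s u) (shift s v) = label_step u v.
Proof.
have E x y : (shift s x).2 - (shift s y).2 = x.2 - y.2 by exact: addrKA2.
by rewrite /label_step !E.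
Qed.

Lemma bockstein_shift s u v w :
  bockstein (shift s u) (shift s v) (shift s w) = bockstein u v w.
Proof. by rewrite /bockstein !label_step_shift. Qed.

Lemma weight_shift s u v w :
  weight (shift s u) (shift s v) (shift s w) = weight u v w + (bockstein u v w)%:~R * s.
Proof.
rewrite /weight bockstein_shift /bottom_label /shift /=.
by case: ifP => _; [ring | case: ifP => _; ring].
Qed.

Lemma label_step_level u v w : compatible u v -> u.1 = v.1 -> label_step u w = label_step v w.
Proof. by move=> uv e; rewrite /label_step e uv. Qed.

(** Two vertices of the same level carry the same label, so the three lifted
    differences cancel. *)
Lemma bockstein_degenerate u v w : compatible u v -> compatible v w -> compatible w u ->
  [\/ u.1 = v.1, v.1 = w.1 | w.1 = u.1] -> bockstein u v w = 0.
Proof.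
move=> uv vw wu H.
have E0 a b : a.1 = b.1 -> label_step a b = 0 by rewrite /label_step => ->; rewrite ltnn.
suff E : label_step u v + label_step v w + label_step w u = 0 by rewrite /bockstein E div0z.
case: H => e.
- rewrite (E0 _ _ e) (label_stepN w u) (label_step_level w uv e); ring.
- rewrite (E0 _ _ e) (label_stepN u v) (label_step_level u vw e); ring.
- rewrite (E0 _ _ e) (label_stepN v w) (label_step_level v wu e); ring.
Qed.

(** All vertices of level 0 of a tetrahedron have the same label, so on its faces
    [weight] is the Bockstein times a constant, and the Bockstein is a cocycle. *)
Lemma weight_cocycle a b c d :
  (a.1 < 3)%N -> (b.1 < 3)%N -> (c.1 < 3)%N -> (d.1 < 3)%N ->
  compatible a b -> compatible a c -> compatible a d ->
  compatible b c -> compatible b d -> compatible c d ->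
  weight b c d - weight a c d + weight a b d - weight a b c = 0.
Proof.
move=> a3 b3 c3 d3 ab ac ad bc bd cd.
have sym u v : compatible u v -> compatible v u by move=> H e; rewrite H.
have [l [la lb lc ld]] : exists l, [/\ a.1 = 0%N -> a.2 = l, b.1 = 0%N -> b.2 = l,
    c.1 = 0%N -> c.2 = l & d.1 = 0%N -> d.2 = l].
  have [a0|a0] := eqVneq a.1 0%N.
    by exists a.2; split=> // e; symmetry; (apply: ab || apply: ac || apply: ad); rewrite e.
  have [b0|b0] := eqVneq b.1 0%N.
    by exists b.2; split=> // e; [by rewrite e in a0 | |];
       symmetry; (apply: bc || apply: bd); rewrite e.
  have [c0|c0] := eqVneq c.1 0%N.
    exists c.2; split=> // e; [by rewrite e in a0 | by rewrite e in b0 |].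
    by symmetry; apply: cd; rewrite e.
  by exists d.2; split=> // e; [rewrite e in a0 | rewrite e in b0 | rewrite e in c0].
have W u v w : (u.1 < 3)%N -> (v.1 < 3)%N -> (w.1 < 3)%N ->
    compatible u v -> compatible v w -> compatible w u ->
    (u.1 = 0%N -> u.2 = l) -> (v.1 = 0%N -> v.2 = l) -> (w.1 = 0%N -> w.2 = l) ->
    weight u v w = (bockstein u v w)%:~R * l.
  move=> u3 v3 w3 uv vw wu lu lv lw; rewrite /weight /bottom_label.
  case: eqP => [/lu -> //|u0]; case: eqP => [/lv -> //|v0].
  have [/lw -> //|/eqP w0] := eqVneq w.1 0%N.
  rewrite bockstein_degenerate ?mul0r //.
  have : (u.1 == v.1) || (v.1 == w.1) || (w.1 == u.1) by lia.
  by case/orP => [/orP[]|] /eqP; [constructor 1|constructor 2|constructor 3].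
rewrite !W //; try exact: sym.
rewrite -!mulrBl -mulrDl -!mulrBl -!(rmorphB, rmorphD) /=.
suff -> : bockstein b c d - bockstein a c d + bockstein a b d - bockstein a b c = 0.
  by rewrite mul0r.
have p0 : p%:Z != 0 by lia.
apply: (mulfI p0); rewrite mulr0.
transitivity (p%:Z * bockstein b c d - p%:Z * bockstein a c d + p%:Z * bockstein a b d
   - p%:Z * bockstein a b c); first by ring.
rewrite !bocksteinE //; try exact: sym.
rewrite (label_stepN d b) (label_stepN d a) (label_stepN c a); ring.
Qed.

(** A square of the grid is cut along its diagonal from [u00] to [u11]. *)
Definition square_sum (V : zmodType) (F : nat * 'Z_p -> nat * 'Z_p -> nat * 'Z_p -> V)
  u00 u10 u11 u01 := F u00 u10 u11 - F u00 u01 u11.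

(** The cube is cut into the six tetrahedra around its main diagonal; the inner
    triangles cancel. *)
Lemma cube_cocycle (u : bool -> bool -> bool -> nat * 'Z_p) :
  (forall i j k, (u i j k).1 < 3)%N ->
  (forall i j k i' j' k', compatible (u i j k) (u i' j' k')) ->
  let S := square_sum weight in
  let o := false in let l := true in
  (S (u o o l) (u l o l) (u l l l) (u o l l) - S (u o o o) (u l o o) (u l l o) (u o l o))
  + (S (u l o o) (u l l o) (u l l l) (u l o l) - S (u o o o) (u o l o) (u o l l) (u o o l))
  - (S (u o l o) (u l l o) (u l l l) (u o l l) - S (u o o o) (u l o o) (u l o l) (u o o l))
  = 0.
Proof.
move=> u3 uc S o l.
have H a b c d := weight_cocycle (u3 a.1.1 a.1.2 a.2) (u3 b.1.1 b.1.2 b.2)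
  (u3 c.1.1 c.1.2 c.2) (u3 d.1.1 d.1.2 d.2)
  (uc _ _ _ _ _ _) (uc _ _ _ _ _ _) (uc _ _ _ _ _ _)
  (uc _ _ _ _ _ _) (uc _ _ _ _ _ _) (uc _ _ _ _ _ _).
have E1 := H (o,o,o) (l,o,o) (l,l,o) (l,l,l).
have E2 := H (o,o,o) (o,l,o) (l,l,o) (l,l,l).
have E3 := H (o,o,o) (o,l,o) (o,l,l) (l,l,l).
have E4 := H (o,o,o) (o,o,l) (o,l,l) (l,l,l).
have E5 := H (o,o,o) (o,o,l) (l,o,l) (l,l,l).
have E6 := H (o,o,o) (l,o,o) (l,o,l) (l,l,l).
move: E1 E2 E3 E4 E5 E6; rewrite /S /square_sum /=.
move=> E1 E2 E3 E4 E5 E6.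
have comb (x1 x2 x3 x4 x5 x6 y : 'Z_p) : x1 = 0 -> x2 = 0 -> x3 = 0 -> x4 = 0 ->
    x5 = 0 -> x6 = 0 -> y = x1 - x2 + x3 - x4 + x5 - x6 -> y = 0.
  by move=> -> -> -> -> -> -> ->; ring.
by apply: (comb _ _ _ _ _ _ _ E1 E2 E3 E4 E5 E6); ring.
Qed.

Section Grid.
Variables (n : nat) (v : nat -> nat -> nat -> nat * 'Z_p).
(* [a], [b] and [c] count the steps of the parameters [al], [ph] and [th]; there
   are [n] steps in [pi / 2] for [al], and in [2 pi / p] for [ph] and [th] *)
Hypothesis v_level : forall a b c, ((v a b c).1 < 3)%N.
Hypothesis v_cell : forall a b c (i j k i' j' k' : bool), (a < n)%N -> (c < n)%N ->
  compatible (v (i + a) (j + b) (k + c)) (v (i' + a) (j' + b) (k' + c)).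
Hypothesis v_periodic : forall a c, (a <= n)%N -> (c <= n)%N -> v a (p * n) c = v a 0 c.
Hypothesis v_centre : forall b c, (c <= n)%N -> v 0 b c = v 0 0 c.
Hypothesis v_edge : forall b c, (c <= n)%N -> v n (n + b) c = shift 2 (v n b c).
Hypothesis v_shift : forall a b, (a <= n)%N -> v a b n = shift (-1) (v a b 0).

Let sq_ab F a b c : 'Z_p :=
  square_sum F (v a b c) (v a.+1 b c) (v a.+1 b.+1 c) (v a b.+1 c).
Let sq_bc F a b c : 'Z_p :=
  square_sum F (v a b c) (v a b.+1 c) (v a b.+1 c.+1) (v a b c.+1).
Let sq_ac F a b c : 'Z_p :=
  square_sum F (v a b c) (v a.+1 b c) (v a.+1 b c.+1) (v a b c.+1).

Lemma shiftD s t u : shift s (shift t u) = shift (t + s) u.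
Proof. by rewrite /shift /= addrA. Qed.

Lemma v_edge_iter b j c : (c <= n)%N -> v n (j * n + b) c = shift (2 * j%:R) (v n b c).
Proof.
move=> cn; elim: j => [|j IH]; first by rewrite mul0n mulr0 /shift addr0; case: (v _ _ _).
by rewrite mulSn -addnA v_edge // IH shiftD -[j.+1]addn1 natrD mulrDr mulr1.
Qed.

(** Discrete Stokes for the cocycle [weight] on the grid.  Of the six sides, the two
    with constant [b] cancel by periodicity, and the side [a = 0] is degenerate
    because there the value is independent of [b]. *)
Lemma grid_flux :
  \sum_(0 <= a < n) \sum_(0 <= b < p * n) sq_ab weight a b n
  - \sum_(0 <= a < n) \sum_(0 <= b < p * n) sq_ab weight a b 0
  + \sum_(0 <= b < p * n) \sum_(0 <= c < n) sq_bc weight n b c = 0.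
Proof.
have cube a b c : (a < n)%N -> (c < n)%N ->
   (sq_ab weight a b c.+1 - sq_ab weight a b c) + (sq_bc weight a.+1 b c - sq_bc weight a b c)
   - (sq_ac weight a b.+1 c - sq_ac weight a b c) = 0.
  move=> an cn.
  exact: (@cube_cocycle (fun i j k : bool => v (i + a)%N (j + b)%N (k + c)%N)
           (fun i j k => v_level _ _ _) (fun i j k i' j' k' => v_cell an cn)).
have tot : \sum_(0 <= a < n) \sum_(0 <= b < p * n) \sum_(0 <= c < n)
   ((sq_ab weight a b c.+1 - sq_ab weight a b c) + (sq_bc weight a.+1 b c - sq_bc weight a b c)
   - (sq_ac weight a b.+1 c - sq_ac weight a b c)) = 0.
  rewrite big1_seq // => a /andP[_]; rewrite mem_index_iota => /andP[_ an].
  rewrite big1_seq // => b _.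
  rewrite big1_seq // => c /andP[_]; rewrite mem_index_iota => /andP[_ cn].
  exact: cube.
rewrite -[RHS]tot.
under [in RHS]eq_bigr => a _ do under eq_bigr => b _ do rewrite sumrB big_split /=.
under [in RHS]eq_bigr => a _ do rewrite sumrB big_split /=.
rewrite [in RHS]sumrB big_split /=.
have -> : \sum_(0 <= a < n) \sum_(0 <= b < p * n) \sum_(0 <= c < n)
   (sq_ac weight a b.+1 c - sq_ac weight a b c) = 0.
  rewrite big1_seq // => a /andP[_]; rewrite mem_index_iota => /andP[_ an].
  rewrite exchange_big /= big1_seq // => c /andP[_]; rewrite mem_index_iota => /andP[_ cn].
  rewrite telescope_sumr //.
  have an' := ltnW an; have cn' := ltnW cn.
  by rewrite /sq_ac !v_periodic // subrr.
rewrite subr0; congr (_ + _).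
  rewrite -sumrB; apply: eq_bigr => a _; rewrite -sumrB; apply: eq_bigr => b _.
  by rewrite telescope_sumr.
rewrite [RHS]exchange_big /=; apply: eq_bigr => b _.
rewrite [RHS]exchange_big /=; apply: eq_big_seq => c; rewrite mem_index_iota => /andP[_ cn].
rewrite telescope_sumr // [sq_bc weight 0 b c]/sq_bc /square_sum !(v_centre _ (ltnW cn)) !(v_centre _ cn).
have deg x y : compatible x y -> weight x x y = 0 /\ weight x y y = 0.
  move=> xy; have yx : compatible y x by move=> e; rewrite xy.
  by rewrite /weight !bockstein_degenerate ?mul0r //; [constructor 2|constructor 1].
have [|-> ->] := deg (v 0 0 c) (v 0 0 c.+1); last by rewrite subrr subr0.
have n0 : (0 < n)%N by apply: leq_ltn_trans cn.
exact: (@v_cell 0 0 c false false false false false true n0 cn).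
Qed.

Lemma sum_nat_blocks (V : nmodType) (F : nat -> V) m k :
  \sum_(0 <= b < m * k) F b = \sum_(0 <= j < m) \sum_(0 <= b < k) F (j * k + b)%N.
Proof.
elim: m => [|m IH]; first by rewrite mul0n !big_nil.
rewrite big_nat_recr //= -IH mulSn addnC (@big_cat_nat _ _ _ (m * k)) //=; last exact: leq_addr.
congr (_ + _); rewrite -{1}[(m * k)%N]add0n big_addn addKn.
by apply: eq_bigr => b _; rewrite addnC.
Qed.

(** The side [a = n] consists of [p] blocks, the [j]-th being the first one with the
    labels shifted by [2 j].  The sum over [j] of the weights is therefore [p]
    times the first one plus a multiple of [0 + 2 + ... + 2 (p - 1) = p (p - 1)]. *)
Lemma lateral_flux :
  \sum_(0 <= b < p * n) \sum_(0 <= c < n) sq_bc weight n b c = 0.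
Proof.
pose Z b c := (square_sum bockstein (v n b c) (v n b.+1 c) (v n b.+1 c.+1) (v n b c.+1))%:~R : 'Z_p.
have pz : p%:R = 0 :> 'Z_p by rewrite pchar_Zp.
rewrite sum_nat_blocks exchange_big /= big1_seq // => b _.
rewrite exchange_big /= big1_seq // => c /andP[_]; rewrite mem_index_iota => /andP[_ cn].
have cn' := ltnW cn.
transitivity (\sum_(0 <= j < p) (sq_bc weight n b c + Z b c * 2 * j%:R)).
  apply: eq_bigr => j _; rewrite /sq_bc -!addnS !v_edge_iter //.
  rewrite /square_sum !weight_shift /Z /square_sum rmorphB /=; ring.
rewrite big_split /= sumr_const_nat subn0 -[X in X + _]mulr_natr pz mulr0 add0r -mulr_sumr.
rewrite -natr_sum -mulrA -natrM mulnC big_distrl /=.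
have -> : (\sum_(0 <= j < p) j * 2 = p * p.-1)%N.
  elim: (p) => [|m IH]; first by rewrite big_nil.
  by rewrite big_nat_recr //= IH; case: m {IH} => // m; lia.
by rewrite natrM pz mul0r mulr0.
Qed.

(** Stokes for [label_step] on the disc [c = 0]; its boundary consists of [p]
    translates of one arc, which contribute equally and absorb the factor [p]. *)
Lemma total_bockstein :
  \sum_(0 <= a < n) \sum_(0 <= b < p * n)
    square_sum bockstein (v a b 0) (v a.+1 b 0) (v a.+1 b.+1 0) (v a b.+1 0)
  = \sum_(0 <= b < n) label_step (v n b 0) (v n b.+1 0).
Proof.
have p0 : p%:Z != 0 by lia.
apply: (mulfI p0).
pose fa a b := label_step (v a b 0) (v a.+1 b 0).
pose fb a b := label_step (v a b 0) (v a b.+1 0).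
have n_gt0 a : (a < n)%N -> (0 < n)%N by apply: leq_ltn_trans.
have step a b : (a < n)%N ->
    p%:Z * square_sum bockstein (v a b 0) (v a.+1 b 0) (v a.+1 b.+1 0) (v a b.+1 0)
    = (fb a.+1 b - fb a b) - (fa a b.+1 - fa a b).
  move=> an; have n0 := n_gt0 _ an.
  have cc (i j i' j' : bool) : compatible (v (i + a) (j + b) 0) (v (i' + a) (j' + b) 0).
    exact: (@v_cell a b 0 i j false i' j' false).
  rewrite /square_sum mulrBr (bocksteinE (cc false false true false) (cc true false true true)
    (cc true true false false)) (bocksteinE (cc false false false true)
    (cc false true true true) (cc true true false false)).
  rewrite /fa /fb (label_stepN (v a.+1 b.+1 0) (v a b 0)); ring.
rewrite mulr_sumr; under eq_big_seq => a.
  rewrite mem_index_iota => /andP[_ an].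
  rewrite mulr_sumr; under eq_bigr => b _ do rewrite step //.
  have an' := ltnW an.
  have fa_periodic : fa a (p * n)%N = fa a 0%N by rewrite /fa !v_periodic.
  rewrite sumrB /= telescope_sumr // fa_periodic subrr subr0.
  rewrite sumrB. over.
rewrite telescope_sumr // [X in _ - X]big1 ?subr0; last first.
  by move=> b _; rewrite /fb !(v_centre _ (leq0n n)) /label_step ltnn.
rewrite sum_nat_blocks; transitivity (\sum_(0 <= j < p) \sum_(0 <= b < n) fb n b).
  apply: eq_bigr => j _; apply: eq_bigr => b _.
  by rewrite /fb -addnS !v_edge_iter // label_step_shift.
by rewrite sumr_const_nat subn0 -mulr_natl natz.
Qed.

(** Along an arc the label steps telescope modulo [p] to the shift by 2 between its
    ends. *)
Lemma holonomy : (0 < n)%N ->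
  (\sum_(0 <= b < n) label_step (v n b 0) (v n b.+1 0))%:~R = 2 :> 'Z_p.
Proof.
move=> n0; rewrite rmorph_sum /=.
under eq_bigr => b _.
  rewrite label_step_mod; first over.
  have := @v_cell n.-1 b 0 true false false true true false.
  by rewrite prednK //= !add1n prednK // add0n; apply => //; rewrite prednK.
rewrite telescope_sumr //.
by have := v_edge 0 (leq0n n); rewrite addn0 => ->; rewrite /= addrC addKr.
Qed.

(** Shifting the labels by -1 changes the flux through a disc by minus the sum of
    the Bockstein, which is 2 modulo [p]; but the two fluxes agree. *)
Lemma no_equivariant_labelling : (2 < p)%N -> (0 < n)%N -> False.
Proof.
move=> p2 n0.
pose Z a b := (square_sum bockstein (v a b 0) (v a.+1 b 0) (v a.+1 b.+1 0) (v a b.+1 0))%:~R : 'Z_p.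
have := grid_flux; rewrite lateral_flux addr0.
have -> : \sum_(0 <= a < n) \sum_(0 <= b < p * n) sq_ab weight a b n
   = \sum_(0 <= a < n) \sum_(0 <= b < p * n) (sq_ab weight a b 0 - Z a b).
  apply: eq_big_seq => a; rewrite mem_index_iota => /andP[_ an].
  apply: eq_bigr => b _.
  have an' := ltnW an.
  rewrite /sq_ab !v_shift // /square_sum !weight_shift /Z /square_sum rmorphB /=; ring.
under eq_bigr => a _ do rewrite sumrB.
rewrite sumrB addrAC subrr add0r => /eqP; rewrite oppr_eq0 => /eqP.
have -> : \sum_(0 <= a < n) \sum_(0 <= b < p * n) Z a b = 2.
  rewrite -(holonomy n0) -total_bockstein rmorph_sum /=; apply: eq_bigr => a _.
  by rewrite rmorph_sum.
move/eqP; have := intr_Zp_eq0 2; rewrite /= => ->.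
by rewrite dvdzE /= => /dvdn_leq; lia.
Qed.
End Grid.
End Cochains.

(** * Euclidean geometry and continuity in C^2 *)

Lemma lift_ord2 : lift ord0 ord0 = ord_max :> 'I_2.
Proof. exact/val_inj. Qed.

Lemma ord2P (k : 'I_2) : k = ord0 \/ k = ord_max.
Proof. by case: k => [[|[|//]] hk]; [left|right]; apply/val_inj. Qed.

Section Euclid.
Variable R : realType.
Implicit Types u v w z : C2 R.

Lemma innerE u v : inner u v =
  u ord0 ord0 * v ord0 ord0 + u ord0 ord_max * v ord0 ord_max
  + (u ord_max ord0 * v ord_max ord0 + u ord_max ord_max * v ord_max ord_max).
Proof.
rewrite /inner !big_ord_recl !big_ord0 !addr0.
by rewrite lift_ord2.
Qed.

Lemma innerC u v : inner u v = inner v u.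
Proof. by rewrite !innerE; ring. Qed.

Lemma innerDl u v w : inner (u + v) w = inner u w + inner v w.
Proof. by rewrite !innerE !mxE; ring. Qed.

Lemma innerZl a u w : inner (a *: u) w = a * inner u w.
Proof. by rewrite !innerE !mxE; ring. Qed.

Lemma innerBl u v w : inner (u - v) w = inner u w - inner v w.
Proof. by rewrite !innerE !mxE; ring. Qed.

Lemma innerDr u v w : inner w (u + v) = inner w u + inner w v.
Proof. by rewrite innerC innerDl !(innerC w). Qed.

Lemma innerZr a u w : inner w (a *: u) = a * inner w u.
Proof. by rewrite innerC innerZl (innerC w). Qed.

Lemma innerBr u v w : inner w (u - v) = inner w u - inner w v.
Proof. by rewrite innerC innerBl !(innerC w). Qed.

Lemma inner0l u : inner 0 u = 0.
Proof. by rewrite -(scale0r (0 : C2 R)) innerZl mul0r. Qed.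

Lemma inner_ge0 u : 0 <= inner u u.
Proof. by rewrite innerE; nra. Qed.

Lemma inner_eq0 u : (inner u u == 0) = (u == 0).
Proof.
apply/eqP/eqP => [|->]; last exact: inner0l.
rewrite innerE => H; apply/matrixP => i j; rewrite mxE.
have [h1 [h2 [h3 h4]]] : u ord0 ord0 = 0 /\ u ord0 ord_max = 0 /\
  u ord_max ord0 = 0 /\ u ord_max ord_max = 0 by do !split; nra.
by case: (ord2P i) => ->; case: (ord2P j) => ->.
Qed.

Lemma rotE u t (i : 'I_2) : (u *m rot t) i ord0 = u i ord0 * cos t - u i ord_max * sin t
  /\ (u *m rot t) i ord_max = u i ord0 * sin t + u i ord_max * cos t.
Proof.
rewrite !mxE !big_ord_recl !big_ord0 !mxE lift_ord2 /=.
by split; ring.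
Qed.

Lemma inner_rot u v t : inner (u *m rot t) (v *m rot t) = inner u v.
Proof.
rewrite !innerE !(rotE _ _ _).1 !(rotE _ _ _).2.
have E := cos2Dsin2 t.
transitivity ((cos t ^+ 2 + sin t ^+ 2) * (u ord0 ord0 * v ord0 ord0 + u ord0 ord_max * v ord0 ord_max
  + (u ord_max ord0 * v ord_max ord0 + u ord_max ord_max * v ord_max ord_max))); first by ring.
by rewrite E mul1r.
Qed.

Definition enorm u : R := Num.sqrt (inner u u).

Lemma enorm_ge0 u : 0 <= enorm u. Proof. exact: sqrtr_ge0. Qed.

Lemma sqr_enorm u : enorm u ^+ 2 = inner u u.
Proof. by rewrite sqr_sqrtr // inner_ge0. Qed.

Lemma enorm0 : enorm 0 = 0.
Proof. by rewrite /enorm inner0l sqrtr0. Qed.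

Lemma enorm_eq0 u : (enorm u == 0) = (u == 0).
Proof. by rewrite -inner_eq0 -sqr_enorm sqrf_eq0. Qed.

Lemma enorm_rot u t : enorm (u *m rot t) = enorm u.
Proof. by rewrite /enorm inner_rot. Qed.

Lemma enormZ a u : enorm (a *: u) = `|a| * enorm u.
Proof.
by rewrite /enorm innerZl innerZr mulrA -expr2 sqrtrM ?sqr_ge0 // sqrtr_sqr.
Qed.

Lemma enormN u : enorm (- u) = enorm u.
Proof. by rewrite -scaleN1r enormZ normrN1 mul1r. Qed.

(** Cauchy-Schwarz: expand the squared length of [|v|^2 u - <u, v> v]. *)
Lemma cauchy_schwarz_sqr u v : inner u v ^+ 2 <= inner u u * inner v v.
Proof.
have [/eqP|vn0] := eqVneq (inner v v) 0.
  by rewrite inner_eq0 => /eqP ->; rewrite innerC !inner0l expr0n /= mulr0.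
have vp : 0 < inner v v by rewrite lt_neqAle eq_sym vn0 inner_ge0.
have := inner_ge0 (inner v v *: u - inner u v *: v).
rewrite !(innerBl, innerBr, innerZl, innerZr) (innerC v u) => H.
rewrite -subr_ge0 -(pmulr_rge0 _ vp); nra.
Qed.

Lemma cauchy_schwarz u v : `|inner u v| <= enorm u * enorm v.
Proof.
rewrite -(ler_pXn2r (n := 2)) ?nnegrE ?mulr_ge0 ?enorm_ge0 //.
by rewrite -normrX ger0_norm ?sqr_ge0 // exprMn !sqr_enorm cauchy_schwarz_sqr.
Qed.

Lemma enormD u v : enorm (u + v) <= enorm u + enorm v.
Proof.
rewrite -(ler_pXn2r (n := 2)) ?nnegrE ?addr_ge0 ?enorm_ge0 //.
rewrite sqr_enorm innerDl !innerDr sqrrD !sqr_enorm (innerC v u).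
have := le_trans (ler_norm _) (cauchy_schwarz u v); lra.
Qed.

Lemma continuous_entry (i j : 'I_2) : continuous (fun z => z i j : R).
Proof. exact: coord_continuous. Qed.

Lemma continuous_matrix (T : topologicalType) (f : T -> C2 R) t :
  (forall i j, {for t, continuous (fun s => f s i j)}) -> {for t, continuous f}.
Proof.
move=> H; apply/cvgrPdist_le => /= e e0; near=> x.
rewrite /Num.Def.normr/= mx_normrE (bigmax_le _ (ltW e0))//= => i _.
rewrite !mxE/=.
move: i; near: x; apply: filter_forall => /= i.
exact: ((cvgrPdist_le _ _).1 (H i.1 i.2)).
Unshelve. all: by end_near. Qed.

Lemma continuous_comp_at (T : topologicalType) (U V : topologicalType) (f : T -> U) (g : U -> V) t :
  {for t, continuous f} -> {for f t, continuous g} -> {for t, continuous (fun s => g (f s))}.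
Proof. exact: continuous_comp. Qed.

Lemma continuous_inner (T : topologicalType) (f g : T -> C2 R) t :
  {for t, continuous f} -> {for t, continuous g} ->
  {for t, continuous (fun s => inner (f s) (g s))}.
Proof.
move=> cf cg; rewrite (funext (fun s => innerE (f s) (g s))).
have ce (h : T -> C2 R) i j : {for t, continuous h} -> {for t, continuous (fun s => h s i j)}.
  by move=> ch; apply: (continuous_comp_at ch (g := fun z : C2 R => z i j)); exact: continuous_entry.
by do !(apply: continuousD || apply: continuousM); apply: ce.
Qed.

Lemma continuous_enorm (T : topologicalType) (f : T -> C2 R) t :
  {for t, continuous f} -> {for t, continuous (fun s => enorm (f s))}.
Proof.
by move=> cf; apply: (continuous_comp_at (continuous_inner cf cf)); exact: sqrt_continuous.
Qed.

Lemma continuous_rot (T : topologicalType) (f : T -> C2 R) (g : T -> R) t :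
  {for t, continuous f} -> {for t, continuous g} ->
  {for t, continuous (fun s => f s *m rot (g s) : C2 R)}.
Proof.
move=> cf cg; apply: continuous_matrix => i j.
have ce i' j' : {for t, continuous (fun s => f s i' j')}.
  by apply: (continuous_comp_at cf (g := fun z : C2 R => z i' j')); exact: continuous_entry.
have cc : {for t, continuous (fun s => cos (g s))}.
  by apply: (continuous_comp_at cg); exact: continuous_cos.
have cs : {for t, continuous (fun s => sin (g s))}.
  by apply: (continuous_comp_at cg); exact: continuous_sin.
have [->|->] := ord2P j.
- rewrite (funext (fun s => (rotE (f s) (g s) i).1)).
  by apply: continuousB; apply: continuousM => //; exact: ce.
- rewrite (funext (fun s => (rotE (f s) (g s) i).2)).
  by apply: continuousD; apply: continuousM => //; exact: ce.
Qed.
End Euclid.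

(** * Great arcs and the geodesic equation *)

Section Calculus.
Variable R : realType.
Implicit Types f g : R -> C2 R.

Lemma is_derive_matrix f (t : R) (df : C2 R) :
  (forall i j, is_derive t 1 (fun s => f s i j) (df i j)) -> is_derive t 1 f df.
Proof.
move=> H; have d : derivable f t 1 by apply/derivable_mxP => i j; exact: (@ex_derive _ _ _ _ _ _ _ (H i j)).
apply: DeriveDef => //; rewrite (derive_mx d); apply/matrixP => i j; rewrite mxE.
exact: (@derive_val _ _ _ _ _ _ _ (H i j)).
Qed.

Lemma is_derive_entry f (t : R) (df : C2 R) i j :
  is_derive t 1 f df -> is_derive t 1 (fun s => f s i j) (df i j).
Proof.
move=> [d e]; apply: DeriveDef; first exact: ((derivable_mxP f t 1).1 d).
by rewrite -e (derive_mx d) mxE.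
Qed.

Lemma derivable_continuous f (t : R) : derivable f t 1 -> {for t, continuous f}.
Proof. by move=> /derivable1_diffP; exact: differentiable_continuous. Qed.

Lemma is_derive_inner f g (t : R) (df dg : C2 R) : is_derive t 1 f df -> is_derive t 1 g dg ->
  is_derive t 1 (fun s => inner (f s) (g s)) (inner df (g t) + inner (f t) dg).
Proof.
move=> Hf Hg; rewrite (funext (fun s => innerE (f s) (g s))) !innerE.
have F i j := is_derive_entry i j Hf; have G i j := is_derive_entry i j Hg.
have P i j i' j' := @is_deriveM _ _ (fun s => f s i j) (fun s => g s i' j') _ _ _ _ (F i j) (G i' j').
apply: (is_derive_eq (is_deriveD
  (is_deriveD (P ord0 ord0 ord0 ord0) (P ord0 ord_max ord0 ord_max))
  (is_deriveD (P ord_max ord0 ord_max ord0) (P ord_max ord_max ord_max ord_max)))).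
by rewrite /GRing.scale /=; ring.
Qed.

Lemma is_derive_cos_mul (w t : R) : is_derive t 1 (fun s => cos (w * s)) (- w * sin (w * t)).
Proof.
have H : is_derive t 1 (fun s : R => w * s) w.
  apply: (is_derive_eq (is_deriveZ _ (is_derive_id t 1))); exact: mulr1.
apply: (is_derive_eq (@is_derive1_comp _ (@cos R) (fun s => w * s) t _ _ (is_derive_cos _) H)).
by ring.
Qed.

Lemma is_derive_sin_mul (w t : R) : is_derive t 1 (fun s => sin (w * s)) (w * cos (w * t)).
Proof.
have H : is_derive t 1 (fun s : R => w * s) w.
  apply: (is_derive_eq (is_deriveZ _ (is_derive_id t 1))); exact: mulr1.
apply: (is_derive_eq (@is_derive1_comp _ (@sin R) (fun s => w * s) t _ _ (is_derive_sin _) H)).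
by ring.
Qed.

Definition great_arc (a b : C2 R) (w t : R) : C2 R := cos (w * t) *: a + sin (w * t) *: b.

Lemma great_arc_derive (a b : C2 R) (w t : R) :
  is_derive t 1 (great_arc a b w) (w *: great_arc b (- a) w t).
Proof.
apply: is_derive_matrix => i j.
have E : is_derive t 1 (a i j *: (fun s => cos (w * s)) + b i j *: (fun s => sin (w * s)))
   (a i j *: (- w * sin (w * t)) + b i j *: (w * cos (w * t))).
  exact: (is_deriveD (is_deriveZ _ (is_derive_cos_mul w t)) (is_deriveZ _ (is_derive_sin_mul w t))).
have -> : (fun s => great_arc a b w s i j) = (a i j *: (fun s => cos (w * s)) + b i j *: (fun s => sin (w * s))).
  apply/funext => s; rewrite /great_arc !mxE.
  by transitivity (a i j * cos (w * s) + b i j * sin (w * s)); first by ring.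
by apply: (is_derive_eq E); rewrite /great_arc !mxE /GRing.scale /=; ring.
Qed.

Lemma great_arc_derive1 (a b : C2 R) (w : R) : derive1 (great_arc a b w) = fun t => w *: great_arc b (- a) w t.
Proof. by apply/funext => t; rewrite derive1E; exact: (@derive_val _ _ _ _ _ _ _ (great_arc_derive a b w t)). Qed.

Lemma derivable_great_arc (a b : C2 R) (w t : R) : derivable (great_arc a b w) t 1.
Proof. exact: (@ex_derive _ _ _ _ _ _ _ (great_arc_derive a b w t)). Qed.

Lemma great_arcZ (a b : C2 R) (w c t : R) : c *: great_arc a b w t = great_arc (c *: a) (c *: b) w t.
Proof. by rewrite /great_arc scalerDr !scalerA ![c * _]mulrC -!scalerA. Qed.

Lemma great_arc_C1 (a b : C2 R) (w : R) : C1 (great_arc a b w).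
Proof.
split=> [t|]; first exact: derivable_great_arc.
rewrite great_arc_derive1 (funext (great_arcZ _ _ _ _)) => t.
exact/derivable_continuous/derivable_great_arc.
Qed.

Lemma great_arc_inner (a b : C2 R) (w t : R) : inner a a = 1 -> inner b b = 1 -> inner a b = 0 ->
  inner (great_arc a b w t) (great_arc a b w t) = 1.
Proof.
move=> aa bb ab; rewrite /great_arc innerDl !innerDr !innerZl !innerZr (innerC b) ab aa bb.
by rewrite -[RHS](cos2Dsin2 (w * t)); ring.
Qed.

Lemma great_arc_geodesic (c : R -> @sphere3 R) (a b : C2 R) (w : R) : emb c = great_arc a b w ->
  sphere_geodesic c.
Proof.
move=> E t; rewrite /covariant_acceleration E.
have D1 := great_arc_derive1 a b w.
split; first exact: derivable_great_arc.
  rewrite D1 (funext (great_arcZ _ _ _ _)); exact: derivable_great_arc.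
have D2 : derive1n 2 (great_arc a b w) t = - w ^+ 2 *: great_arc a b w t.
  rewrite /= D1 (funext (great_arcZ _ _ _ _)) great_arc_derive1.
  rewrite /great_arc; apply/matrixP => i j; rewrite !mxE; ring.
have E2 : inner (great_arc a b w t) (great_arc a b w t) = 1.
  rewrite -E /emb; exact: (set_mem (valP (c t))).
by rewrite D2 innerZl E2 mulr1 subrr.
Qed.
End Calculus.

Section Geodesics.
Variable R : realType.

Lemma is_derive_unique (f : R -> R) (t d1 d2 : R) :
  is_derive t 1 f d1 -> is_derive t 1 f d2 -> d1 = d2.
Proof. by move=> H1 H2; rewrite -(@derive_val _ _ _ _ _ _ _ H1) (@derive_val _ _ _ _ _ _ _ H2). Qed.

Lemma is_derive_derive1 (g : R -> C2 R) (t : R) : derivable g t 1 -> is_derive t 1 g (derive1 g t).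
Proof. by move=> d; apply: DeriveDef => //; rewrite derive1E. Qed.

Lemma inner_perp (a : C2 R) : inner a (a *m rot (pi / 2)) = 0.
Proof. by rewrite innerE !(rotE _ _ _).1 !(rotE _ _ _).2 cos_pihalf sin_pihalf; ring. Qed.

Lemma exists_orthonormal (a : C2 R) : inner a a = 1 ->
  exists b : C2 R, inner b b = 1 /\ inner a b = 0.
Proof. by move=> aa; exists (a *m rot (pi / 2)); rewrite inner_rot inner_perp. Qed.

(** The geodesic equation forces constant speed [w], hence is the harmonic
    oscillator [f'' = - w^2 f]; its two first integrals are the coordinates of
    [f] in the rotating frame. *)
Lemma sphere_geodesic_great_arc (c : R -> @sphere3 R) : sphere_geodesic c ->
  exists a b w, [/\ inner a a = 1, inner b b = 1, inner a b = 0, 0 <= w &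
    emb c = great_arc a b w].
Proof.
move=> geo; pose f := emb c; pose f1 := derive1 f; pose f2 := derive1 f1.
have Hf (t : R) : is_derive t 1 f (f1 t).
  by have [d _ _] := geo t; exact: (is_derive_derive1 d).
have Hf1 (t : R) : is_derive t 1 f1 (f2 t).
  by have [_ d _] := geo t; exact: (is_derive_derive1 d).
have ff (t : R) : inner (f t) (f t) = 1 by exact: (set_mem (valP (c t))).
have f1f (t : R) : inner (f1 t) (f t) = 0.
  have E := is_derive_inner (Hf t) (Hf t).
  have /(is_derive_unique E) : is_derive t 1 (fun s => inner (f s) (f s)) 0.
    by rewrite (funext ff); exact: is_derive_cst.
  by rewrite (innerC (f t)); lra.
have f2f (t : R) : inner (f2 t) (f t) = - inner (f1 t) (f1 t).
  have E := is_derive_inner (Hf1 t) (Hf t).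
  have /(is_derive_unique E) : is_derive t 1 (fun s => inner (f1 s) (f s)) 0.
    by rewrite (funext f1f); exact: is_derive_cst.
  lra.
have eq2 (t : R) : f2 t = inner (f2 t) (f t) *: f t.
  have [_ _ E] := geo t; apply/eqP; rewrite -subr_eq0; apply/eqP; exact: E.
have speed (t : R) : inner (f1 t) (f1 t) = inner (f1 0) (f1 0).
  apply: (@is_derive_0_is_cst R (fun s => inner (f1 s) (f1 s))) => s.
  apply: (is_derive_eq (is_derive_inner (Hf1 s) (Hf1 s))).
  by rewrite eq2 (innerC (f1 s)) !innerZl (innerC (f s)) f1f; ring.
pose w := enorm (f1 0); have w0 : 0 <= w := enorm_ge0 _.
have f2E (t : R) : f2 t = - w ^+ 2 *: f t by rewrite eq2 f2f speed /w sqr_enorm.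
have [wz|wn] := eqVneq w 0.
  have [b [bb ab]] := exists_orthonormal (ff 0).
  exists (f 0), b, 0; split=> //; apply/funext => t.
  rewrite /great_arc mul0r cos0 sin0 scale1r scale0r addr0.
  apply/matrixP => i j; apply: (@is_derive_0_is_cst R (fun s => f s i j)) => s.
  apply: (is_derive_eq (is_derive_entry i j (Hf s))).
  have /eqP : inner (f1 s) (f1 s) = 0 by rewrite speed -sqr_enorm -/w wz expr0n.
  by rewrite inner_eq0 => /eqP ->; rewrite mxE.
have H i j (t : R) : is_derive t 1 (fun s => f s i j) (f1 t i j) by exact: is_derive_entry.
have H1 i j (t : R) : is_derive t 1 (fun s => f1 s i j) (- w ^+ 2 * f t i j).
  by have := is_derive_entry i j (Hf1 t); rewrite f2E mxE.
have Hc := is_derive_cos_mul w; have Hs := is_derive_sin_mul w.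
have U i j (t : R) : cos (w * t) * f t i j - w^-1 * (sin (w * t) * f1 t i j) = f 0 i j.
  transitivity (cos (w * 0) * f 0 i j - w^-1 * (sin (w * 0) * f1 0 i j)); last first.
    by rewrite mulr0 cos0 sin0; ring.
  apply: (@is_derive_0_is_cst R (fun s => cos (w * s) * f s i j - w^-1 * (sin (w * s) * f1 s i j))) => s.
  apply: (is_derive_eq (is_deriveB (is_deriveM (Hc s) (H i j s))
    (is_deriveZ w^-1 (is_deriveM (Hs s) (H1 i j s))))).
  by rewrite /GRing.scale /=; field.
have V i j (t : R) : sin (w * t) * f t i j + w^-1 * (cos (w * t) * f1 t i j) = w^-1 * f1 0 i j.
  transitivity (sin (w * 0) * f 0 i j + w^-1 * (cos (w * 0) * f1 0 i j)); last first.
    by rewrite mulr0 cos0 sin0; ring.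
  apply: (@is_derive_0_is_cst R (fun s => sin (w * s) * f s i j + w^-1 * (cos (w * s) * f1 s i j))) => s.
  apply: (is_derive_eq (is_deriveD (is_deriveM (Hs s) (H i j s))
    (is_deriveZ w^-1 (is_deriveM (Hc s) (H1 i j s))))).
  by rewrite /GRing.scale /=; field.
exists (f 0), (w^-1 *: f1 0), w; split=> //.
- by rewrite innerZl innerZr -sqr_enorm -/w; field.
- by rewrite innerZr innerC f1f mulr0.
- apply/funext => t; apply/matrixP => i j; rewrite /great_arc !mxE -(V i j t) -(U i j t).
  rewrite -/f; have E := cos2Dsin2 (w * t).
  by transitivity ((cos (w * t) ^+ 2 + sin (w * t) ^+ 2) * f t i j); [rewrite E mul1r | ring].
Qed.
End Geodesics.

(** * Length and angle on the sphere *)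

Section Length.
Variable R : realType.
Let mu := @lebesgue_measure R.

Lemma increment_le_integral (F dF g : R -> R) (a b : R) : a < b ->
  (forall t, a <= t <= b -> is_derive t 1 F (dF t)) ->
  (forall t, a <= t <= b -> {for t, continuous dF}) ->
  continuous g -> (forall t, a < t < b -> dF t <= g t) ->
  ((F b - F a)%:E <= \int[mu]_(t in `[a, b]) (g t)%:E)%E.
Proof.
move=> ab HF cdF cg dFg; pose f t := Order.min (dF t) (g t).
have cF t : a <= t <= b -> {for t, continuous F}.
  by move=> /HF [d _]; move: d => /derivable1_diffP; exact: differentiable_continuous.
have cf : {within `[a, b], continuous f}.
  apply: continuous_in_subspaceT => t; rewrite inE /= in_itv /= => tab.
  by apply: continuous_min; [exact: cdF | exact: cg].
have cg' : {within `[a, b], continuous g} by apply: continuous_subspaceT.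
(* [f] is continuous and below [g] also at the endpoints of the interval, where
   [dF <= g] is not assumed *)
have := @continuous_FTC2 R f F a b ab cf.
rewrite EFinB => <-.
- apply: le_integral => //.
  + by apply: continuous_compact_integrable => //; exact: segment_compact.
  + by apply: continuous_compact_integrable => //; exact: segment_compact.
  + by move=> t _; rewrite lee_fin /f ge_min lexx orbT.
- split.
  + by move=> t; rewrite in_itv /= => /andP[at_ tb]; have [] := HF t; rewrite ?ltW.
  + by apply: cvg_at_right_filter; apply: cF; rewrite lexx ltW.
  + by apply: cvg_at_left_filter; apply: cF; rewrite lexx ltW.
- move=> t; rewrite in_itv /= => /[dup] tab /andP[at_ tb].
  rewrite derive1E; have H : a <= t <= b by rewrite !ltW.
  by rewrite (@derive_val _ _ _ _ _ _ _ (HF t H)) /f min_l // dFg.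
Qed.

(** Only the part of [a] perpendicular to [x] contributes. *)
Lemma unit_perp_bound (x a y : C2 R) : inner x x = 1 -> inner a a = 1 -> inner y x = 0 ->
  `|inner y a| <= enorm y * Num.sqrt (1 - inner x a ^+ 2).
Proof.
move=> xx aa yx; have -> : inner y a = inner y (a - inner x a *: x).
  by rewrite innerBr innerZr yx mulr0 subr0.
apply: le_trans (cauchy_schwarz _ _) _; rewrite ler_wpM2l ?enorm_ge0 //.
rewrite /enorm ler_wsqrtr // !(innerBl, innerBr, innerZl, innerZr) xx aa (innerC a); lra.
Qed.

Lemma unit_inner_bound (x a : C2 R) : inner x x = 1 -> inner a a = 1 -> inner x a ^+ 2 <= 1.
Proof. by move=> xx aa; have := cauchy_schwarz_sqr x a; rewrite xx aa mulr1. Qed.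

(** Shrinking the inner product by [cos d < 1] keeps [acos] differentiable
    also where [f] meets [a] or its antipode. *)
Lemma shrunk_angle_step (f : R -> C2 R) (a : C2 R) (d s t : R) : s < t -> C1 f ->
  0 < d < pi / 2 -> inner a a = 1 -> (forall r, s <= r <= t -> inner (f r) (f r) = 1) ->
  ((acos (cos d * inner (f t) a) - acos (cos d * inner (f s) a))%:E
    <= \int[mu]_(r in `[s, t]) (enorm (derive1 f r))%:E)%E.
Proof.
move=> st [df cf1] /andP[d0 d2] aa ff.
have Hf (r : R) : is_derive r 1 f (derive1 f r) by exact: is_derive_derive1.
pose q r := cos d * inner (f r) a.
pose dq r := cos d * inner (derive1 f r) a.
have Hq (r : R) : is_derive r 1 q (dq r).
  have := is_deriveZ (cos d) (is_derive_inner (Hf r) (is_derive_cst a r 1)).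
  by rewrite (innerC _ 0) inner0l addr0; apply.
have cd : 0 < cos d < 1.
  have d' : - (pi / 2) < d < pi / 2 by rewrite d2 andbT; lra.
  rewrite cos_gt0_pihalf //= -cos0 ltr_cos ?in_itv /= ?lexx ?pi_ge0 //; lra.
have q1 r : s <= r <= t -> -1 < q r < 1.
  move=> /ff fr; have := unit_inner_bound fr aa; rewrite /q; move: cd (inner _ _) => /andP[c0 c1] z z1.
  have z2 : -1 <= z <= 1 by apply/andP; split; nra.
  apply/andP; split; nra.
have cq (r : R) : {for r, continuous q} by apply: differentiable_continuous; apply/derivable1_diffP; have [] := Hq r.
have cdq (r : R) : {for r, continuous dq}.
  apply: continuousM; first exact: cst_continuous.
  by apply: continuous_inner; [exact: cf1 | exact: cst_continuous].
pose den r := Num.sqrt (1 - q r ^+ 2).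
have den0 r : s <= r <= t -> 0 < den r.
  by move=> /q1 /andP[h1 h2]; rewrite /den sqrtr_gt0; nra.
apply: (@increment_le_integral (fun r => acos (q r)) (fun r => - (den r)^-1 * dq r)) => //.
- move=> r rst; have H := @is_derive1_comp _ (@acos R) q r _ _ (is_derive1_acos (q1 r rst)) (Hq r).
  exact: (is_derive_eq H).
- move=> r rst; apply: continuousM => //; apply: continuousN; apply: continuousV.
    by rewrite gt_eqF ?den0.
  apply: (@continuous_comp_at R R R (fun r => 1 - q r ^+ 2) (@Num.sqrt R)); last exact: sqrt_continuous.
  by apply: continuousB; [exact: cst_continuous | exact: continuousM].
- by move=> r; apply: continuous_enorm; exact: cf1.
- move=> r /andP[sr rt]; have rst : s <= r <= t by rewrite !ltW.
  have perp : inner (derive1 f r) (f r) = 0.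
    have E := is_derive_inner (Hf r) (Hf r).
    have C : is_derive r 1 (fun s => inner (f s) (f s)) 0.
      have near1 : \near r, cst (1:R) r = inner (f r) (f r).
        have : r \in `]s, t[ by rewrite in_itv /= sr rt.
        move=> /near_in_itvoo; apply: filterS => z; rewrite in_itv /= => /andP[h1 h2].
        by rewrite ff // !ltW.
      exact: (@near_eq_is_derive _ _ _ (cst (1:R)) (fun s => inner (f s) (f s)) r 1 0 near1 (is_derive_cst (1:R) r 1)).
    by have := is_derive_unique E C; rewrite (innerC (f r)); lra.
  have B := unit_perp_bound (ff r rst) aa perp.
  have D := den0 r rst.
  rewrite mulNr -mulrN mulrC ler_pdivrMr //.
  (* with [c = cos d], this is [c^2 (1 - z^2) <= 1 - c^2 z^2] *)
  have : cos d * Num.sqrt (1 - inner (f r) a ^+ 2) <= den r.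
    have /andP[c0 c1] := cd; have I := unit_inner_bound (ff r rst) aa.
    have -> A : cos d * Num.sqrt A = Num.sqrt (cos d ^+ 2 * A).
      by rewrite sqrtrM ?sqr_ge0 // sqrtr_sqr ger0_norm ?ltW.
    by apply: ler_wsqrtr; rewrite /q; nra.
  move: B; rewrite ler_norml => /andP[B _] B2; rewrite /dq.
  have /andP[c0 c1] := cd; have e0 := enorm_ge0 (derive1 f r).
  apply: (@le_trans _ _ (cos d * (enorm (derive1 f r) * Num.sqrt (1 - inner (f r) a ^+ 2)))).
    by rewrite -mulrN ler_pM2l //; lra.
  by rewrite mulrCA ler_wpM2l.
Qed.

Definition speed (kappa : R) (c : R -> @sphere3 R) (t : R) : R :=
  Num.sqrt (kappa^-1 * inner (derive1 (emb c) t) (derive1 (emb c) t)).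

Lemma curve_lengthE kappa (c : R -> @sphere3 R) :
  curve_length kappa c = (\int[mu]_(t in `[0%R, 1%R]) (speed kappa c t)%:E)%E.
Proof. by []. Qed.

(** Induction over the break points.  The speed may be arbitrary at these points,
    so the integral of a piece is computed on the open interval. *)
Lemma piecewise_prefix (kappa : R) (c : R -> @sphere3 R) (d : R) (s : seq R) (k : nat) :
  0 < kappa -> 0 < d < pi / 2 ->
  path <%R 0 s -> (forall i, (i < size s)%N -> exists2 f : R -> C2 R, C1 f &
        {in `[nth 0 (0 :: s) i, nth 0 s i], emb c =1 f}) -> (k <= size s)%N ->
  let a := emb c 0 in let e := nth 0 (0 :: s) k in
  [/\ 0 <= e, measurable_fun `[0, e] (speed kappa c) &
   ((Num.sqrt kappa^-1 * (acos (cos d * inner (emb c e) a) - acos (cos d * inner (emb c 0) a)))%:E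
    <= \int[mu]_(t in `[0%R, e]) (speed kappa c t)%:E)%E].
Proof.
move=> k0 d12 ps pcs + a; elim: k => [|k IH] ks e.
  rewrite /e /= set_itv1; split=> //; first exact: measurable_fun_set1.
  by rewrite subrr mulr0 integral_set1 lexx.
have [] := IH (ltnW ks); set e0 := nth 0 (0 :: s) k => e00 me0 ie0.
have e0e : e0 < e by have /(pathP 0) := ps; apply.
have [f C1f cf] := pcs k ks; rewrite -/e0 -[nth 0 s k]/e in cf.
have cfE t : e0 <= t <= e -> emb c t = f t by move=> h; apply: cf; rewrite in_itv /=.
have sp t : e0 < t < e -> speed kappa c t = Num.sqrt kappa^-1 * enorm (derive1 f t).
  move=> te; have D : derive1 (emb c) t = derive1 f t.
    rewrite !derive1E; apply: near_eq_derive.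
    have : t \in `]e0, e[ by rewrite in_itv.
    move=> /near_in_itvoo; apply: filterS => z; rewrite in_itv /= => /andP[h1 h2].
    by rewrite cfE // !ltW.
  by rewrite /speed D sqrtrM // invr_ge0 ltW.
pose g t := Num.sqrt kappa^-1 * enorm (derive1 f t).
have cg t : {for t, continuous g}.
  apply: continuousM; first exact: cst_continuous.
  by apply: continuous_enorm; exact: C1f.2.
have mg A : measurable_fun A g.
  by apply: measurable_funTS; exact: continuous_measurable_fun.
have moo : measurable_fun `]e0, e[ (speed kappa c).
  by apply: (eq_measurable_fun _ _ (mg _)) => t; rewrite inE /= in_itv /= => /sp ->.
have moc : measurable_fun `]e0, e] (speed kappa c).
  rewrite -(setUitv1 true) ?bnd_simp //.
  by apply/measurable_funU => //; split => //; exact: measurable_fun_set1.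
have U : `[0, e]%classic = `[0, e0] `|` `]e0, e].
  by rewrite -itv_bndbnd_setU ?bnd_simp // ltW.
have mU : measurable_fun (`[0, e0] `|` `]e0, e]) (speed kappa c).
  by apply/measurable_funU.
split; [exact: le_trans e00 (ltW e0e) | by rewrite U |].
rewrite U ge0_integral_setU //=; first last.
- apply/disj_setPRL => t /=; rewrite !in_itv /= => /andP[h _] /andP[_ h']; lra.
- by move=> t _; rewrite lee_fin sqrtr_ge0.
- exact/measurable_EFinP.
rewrite -(@integral_itv_bndo_bndc R (BRight e0) e); last by apply/measurable_EFinP.
have -> : (\int[mu]_(x in `]e0, e[) (speed kappa c x)%:E = \int[mu]_(x in `[e0, e]) (g x)%:E)%E.
  transitivity (\int[mu]_(x in `]e0, e[) (g x)%:E)%E.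
    by apply: eq_integral => t; rewrite inE /= in_itv /= => /sp ->.
  by rewrite integral_itv_bndo_bndc ?integral_itv_obnd_cbnd //; exact/measurable_EFinP.
have aa : inner a a = 1 by exact: (set_mem (valP (c 0))).
have ff r : e0 <= r <= e -> inner (f r) (f r) = 1.
  by move=> h; rewrite -cfE //; exact: (set_mem (valP (c r))).
have step := shrunk_angle_step e0e C1f d12 aa ff.
have E : (\int[mu]_(x in `[e0, e]) (g x)%:E = (Num.sqrt kappa^-1)%:E * \int[mu]_(x in `[e0, e]) (enorm (derive1 f x))%:E)%E.
  under eq_integral do rewrite /g EFinM.
  rewrite ge0_integralZl ?lee_fin ?sqrtr_ge0 //.
  - apply/measurable_EFinP; apply: measurable_funTS; apply: continuous_measurable_fun.
    by move=> t; apply: continuous_enorm; exact: C1f.2.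
  - by move=> t _; rewrite lee_fin enorm_ge0.
rewrite E; apply: le_trans (leeD ie0 (lee_wpmul2l _ step)); last by rewrite lee_fin sqrtr_ge0.
have e1 : e0 <= e <= e by rewrite lexx ltW.
have e2 : e0 <= e0 <= e by rewrite lexx ltW.
rewrite -EFinM -EFinD lee_fin -mulrDr -(cfE e e1) -(cfE e0 e2).
by rewrite le_eqVlt; apply/orP; left; apply/eqP; ring.
Qed.

(** Summing [shrunk_angle_step] over the pieces bounds the shrunk angle by the
    length; the shrinking parameter then tends to 0. *)
Lemma angle_le_length (kappa : R) (c : R -> @sphere3 R) (w : R) :
  0 < kappa -> piecewise_C1 c -> 0 <= w <= pi ->
  inner (emb c 1) (emb c 0) <= cos w ->
  ((Num.sqrt kappa^-1 * w)%:E <= curve_length kappa c)%E.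
Proof.
move=> k0 [s [ps s1 pcs]] /andP[w0 wpi] cw; rewrite curve_lengthE leNgt; apply/negP => lt.
pose I := (\int[mu]_(t in `[0%R, 1%R]) (speed kappa c t)%:E)%E.
have I0 : (0 <= I)%E by apply: integral_ge0 => t _; rewrite lee_fin sqrtr_ge0.
have Ifin : I \is a fin_num by rewrite ge0_fin_numE // (lt_trans lt) ?ltry.
have sk : 0 < Num.sqrt kappa^-1 by rewrite sqrtr_gt0 invr_gt0.
pose L := fine I / Num.sqrt kappa^-1.
have L0 : 0 <= L by rewrite divr_ge0 ?fine_ge0 // ltW.
have Lw : L < w by rewrite /L ltr_pdivrMr // mulrC -lte_fin fineK.
have aa : inner (emb c 0) (emb c 0) = 1 by exact: (set_mem (valP (c 0))).
have cc : inner (emb c 1) (emb c 1) = 1 by exact: (set_mem (valP (c 1))).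
have pi0 := pi_gt0 R.
set z := inner (emb c 1) (emb c 0) in cw.
have z2 : z ^+ 2 <= 1 by apply: unit_inner_bound.
have key d : 0 < d < pi / 2 -> L + d < pi -> cos (L + d) <= cos d * z.
  move=> d12 Ld; have := piecewise_prefix k0 d12 ps pcs (leqnn _).
  have -> : nth 0 (0 :: s) (size s) = 1 by rewrite -[size s]/((size (0 :: s)).-1) nth_last.
  move=> [_ _ H0]; move: H0; rewrite -/I -(fineK Ifin) aa mulr1 lee_fin -/z => H0.
  have /andP[d0 d2] := d12.
  have H : acos (cos d * z) - d <= L.
    rewrite /L ler_pdivlMr // mulrC; move: H0; rewrite cosK //.
    by rewrite in_itv /= ltW //=; lra.
  have cd : 0 <= cos d <= 1.
    by rewrite cos_le1 andbT cos_ge0_pihalf //; apply/andP; split; lra.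
  have q1 : -1 <= cos d * z <= 1.
    move: cd => /andP[h1 h2]; have /andP[z1 z3] : -1 <= z <= 1 by apply/andP; split; nra.
    by apply/andP; split; nra.
  have qi : cos d * z \in `[-1, 1] by rewrite in_itv.
  rewrite -(acosK qi) leNgt ltr_cos ?in_itv /= -?leNgt; first lra.
  - by apply/andP; split; lra.
  - by rewrite acos_ge0 //= acos_lepi.
have lim : cos L <= z.
  have -> : cos L = cos (L + 0) by rewrite addr0.
  have -> : z = cos 0 * z by rewrite cos0 mul1r.
  have cl : cos (L + d) @[d --> (0:R)^'+] --> cos (L + 0).
    apply: cvg_at_right_filter; apply: (@continuous_comp_at R R R (fun d => L + d) (@cos R)); last exact: continuous_cos.
    by apply: continuousD; [exact: cst_continuous | exact: id].
  have cr : cos d * z @[d --> (0:R)^'+] --> cos 0 * z.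
    apply: cvg_at_right_filter; apply: cvgM; last exact: cvg_cst.
    exact: continuous_cos.
  apply: (ler_cvg_to cl cr); near=> d; apply: key.
  - by apply/andP; split; near: d; [exact: nbhs_right_gt | apply: nbhs_right_lt; lra].
  - by rewrite -ltrBrDl; near: d; apply: nbhs_right_lt; lra.
have : cos w < cos L by rewrite ltr_cos ?in_itv /=; lra.
by rewrite ltNge (le_trans lim).
Unshelve. all: by end_near. Qed.

Lemma great_arc_length (kappa : R) (c : R -> @sphere3 R) (a b : C2 R) (w : R) :
  0 < kappa -> inner a a = 1 -> inner b b = 1 -> inner a b = 0 -> 0 <= w ->
  emb c = great_arc a b w -> curve_length kappa c = (Num.sqrt kappa^-1 * w)%:E.
Proof.
move=> k0 aa bb ab w0 E; rewrite curve_lengthE.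
have sp t : speed kappa c t = Num.sqrt kappa^-1 * w.
  rewrite /speed E great_arc_derive1 innerZl innerZr great_arc_inner //.
  - by rewrite mulr1 -expr2 sqrtrM ?invr_ge0 ?ltW // sqrtr_sqr ger0_norm.
  - by rewrite -scaleN1r innerZl innerZr aa; ring.
  - by rewrite -scaleN1r innerZr innerC ab mulr0.
under eq_integral do rewrite sp.
rewrite (integral_cst mu) //= lebesgue_measure_itv /= lte_fin ltr01 sube0 mule1 //.
Qed.

Lemma great_arc_piecewise (c : R -> @sphere3 R) (a b : C2 R) (w : R) :
  emb c = great_arc a b w -> piecewise_C1 c.
Proof.
move=> E; exists [:: 1]; split=> /=; first by rewrite ltr01.
  by [].
by case=> // _; exists (great_arc a b w); [exact: great_arc_C1 | move=> t _; rewrite E].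
Qed.
End Length.

(** * The action of Z_p and the lens space *)

Section Trig.
Variable R : realType.

Lemma cos_2pi_int (n : int) : cos (2 * pi * n%:~R) = 1 :> R /\ sin (2 * pi * n%:~R) = 0 :> R.
Proof.
have nat_case (k : nat) : cos (2 * pi * k%:R) = 1 :> R /\ sin (2 * pi * k%:R) = 0 :> R.
  have -> : 2 * pi * k%:R = 0 + (pi *+ 2) *+ k :> R by rewrite add0r -(mulr_natr (pi *+ 2) k) -(mulr_natl pi 2).
  elim: k => [|k [IH1 IH2]]; first by rewrite mulr0n addr0 cos0 sin0.
  by rewrite mulrSr addrA cosD2pi sinD2pi IH1 IH2.
case: n => k; first exact: nat_case.
rewrite NegzE mulrNz mulrN cosN sinN; have [-> ->] := nat_case k.+1.
by rewrite oppr0.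
Qed.

Lemma cos_eq1_int (t : R) : cos t = 1 -> exists n : int, t = 2 * pi * n%:~R.
Proof.
move=> ct; have p0 : 0 < 2 * pi :> R by have := pi_gt0 R; lra.
pose n := Num.floor (t / (2 * pi)); exists n.
pose r := t - 2 * pi * n%:~R.
have r0 : 0 <= r.
  rewrite /r subr_ge0 mulrC -ler_pdivlMr //; exact: Num.Theory.floor_le.
have r1 : r < 2 * pi.
  have := Num.Theory.floorD1_gt (t / (2 * pi)); rewrite -/n intrD ltr_pdivrMr // /r; lra.
have cr : cos r = 1.
  have [c s] := cos_2pi_int n.
  by rewrite /r cosB ct c s; ring.
have [/eqP|rn] := eqVneq r 0; first by rewrite subr_eq0 => /eqP.
have s2 : sin (r / 2) = 0.
  apply/eqP; rewrite -sqrf_eq0 sin2cos2.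
  have := cos_mulr2n (r / 2); rewrite mulr2n -splitr cr => E; lra.
have : 0 < sin (r / 2) by apply: sin_gt0_pi; apply/andP; split; lra.
by rewrite s2 ltxx.
Qed.

Lemma rot_2pi_int (n : int) : rot (2 * pi * n%:~R) = 1%:M :> 'M[R]_2.
Proof.
have [c s] := cos_2pi_int n; apply/matrixP => i j; rewrite !mxE c s oppr0.
by case: (i == j) => //=; rewrite if_same.
Qed.

Lemma rot_fix (z : C2 R) (t : R) : z != 0 -> z *m rot t = z -> cos t = 1.
Proof.
rewrite -inner_eq0 => zn E; apply: (mulfI zn); rewrite mulr1 -{3}E.
by rewrite innerE [RHS]innerE !(rotE _ _ _).1 !(rotE _ _ _).2; ring.
Qed.
End Trig.

Section LensAct.
Local Open Scope quotient_scope.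
Variables (R : realType) (p : nat).
Hypothesis p_gt0 : (0 < p)%N.
Let pR : p%:R != 0 :> R. Proof. by rewrite pnatr_eq0 -lt0n. Qed.

(** The action is free: a rotation that fixes a non-zero vector has an angle in
    [2 pi Z]. *)
Lemma lens_act_fix (m : int) (z : C2 R) : z != 0 -> lens_act p m z = z -> (p %| m)%Z.
Proof.
move=> zn /(rot_fix zn) /cos_eq1_int [n E]; apply/dvdzP; exists n.
apply/eqP; rewrite -(@eqr_int R) rmorphM /=; apply/eqP.
have p0 : 2 * pi != 0 :> R by have := pi_gt0 R; lra.
apply: (mulfI p0); rewrite mulrA -E -pmulrn; field.
exact: pR.
Qed.

Lemma lens_act_dvd (m : int) (z : C2 R) : (p %| m)%Z -> lens_act p m z = z.
Proof.
case/dvdzP => n ->; rewrite /lens_act rmorphM /= -pmulrn.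
have -> : 2 * pi * (n%:~R * p%:R) / p%:R = 2 * pi * n%:~R :> R by field.
by rewrite rot_2pi_int mulmx1.
Qed.

Lemma lens_actB u v m : lens_act p m (u - v) = lens_act p m u - lens_act p m v :> C2 R.
Proof. exact: mulmxBl. Qed.

Lemma lens_actDv u v m : lens_act p m (u + v) = lens_act p m u + lens_act p m v :> C2 R.
Proof. exact: mulmxDl. Qed.

Lemma lens_actZ a u m : lens_act p m (a *: u) = a *: lens_act p m u :> C2 R.
Proof. by rewrite /lens_act -scalemxAl. Qed.

Lemma lens_act_inner u v m : inner (lens_act p m u) (lens_act p m v) = inner u v :> R.
Proof. exact: inner_rot. Qed.

Lemma lens_act_enorm u m : enorm (lens_act p m u) = enorm u :> R.
Proof. exact: enorm_rot. Qed.

Lemma lens_actK m z : lens_act p (- m) (lens_act p m z) = z :> C2 R.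
Proof. by rewrite lens_actD addrN lens_act0. Qed.

Lemma sphereE (x : @sphere3 R) : inner (\val x) (\val x) = 1.
Proof. exact: (set_mem (valP x)). Qed.

Lemma sphere_neq0 (x : @sphere3 R) : \val x != 0.
Proof. by rewrite -inner_eq0 sphereE oner_eq0. Qed.

Definition to_sphere (z : C2 R) (h : inner z z = 1) : @sphere3 R := SigSub (mem_set h).

Lemma sact_subproof (m : int) (x : @sphere3 R) :
  inner (lens_act p m (\val x)) (lens_act p m (\val x)) = 1.
Proof. by rewrite lens_act_inner sphereE. Qed.

Definition sact m x := to_sphere (sact_subproof m x).

Lemma val_sact m x : \val (sact m x) = lens_act p m (\val x). Proof. by []. Qed.

Lemma lens_projP (x y : @sphere3 R) :
  lens_proj p x = lens_proj p y <-> exists m : int, lens_act p m (\val x) = \val y.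
Proof.
split=> [|H].
  by move/eqmodP => /= /asboolP.
by apply/eqmodP; apply/asboolP.
Qed.

Lemma lens_proj_sact m x : lens_proj p (sact m x) = lens_proj p x.
Proof. by symmetry; apply/lens_projP; exists m. Qed.

Lemma lens_proj_surj (l : lens_space R p) : exists x, lens_proj p x = l.
Proof. by exists (repr l); exact: reprK. Qed.

Lemma continuous_lens_proj : continuous (@lens_proj R p).
Proof. exact: pi_continuous. Qed.

Lemma enorm_entry (z : C2 R) i j : `|z i j| <= enorm z.
Proof.
rewrite -sqrtr_sqr; apply: ler_wsqrtr; rewrite innerE.
by case: (ord2P i) => ->; case: (ord2P j) => ->; nra.
Qed.

Lemma norm_le_enorm (z : C2 R) : `|z| <= enorm z.
Proof.
rewrite [leLHS]/Num.Def.normr/= mx_normrE (bigmax_le _ (enorm_ge0 z)) //= => -[i j] _.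
exact: enorm_entry.
Qed.

Lemma continuous_sphere_val : continuous (fun x : @sphere3 R => \val x : C2 R).
Proof. exact: initial_continuous. Qed.

(** The topology of the sphere as a subspace of C^2 is that of the Euclidean norm. *)
Lemma nbhs_sphereP (x : @sphere3 R) (U : set (@sphere3 R)) :
  nbhs x U <-> exists2 e, 0 < e & forall y : @sphere3 R, enorm (\val y - \val x) < e -> U y.
Proof.
split=> [|[e e0 H]].
  case=> _ [/= [W oW <-]] Wx WU; move: oW; rewrite openE => /(_ _ Wx).
  move/nbhs_ballP => [e /= e0 He]; exists e => // y yx.
  apply: WU; apply: He; rewrite -ball_normE /ball_ /= distrC.
  exact: le_lt_trans (norm_le_enorm _) yx.
have c : {for x, continuous (fun y : @sphere3 R => enorm (\val y - \val x))}.
  apply: continuous_enorm; apply: continuousB; first exact: continuous_sphere_val.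
  exact: cst_continuous.
have : nbhs (enorm (\val x - \val x)) [set r | r < e].
  by apply: open_nbhs_nbhs; split; [exact: open_lt | rewrite /= subrr enorm0].
move=> /c Hn; have : nbhs x [set y : @sphere3 R | enorm (\val y - \val x) < e] by exact: Hn.
by apply: filterS => y; exact: H.
Qed.

Lemma continuous_sact m : continuous (sact m).
Proof.
move=> x U /nbhs_sphereP [e e0 H]; apply/nbhs_sphereP; exists e => // y yx.
by apply: H; rewrite !val_sact -lens_actB lens_act_enorm.
Qed.

(** The saturation of an open set is the union of its translates. *)
Lemma lens_proj_open (U : set (@sphere3 R)) : open U -> open [set lens_proj p x | x in U].
Proof.
move=> oU; rewrite /open /= /quotient_open.
have -> : \pi_(lens_space R p) @^-1` [set lens_proj p x | x in U]
   = \bigcup_(m in [set: int]) (sact m @^-1` U).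
  apply/seteqP; split=> x /=.
    case=> y Uy /lens_projP [m E]; exists (- m) => //=.
    suff -> : sact (- m) x = y by [].
    by apply/val_inj; rewrite val_sact -E lens_actK.
  by case=> m _ /= Ux; exists (sact m x) => //; exact: lens_proj_sact.
by apply: bigcup_open => m _; apply: open_comp => // z _; exact: continuous_sact.
Qed.

Lemma lens_proj_nbhs (x : @sphere3 R) (U : set (@sphere3 R)) :
  nbhs x U -> nbhs (lens_proj p x) [set lens_proj p y | y in U].
Proof.
rewrite !nbhsE => -[V [oV Vx] VU].
exists [set lens_proj p y | y in V]; last exact: image_subset.
by split; [exact: lens_proj_open | exists x].
Qed.

Lemma finite_pos_min (a : nat -> R) n : (forall k, (k < n)%N -> 0 < a k) ->
  exists2 e, 0 < e & forall k, (k < n)%N -> e <= a k.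
Proof.
elim: n => [_|n IH H]; first by exists 1.
have [k kn|e e0 He] := IH; first exact: H (ltnW kn).
exists (Num.min e (a n)) => [|k]; first by rewrite lt_min e0 H.
rewrite ltnS leq_eqVlt => /orP[/eqP ->|kn]; first by rewrite ge_min lexx orbT.
by rewrite ge_min He.
Qed.

Lemma lens_act_eqmod (m l : int) (z : C2 R) : (p %| m - l)%Z -> lens_act p m z = lens_act p l z.
Proof. by move=> d; rewrite -{1}(subrK l m) -lens_actD (lens_act_dvd z). Qed.

Lemma lens_act_modn (m : int) :
  exists2 k : nat, (k < p)%N & forall z : C2 R, lens_act p m z = lens_act p k z.
Proof.
have p0 : p%:Z != 0 by rewrite eqz_nat -lt0n.
have m0 := modz_ge0 m p0.
exists `|(m %% p)%Z|%N => [|z].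
  by rewrite -ltz_nat gez0_abs // ltz_pmod // ltz_nat.
rewrite gez0_abs // {1}(divz_eq m p) -lens_actD (lens_act_dvd z) //.
exact: dvdz_mull.
Qed.

(** Distinct fibres are finite sets, so their points stay at a positive
    distance; tubes of half that radius separate them. *)
Lemma lens_space_hausdorff : hausdorff_space (lens_space R p).
Proof.
rewrite open_hausdorff => l1 l2 l12.
have [u Eu] := lens_proj_surj l1; have [v Ev] := lens_proj_surj l2.
pose a k := enorm (lens_act p k%:Z (\val u) - \val v).
have [k kp|e e0 He] := @finite_pos_min a p.
  rewrite lt_neqAle enorm_ge0 andbT eq_sym enorm_eq0 subr_eq0.
  apply/negP => /eqP E; case/eqP: l12; rewrite -Eu -Ev.
  by apply/lens_projP; exists k.
have He' m : e <= enorm (lens_act p m (\val u) - \val v).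
  by have [k kp ->] := lens_act_modn m; exact: He.
pose B (w : @sphere3 R) := [set x : @sphere3 R | enorm (\val x - \val w) < e / 2].
have oB w : open (B w).
  rewrite openE => x Bx; apply/nbhs_sphereP; exists (e / 2 - enorm (\val x - \val w)).
    by rewrite subr_gt0.
  move=> y yx; rewrite /B /=; have := enormD (\val y - \val x) (\val x - \val w).
  by rewrite subrKA; lra.
have Bw w : B w w by rewrite /B /= subrr enorm0 divr_gt0.
exists ([set lens_proj p x | x in B u], [set lens_proj p x | x in B v]).
  by split; rewrite inE /=; [exists u | exists v].
split; try exact: lens_proj_open.
apply/eqP/seteqP; split=> // l [/= [x Bx xl] [y By yl]].
have /lens_projP [m xy] : lens_proj p x = lens_proj p y by rewrite xl yl.
have := He' m; rewrite leNgt => /negP; apply.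
have := enormD (lens_act p m (\val u) - \val y) (\val y - \val v).
rewrite subrKA -xy -lens_actB lens_act_enorm -(enormN (\val u - _)) opprB.
by rewrite /B /= in Bx By; rewrite xy; lra.
Qed.
End LensAct.

(** * Minimizing geodesics of the lens space *)

Section Minimizing.
Variables (R : realType) (p : nat) (kappa : R).
Hypotheses (p_gt0 : (0 < p)%N) (kappa_gt0 : 0 < kappa).

Definition arc_to_sphere (a b : C2 R) (w : R) (aa : inner a a = 1) (bb : inner b b = 1)
  (ab : inner a b = 0) (t : R) : @sphere3 R := to_sphere (great_arc_inner w t aa bb ab).

Lemma great_arc0 (a b : C2 R) (w : R) : great_arc a b w 0 = a.
Proof. by rewrite /great_arc mulr0 cos0 sin0 scale1r scale0r addr0. Qed.

Lemma great_arc1 (a b : C2 R) (w : R) : great_arc a b w 1 = cos w *: a + sin w *: b.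
Proof. by rewrite /great_arc mulr1. Qed.

Lemma exists_great_arc (x v : C2 R) : inner x x = 1 -> inner v v = 1 ->
  exists b w, [/\ inner b b = 1, inner x b = 0, 0 <= w <= pi & great_arc x b w 1 = v].
Proof.
move=> xx vv; have := unit_inner_bound xx vv; set z := inner x v => z2.
have z1 : -1 <= z <= 1 by apply/andP; split; nra.
pose w := acos z; have w0 : 0 <= w <= pi by rewrite acos_ge0 ?acos_lepi.
have cw : cos w = z by rewrite /w acosK // in_itv.
have perp : inner (v - cos w *: x) (v - cos w *: x) = sin w ^+ 2.
  by rewrite sin2cos2 !(innerBl, innerBr, innerZl, innerZr) xx vv (innerC v) -/z cw; ring.
have [s0|sn] := eqVneq (sin w) 0.
  have [b [bb xb]] := exists_orthonormal xx; exists b, w; split=> //.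
  rewrite great_arc1 s0 scale0r addr0; apply/esym/eqP; rewrite -subr_eq0 -inner_eq0 perp s0.
  by rewrite expr0n.
exists ((sin w)^-1 *: (v - cos w *: x)), w; split=> //.
- by rewrite innerZl innerZr perp; field.
- by rewrite innerZr innerBr innerZr xx -/z cw; ring.
- by rewrite great_arc1 scalerA divff // scale1r addrC subrK.
Qed.

(** A curve between the same endpoints of the lens space lifts to one that joins
    two points of the orbits of [c 0] and [c 1]; the angle between these is at
    least [w] by the last hypothesis. *)
Lemma great_arc_minimizing (c : R -> @sphere3 R) (a b : C2 R) (w : R) :
  inner a a = 1 -> inner b b = 1 -> inner a b = 0 -> 0 <= w <= pi ->
  emb c = great_arc a b w ->
  (forall m, inner a (lens_act p m (emb c 1)) <= cos w) ->
  @minimizing_geodesics R p kappa (fun t => lens_proj p (c (\val t))).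
Proof.
move=> aa bb ab w0pi E maxw; have /andP[w0 wpi] := w0pi; split.
  have cc : continuous c.
    move=> t U /nbhs_sphereP [e e0 H].
    have ce : {for t, continuous (fun s => enorm (emb c s - emb c t))}.
      apply: continuous_enorm; apply: continuousB; last exact: cst_continuous.
      rewrite E; exact/derivable_continuous/derivable_great_arc.
    have /ce Hn : nbhs (enorm (emb c t - emb c t)) [set r | r < e].
      by apply: open_nbhs_nbhs; split; [exact: open_lt | rewrite /= subrr enorm0].
    have : nbhs t [set s | enorm (emb c s - emb c t) < e] by exact: Hn.
    by apply: filterS => s; exact: H.
  move=> t; apply: (@continuous_comp_at (@unit_interval R) _ _ (fun t => c (\val t)) (@lens_proj R p)).
    apply: (@continuous_comp_at (@unit_interval R) _ _ (fun t => \val t) c); last exact: cc.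
    exact: initial_continuous.
  exact: continuous_lens_proj.
exists c; split; [exact: (great_arc_geodesic E) | by move=> t |].
move=> c' pc' /esym /lens_projP [i Ei] /esym /lens_projP [j Ej].
rewrite (great_arc_length kappa_gt0 aa bb ab w0 E).
apply: angle_le_length => //; rewrite /emb -Ei -Ej /=.
rewrite -[leLHS](lens_act_inner p _ _ (- i)) lens_actK lens_actD innerC.
have -> : \val (c 0) = a by rewrite -[LHS]/(emb c 0) E great_arc0.
exact: maxw.
Qed.

(** The geodesic is a great arc; it is compared with the great arcs from [x] to all
    the points of the orbit of [y].  Since no point of that orbit is antipodal to
    [x], the arc is shorter than [pi] and its midpoint is the normalized sum of
    its endpoints. *)
Lemma minimizer_midpoint (g : {compact-open, @unit_interval R -> lens_space R p})
   (x y : @sphere3 R) (h : @unit_interval R) : \val h = 1 / 2 ->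
  @minimizing_geodesics R p kappa g ->
  path_start g = lens_proj p x -> path_end g = lens_proj p y ->
  (forall m, \val x + lens_act p m (\val y) != 0) ->
  exists m, (forall m', inner (\val x) (lens_act p m' (\val y)) <= inner (\val x) (lens_act p m (\val y)))
   /\ exists z : @sphere3 R, lens_proj p z = g h
     /\ exists2 r, 0 < r & \val z = r *: (\val x + lens_act p m (\val y)).
Proof.
move=> hE [_ [c [geo gE minc]]] gs ge anti.
have [a [b [w [aa bb ab w0 E]]]] := sphere_geodesic_great_arc geo.
have Ea : \val (c 0) = a by rewrite -[LHS]/(emb c 0) E great_arc0.
have Eb : \val (c 1) = cos w *: a + sin w *: b by rewrite -[LHS]/(emb c 1) E great_arc1.
have /lens_projP [i Ei] : lens_proj p x = lens_proj p (c 0) by rewrite -gs /path_start gE.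
have /lens_projP [j Ej] : lens_proj p y = lens_proj p (c 1) by rewrite -ge /path_end gE.
have Exa : lens_act p (- i) a = \val x by rewrite -Ea -Ei lens_actK.
have Eyv : lens_act p (- i) (\val (c 1)) = lens_act p (j - i) (\val y).
  by rewrite -Ej lens_actD.
have xyw : inner (\val x) (lens_act p (j - i) (\val y)) = cos w.
  by rewrite -Exa -Eyv lens_act_inner Eb innerDr !innerZr aa ab; ring.
have short m : exists2 w', w <= w' <= pi & inner (\val x) (lens_act p m (\val y)) = cos w'.
  have vv : inner (lens_act p m (\val y)) (lens_act p m (\val y)) = 1.
    by rewrite lens_act_inner sphereE.
  have [b' [w' [bb' xb' /andP[w'0 w'pi] E']]] := exists_great_arc (sphereE x) vv.
  exists w'; last by rewrite -E' great_arc1 innerDr !innerZr sphereE xb'; ring.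
  rewrite w'pi andbT.
  pose c' := arc_to_sphere w' (sphereE x) bb' xb'.
  have Ec' : emb c' = great_arc (\val x) b' w' by [].
  have := minc c' (great_arc_piecewise Ec').
  rewrite (great_arc_length kappa_gt0 aa bb ab w0 E).
  rewrite (great_arc_length kappa_gt0 (sphereE x) bb' xb' w'0 Ec') lee_fin.
  rewrite ler_pM2l ?sqrtr_gt0 ?invr_gt0 //; apply.
    rewrite gs; congr lens_proj; apply/val_inj; exact: great_arc0.
  by rewrite ge; apply/esym/lens_projP; exists m; rewrite -E'.
have wpi : w <= pi by have [w' /andP[h1 h2] _] := short 0; exact: le_trans h1 h2.
exists (j - i); split.
  move=> m; have [w' /andP[h1 h2] ->] := short m; rewrite xyw.
  by rewrite leNgt ltr_cos ?in_itv /= -?leNgt //; apply/andP; split=> //; exact: le_trans w0 h1.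
exists (sact p (- i) (c (1 / 2))); split.
  by rewrite lens_proj_sact gE hE.
have wn : w != pi.
  apply/eqP => wp; have := anti (j - i); rewrite -Eyv -Exa -lens_actDv Eb wp cospi sinpi.
  by rewrite scale0r addr0 scaleN1r subrr /lens_act mul0mx eqxx.
have cp : 0 < cos (w / 2).
  apply: cos_gt0_pihalf; have pi0 := pi_gt0 R.
  by have wlt : w < pi; [rewrite lt_neqAle wn | apply/andP; split; lra].
exists (2 * cos (w / 2))^-1; first by rewrite invr_gt0 mulr_gt0.
rewrite val_sact -Eyv -Exa -lens_actDv -lens_actZ; congr lens_act.
have -> : \val (c (1 / 2)) = great_arc a b w (1 / 2) by rewrite -[LHS]/(emb c (1/2)) E.
rewrite Eb /great_arc mul1r.
have -> : cos w = 2 * cos (w / 2) ^+ 2 - 1.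
  by rewrite {1}(splitr w) cosD -!expr2 sin2cos2; ring.
have -> : sin w = 2 * cos (w / 2) * sin (w / 2).
  by rewrite {1}(splitr w) sinD; ring.
have cn : cos (w / 2) != 0 by rewrite gt_eqF.
by apply/matrixP => k l; rewrite !mxE; field.
Qed.
End Minimizing.

(** * Pairs of points *)

Section Det.
Variable R : realType.
Implicit Types x y z : C2 R.

(** The complex determinant of two vectors of C^2, stored as the vector
    [(det, 0)] so that multiplication by a phase is [_ *m rot t] again. *)
Definition dvec (x y : C2 R) : C2 R :=
  let x1 := x ord0 ord0 in let x2 := x ord0 ord_max in
  let x3 := x ord_max ord0 in let x4 := x ord_max ord_max in
  let y1 := y ord0 ord0 in let y2 := y ord0 ord_max in
  let y3 := y ord_max ord0 in let y4 := y ord_max ord_max in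
  \matrix_(i, j) if i == ord0 then
     (if j == ord0 then x1 * y3 - x2 * y4 - (x3 * y1 - x4 * y2)
      else x1 * y4 + x2 * y3 - (x3 * y2 + x4 * y1)) else 0.

Lemma dvecE (x y : C2 R) : [/\ dvec x y ord0 ord0 =
     x ord0 ord0 * y ord_max ord0 - x ord0 ord_max * y ord_max ord_max
     - (x ord_max ord0 * y ord0 ord0 - x ord_max ord_max * y ord0 ord_max),
   dvec x y ord0 ord_max =
     x ord0 ord0 * y ord_max ord_max + x ord0 ord_max * y ord_max ord0
     - (x ord_max ord0 * y ord0 ord_max + x ord_max ord_max * y ord0 ord0),
   dvec x y ord_max ord0 = 0 & dvec x y ord_max ord_max = 0].
Proof. by split; rewrite !mxE. Qed.

Lemma C2_eqP (x y : C2 R) : x ord0 ord0 = y ord0 ord0 -> x ord0 ord_max = y ord0 ord_max ->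
  x ord_max ord0 = y ord_max ord0 -> x ord_max ord_max = y ord_max ord_max -> x = y.
Proof.
by move=> *; apply/matrixP => i j; case: (ord2P i) => ->; case: (ord2P j) => ->.
Qed.

Lemma dvec_rotl x y t : dvec (x *m rot t) y = dvec x y *m rot t.
Proof.
have [d1 d2 d3 d4] := dvecE (x *m rot t) y; have [e1 e2 e3 e4] := dvecE x y.
by apply: C2_eqP; rewrite ?(d1, d2, d3, d4) ?(rotE _ _ _).1 ?(rotE _ _ _).2 ?(e1, e2, e3, e4); ring.
Qed.

Lemma dvec_rotr x y t : dvec x (y *m rot t) = dvec x y *m rot t.
Proof.
have [d1 d2 d3 d4] := dvecE x (y *m rot t); have [e1 e2 e3 e4] := dvecE x y.
by apply: C2_eqP; rewrite ?(d1, d2, d3, d4) ?(rotE _ _ _).1 ?(rotE _ _ _).2 ?(e1, e2, e3, e4); ring.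
Qed.

Lemma dvecDl x x' y : dvec (x + x') y = dvec x y + dvec x' y.
Proof. by apply: C2_eqP; rewrite !mxE /=; ring. Qed.

Lemma dvecDr x y y' : dvec x (y + y') = dvec x y + dvec x y'.
Proof. by apply: C2_eqP; rewrite !mxE /=; ring. Qed.

Lemma dvecZl a x y : dvec (a *: x) y = a *: dvec x y.
Proof. by apply: C2_eqP; rewrite !mxE /=; ring. Qed.

Lemma dvecZr a x y : dvec x (a *: y) = a *: dvec x y.
Proof. by apply: C2_eqP; rewrite !mxE /=; ring. Qed.

Lemma dvecxx x : dvec x x = 0.
Proof. by apply: C2_eqP; rewrite !mxE /=; ring. Qed.

(** Lagrange's identity [|<x,y>|^2 + |det(x,y)|^2 = |x|^2 |y|^2], where the
    two squares on the left are the real and imaginary part of [<x,y>]. *)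
Lemma lagrange x y : inner x y ^+ 2 + inner x (y *m rot (pi / 2)) ^+ 2
  + inner (dvec x y) (dvec x y) = inner x x * inner y y.
Proof.
have [d1 d2 d3 d4] := dvecE x y.
rewrite !innerE d1 d2 d3 d4 !(rotE _ _ _).1 !(rotE _ _ _).2 cos_pihalf sin_pihalf.
ring.
Qed.

Lemma continuous_dvec (T : topologicalType) (f g : T -> C2 R) t :
  {for t, continuous f} -> {for t, continuous g} -> {for t, continuous (fun s => dvec (f s) (g s))}.
Proof.
move=> cf cg; have ce (h : T -> C2 R) i j : {for t, continuous h} -> {for t, continuous (fun s => h s i j)}.
  by move=> ch; apply: (continuous_comp_at ch (g := fun z : C2 R => z i j)); exact: continuous_entry.
apply: continuous_matrix => i j; case: (ord2P i) => ->; case: (ord2P j) => ->.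
- have -> : (fun s => dvec (f s) (g s) ord0 ord0) = fun s =>
      f s ord0 ord0 * g s ord_max ord0 - f s ord0 ord_max * g s ord_max ord_max
     - (f s ord_max ord0 * g s ord0 ord0 - f s ord_max ord_max * g s ord0 ord_max).
    by apply/funext => s; have [-> _ _ _] := dvecE (f s) (g s).
  by apply: continuousB; apply: continuousB; apply: continuousM; apply: ce.
- have -> : (fun s => dvec (f s) (g s) ord0 ord_max) = fun s =>
      f s ord0 ord0 * g s ord_max ord_max + f s ord0 ord_max * g s ord_max ord0
     - (f s ord_max ord0 * g s ord0 ord_max + f s ord_max ord_max * g s ord0 ord0).
    by apply/funext => s; have [_ -> _ _] := dvecE (f s) (g s).
  by apply: continuousB; apply: continuousD; apply: continuousM; apply: ce.
- have -> : (fun s => dvec (f s) (g s) ord_max ord0) = fun=> 0.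
    by apply/funext => s; have [_ _ -> _] := dvecE (f s) (g s).
  exact: cst_continuous.
- have -> : (fun s => dvec (f s) (g s) ord_max ord_max) = fun=> 0.
    by apply/funext => s; have [_ _ _ ->] := dvecE (f s) (g s).
  exact: cst_continuous.
Qed.
End Det.

Section Pairs.
Variables (R : realType) (p : nat).
Hypothesis p_gt0 : (0 < p)%N.
Let S := @sphere3 R.
Implicit Types P Q : S * S.

Definition pdist P Q := enorm (\val P.1 - \val Q.1) + enorm (\val P.2 - \val Q.2).

Lemma pdistC P Q : pdist P Q = pdist Q P.
Proof. by rewrite /pdist -enormN opprB -(enormN (\val P.2 - _)) opprB. Qed.

Lemma pdistxx P : pdist P P = 0.
Proof. by rewrite /pdist !subrr enorm0 addr0. Qed.

Lemma pdist_triangle Q P P' : pdist P P' <= pdist P Q + pdist Q P'.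
Proof.
have := enormD (\val P.1 - \val Q.1) (\val Q.1 - \val P'.1).
have := enormD (\val P.2 - \val Q.2) (\val Q.2 - \val P'.2).
by rewrite !subrKA /pdist; lra.
Qed.

Definition gact a b P : S * S := (sact p a P.1, sact p b P.2).

Lemma pdist_gact a b P Q : pdist (gact a b P) (gact a b Q) = pdist P Q.
Proof. by rewrite /pdist /gact !val_sact -!lens_actB !lens_act_enorm. Qed.

Lemma nbhs_pairP P (U : set (S * S)) :
  nbhs P U <-> exists2 e, 0 < e & forall Q, pdist P Q < e -> U Q.
Proof.
case: P => x y; split.
  case=> -[V W] /= [/nbhs_sphereP [e e0 He] /nbhs_sphereP [f f0 Hf]] VWU.
  exists (Num.min e f); first by rewrite lt_min e0.
  move=> [x' y'] h; apply: VWU; have := enorm_ge0 (\val x - \val x'); have := enorm_ge0 (\val y - \val y').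
  move: h; rewrite /pdist /= lt_min => /andP[h1 h2] hx hy.
  by split=> /=; [apply: He | apply: Hf]; rewrite -enormN opprB; lra.
case=> e e0 H; exists ([set x' | enorm (\val x' - \val x) < e / 2], [set y' | enorm (\val y' - \val y) < e / 2]).
  by split; apply/nbhs_sphereP; exists (e / 2) => //; rewrite divr_gt0.
move=> [x' y'] /= [h1 h2]; apply: H; rewrite /pdist /= -enormN opprB -(enormN (\val y - _)) opprB.
lra.
Qed.

Definition lens_proj2 P : lens_space R p * lens_space R p := (lens_proj p P.1, lens_proj p P.2).

Lemma lens_proj2_gact a b P : lens_proj2 (gact a b P) = lens_proj2 P.
Proof. by rewrite /lens_proj2 /= !lens_proj_sact. Qed.

Lemma lens_proj2P P Q : lens_proj2 P = lens_proj2 Q -> exists a b, Q = gact a b P.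
Proof.
move=> [/lens_projP [a Ea] /lens_projP [b Eb]]; exists a, b.
by case: P Q Ea Eb => [x y] [x' y'] /= Ea Eb; congr (_, _); apply/val_inj; rewrite val_sact.
Qed.

Lemma lens_proj2_surj l : exists P, lens_proj2 P = l.
Proof.
case: l => l1 l2; have [x <-] := lens_proj_surj l1; have [y <-] := lens_proj_surj l2.
by exists (x, y).
Qed.

Lemma continuous_lens_proj2 : continuous lens_proj2.
Proof.
move=> [x y] U [[V W] /= [nV nW] VWU].
exists (lens_proj p @^-1` V, lens_proj p @^-1` W).
  by split; apply: continuous_lens_proj.
by move=> [x' y'] /= [h1 h2]; apply: VWU.
Qed.

Lemma lens_proj2_nbhs P (U : set (S * S)) : nbhs P U -> nbhs (lens_proj2 P) [set lens_proj2 Q | Q in U].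
Proof.
case: P => x y [[V W] /= [nV nW] VWU].
exists ([set lens_proj p z | z in V], [set lens_proj p z | z in W]) => /=.
  by split; apply: lens_proj_nbhs.
by move=> [l1 l2] /= [[z Vz <-] [z' Wz' <-]]; exists (z, z') => //; exact: VWU.
Qed.

(** The determinant with [y] removes the second summand, so that [z^j] fixes a
    non-zero vector and [j] is 0 modulo [p]; what remains is [z^m y = z^l y]. *)
Lemma midpoint_label_unique P (j m l : int) (r r' : R) :
  dvec (\val P.1) (\val P.2) != 0 -> 0 < r -> 0 < r' ->
  lens_act p j (r *: (\val P.1 + lens_act p m (\val P.2))) = r' *: (\val P.1 + lens_act p l (\val P.2)) ->
  (p %| m - l)%Z.
Proof.
set x := \val P.1; set y := \val P.2; move=> D0 r0 r'0 E.
have := congr1 (fun z => dvec z y) E; rewrite /lens_act dvec_rotl !dvecZl !dvecDl !dvec_rotl dvecxx !mul0mx !addr0.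
rewrite -/(lens_act p j _) => E1.
have rr : r = r'.
  have := congr1 (@enorm R) E1; rewrite lens_act_enorm !enormZ !gtr0_norm //.
  by apply: mulIf; rewrite enorm_eq0.
move: E1; rewrite -rr lens_actZ => /(scalerI (lt0r_neq0 r0)) /(lens_act_fix p_gt0 D0) pj.
move: E; rewrite (lens_act_dvd p_gt0 _ pj) -rr => /(scalerI (lt0r_neq0 r0)) /addrI E.
have := congr1 (lens_act p (- l)) E; rewrite lens_actK lens_actD.
exact/(lens_act_fix p_gt0)/sphere_neq0.
Qed.
End Pairs.

(** * From local sections to labellings *)

Section Subtype.

Lemma nbhs_set_typeP (X : topologicalType) (A : set X) (a : A) (U : set A) :
  nbhs a U <-> exists V : set X, [/\ open V, V (\val a) & forall b : A, V (\val b) -> U b].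
Proof.
split.
  by case=> _ [/= [V oV <-]] Va VU; exists V; split=> // b Vb; exact: VU.
move=> [V [oV Va VU]]; exists (\val @^-1` V); split => //=.
by exists V.
Qed.

Lemma hausdorff_prod (X Y : topologicalType) :
  hausdorff_space X -> hausdorff_space Y -> hausdorff_space (X * Y)%type.
Proof.
move=> hX hY [x y] [x' y'] cl; congr (_, _).
  apply: hX => A B nA nB.
  have [||[u v] [[/= Au _] [/= Bu _]]] := cl (A `*` setT) (B `*` setT).
  - by exists (A, setT) => //=; split=> //; exact: filterT.
  - by exists (B, setT) => //=; split=> //; exact: filterT.
  by exists u.
apply: hY => A B nA nB.
have [||[u v] [[/= _ Av] [/= _ Bv]]] := cl (setT `*` A) (setT `*` B).
- by exists (setT, A) => //=; split=> //; exact: filterT.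
- by exists (setT, B) => //=; split=> //; exact: filterT.
by exists v.
Qed.

(** A compact neighbourhood in [A] is closed in [X], and contains the trace of [A] on
    some open [V]. *)
Lemma locally_compact_locally_closed (X : topologicalType) (A : set X) (a : X) :
  hausdorff_space X -> locally_compact [set: A] -> A a ->
  exists V : set X, [/\ open V, V a & forall b, V b -> closure (A `&` V) b -> A b].
Proof.
move=> hX lcA Aa; pose a' : A := SigSub (mem_set Aa).
have [C] := lcA a' I; rewrite withinET => /nbhs_set_typeP [V [oV Va VC]] [cC _].
exists V; split => // b Vb.
have cI : compact (\val @` C : set X).
  apply: continuous_compact => //; apply: continuous_subspaceT; exact: initial_continuous.
have clI := compact_closed hX cI.
have sub : A `&` V `<=` \val @` C.
  move=> c [Ac Vc]; exists (SigSub (mem_set Ac)) => //; exact: VC.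
move/(closureS sub); rewrite -(closure_id _).1 // => -[c _ <-].
exact: (set_mem (valP c)).
Qed.
End Subtype.

Section SectionMidpoint.
Variables (R : realType) (M : topologicalType).

Lemma unit_interval_half_subproof : (1 / 2 : R) \in @unit_interval R.
Proof. by rewrite inE /unit_interval /= in_itv /=; apply/andP; split; lra. Qed.

Definition unit_half : @unit_interval R := SigSub unit_interval_half_subproof.

Lemma compact_open_eval (X Y : topologicalType) (x : X) :
  continuous (fun g : {compact-open, X -> Y} => g x).
Proof.
move=> g W; rewrite [in X in X -> _]nbhsE => -[V [oV Vgx] VW].
have : nbhs g [set f : {compact-open, X -> Y} | f @` [set x] `<=` V].
  have := (@compact_open_cvgP X Y (nbhs g) g (nbhs_filter g)).1 (@cvg_id _ _).
  move=> /(_ [set x] V (@compact_set1 _ x) oV); apply.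
  by move=> y [z -> <-]; exact: Vgx.
by apply: filterS => f H; apply: VW; apply: H; exists x.
Qed.

(** Evaluation at 1/2 is continuous on the space of geodesics, and the midpoint is
    all that is kept of a section. *)
Lemma local_section_midpoint (GM : set {compact-open, @unit_interval R -> M}) (A : set (M * M)) :
  has_local_section GM A -> exists mu : M * M -> M,
   (forall l, A l -> exists g, [/\ GM g, path_start g = l.1, path_end g = l.2 & g unit_half = mu l]) /\
   (forall l W, A l -> nbhs (mu l) W -> nbhs l [set l' | A l' -> W (mu l')]).
Proof.
case=> s cs se.
pose mu l := match pselect (A l) with
  | left H => (\val (s (SigSub (mem_set H)))) unit_half | right _ => l.1 end.
have muE (l : A) : mu (\val l) = (\val (s l)) unit_half.
  rewrite /mu; case: pselect => [H|]; last by case; exact: (set_mem (valP l)).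
  by congr ((\val (s _)) _); apply/val_inj.
exists mu; split=> [l Al|l W Al nW].
  pose l' : A := SigSub (mem_set Al); exists (\val (s l')).
  have E := se l'; split; last by rewrite -muE.
  - exact: (set_mem (valP (s l'))).
  - by rewrite -[l]/(\val l') -E.
  - by rewrite -[l]/(\val l') -E.
pose l' : A := SigSub (mem_set Al).
have cm : {for l', continuous (fun b : A => (\val (s b)) unit_half)}.
  apply: (@continuous_comp_at A _ _ (fun b => \val (s b)) (fun g : {compact-open, @unit_interval R -> M} => g unit_half)).
    apply: (@continuous_comp_at A _ _ s (fun g : GM => \val g)); first exact: cs.
    exact: initial_continuous.
  exact: compact_open_eval.
have Hn : nbhs l' [set b : A | W ((\val (s b)) unit_half)] by apply: cm; rewrite -muE.
move/nbhs_set_typeP : Hn => [V [oV Vl VW]]; rewrite nbhsE; exists V => // b Vb Ab.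
by have := VW (SigSub (mem_set Ab)) Vb; rewrite /= -muE.
Qed.
End SectionMidpoint.

Section Labels.
Variables (R : realType) (p : nat) (kappa : R).
Hypotheses (p_gt1 : (1 < p)%N) (kappa_gt0 : 0 < kappa).
Let p_gt0 : (0 < p)%N := ltnW p_gt1.
Let S := @sphere3 R.
Let L := lens_space R p.

(** Linear independence over the complex numbers. *)
Definition independent (P : S * S) := dvec (\val P.1) (\val P.2) != 0.

Definition chord (m : int) (P : S * S) : C2 R := \val P.1 + lens_act p m (\val P.2).

Lemma chord_neq0 m P : independent P -> chord m P != 0.
Proof.
move=> D; apply: contra_neq D => E.
have := congr1 (fun z => dvec z (\val P.2)) E.
rewrite /chord /lens_act dvecDl dvec_rotl dvecxx mul0mx addr0 => ->.
by rewrite -(scale0r (\val P.1)) dvecZl !scale0r.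
Qed.

Definition normal_chord m P : C2 R := (enorm (chord m P))^-1 *: chord m P.

Lemma normal_chord_unit m P : independent P -> inner (normal_chord m P) (normal_chord m P) = 1.
Proof.
move=> /(chord_neq0 m); rewrite -enorm_eq0 => e0.
by rewrite innerZl innerZr -sqr_enorm; field.
Qed.

Lemma normal_chordP m P (r : R) (z : S) : 0 < r -> \val z = r *: chord m P -> \val z = normal_chord m P.
Proof.
move=> r0 E; have := congr1 (@enorm R) E; rewrite enormZ gtr0_norm //.
rewrite {1}/enorm sphereE sqrtr1 => E1; rewrite E /normal_chord; congr (_ *: _).
have e0 : enorm (chord m P) != 0 by apply: contra_eq_neq E1 => ->; rewrite mulr0 oner_neq0.
by apply: (mulIf e0); rewrite -E1 mulVf.
Qed.

Lemma continuous_pair_val (P : S * S) :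
  {for P, continuous (fun Q : S * S => \val Q.1 : C2 R)} /\ {for P, continuous (fun Q : S * S => \val Q.2 : C2 R)}.
Proof.
split=> U; case: P => x y.
  move=> /(@continuous_sphere_val R x) nx; exists ([set z | U (\val z)], setT) => /=.
    by split; [exact: nx | exact: filterT].
  by move=> [x' y'] /= [].
move=> /(@continuous_sphere_val R y) nx; exists (setT, [set z | U (\val z)]) => /=.
  by split; [exact: filterT | exact: nx].
by move=> [x' y'] /= [].
Qed.

Lemma continuous_chord m P : {for P, continuous (chord m)}.
Proof.
have [c1 c2] := continuous_pair_val P.
have c3 := continuous_rot c2 (@cst_continuous _ _ (2 * pi * m%:~R / p%:R : R) P).
exact: (continuousD c1 c3).
Qed.

Lemma pdist_continuous (f : S * S -> C2 R) P e : {for P, continuous f} -> 0 < e ->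
  exists2 d, 0 < d & forall Q, pdist P Q < d -> enorm (f Q - f P) < e.
Proof.
move=> cf e0.
have ce : {for P, continuous (fun Q => enorm (f Q - f P))}.
  exact: (continuous_enorm (continuousB cf (@cst_continuous _ _ (f P) P))).
have /ce Hn : nbhs (enorm (f P - f P)) [set r | r < e].
  by apply: open_nbhs_nbhs; split; [exact: open_lt | rewrite /= subrr enorm0].
have /nbhs_pairP [d d0 H] : nbhs P [set Q | enorm (f Q - f P) < e] by exact: Hn.
by exists d.
Qed.

Lemma normal_chord_near m P e : independent P -> 0 < e ->
  exists2 d, 0 < d & forall Q, pdist P Q < d -> enorm (normal_chord m Q - normal_chord m P) < e.
Proof.
move=> D; apply: pdist_continuous; apply: continuousZ; last exact: continuous_chord.
apply: continuousV; first by rewrite enorm_eq0 chord_neq0.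
by apply: continuous_enorm; exact: continuous_chord.
Qed.

Definition short (m : int) (P : S * S) := forall m',
  inner (\val P.1) (lens_act p m' (\val P.2)) <= inner (\val P.1) (lens_act p m (\val P.2)).

(** The label [m] is shortest for [P] and the geodesic with label [m] has midpoint
    [l]. *)
Definition midpoint_label (l : L) (m : int) (P : S * S) := short m P /\
  exists z : S, lens_proj p z = l /\ exists2 r, 0 < r & \val z = r *: chord m P.

Lemma midpoint_label_mod l m m' P : independent P ->
  midpoint_label l m P -> midpoint_label l m' P -> m%:~R = m'%:~R :> 'Z_p.
Proof.
move=> D [_ [z [zl [r r0 zr]]]] [_ [z' [zl' [r' r'0 zr']]]].
have /lens_projP [j E] : lens_proj p z = lens_proj p z' by rewrite zl zl'.
rewrite zr zr' in E; have := midpoint_label_unique p_gt0 D r0 r'0 E.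
by rewrite -(intr_Zp_eq0 p_gt1) rmorphB subr_eq0 => /eqP.
Qed.

Lemma midpoint_label_gact l m a b P : midpoint_label l m P -> midpoint_label l (m + a - b) (gact p a b P).
Proof.
have act m' : lens_act p m' (lens_act p b (\val P.2)) = lens_act p a (lens_act p (b + m' - a) (\val P.2)).
  by rewrite !lens_actD; congr lens_act; ring.
have act' : lens_act p (m + a - b) (lens_act p b (\val P.2)) = lens_act p a (lens_act p m (\val P.2)).
  by rewrite act; congr (lens_act p a (lens_act p _ _)); ring.
move=> [sm [z [zl [r r0 zr]]]]; split.
  by move=> m'; rewrite /= act act' !lens_act_inner.
exists (sact p a z); split; first by rewrite lens_proj_sact.
exists r => //; rewrite val_sact zr lens_actZ; congr (_ *: _).
by rewrite /chord /= act' lens_actDv.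
Qed.

(** At [P] the normalized chord with label [m] projects to a point other than the
    midpoint selected there.  The two points have disjoint neighbourhoods, and both
    depend continuously on the pair, so they stay different nearby. *)
Lemma separate_labels (A : set (L * L)) (mu : L * L -> L) (P : S * S) (l m : int) :
  A (lens_proj2 p P) ->
  (forall l W, A l -> nbhs (mu l) W -> nbhs l [set l' | A l' -> W (mu l')]) ->
  independent P -> midpoint_label (mu (lens_proj2 p P)) l P -> m%:~R != l%:~R :> 'Z_p ->
  exists2 d, 0 < d & forall Q, pdist P Q < d -> A (lens_proj2 p Q) ->
    ~ midpoint_label (mu (lens_proj2 p Q)) m Q.
Proof.
move=> AP cmu D Pl ml.
pose zm : S := to_sphere (normal_chord_unit m D).
have [sl [zl [Ezl [r r0 zlE]]]] := Pl.
have neq : lens_proj p zm != mu (lens_proj2 p P).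
  apply: contra_neq ml => E; rewrite -Ezl in E; have /lens_projP [j Ej] := E.
  have e0 : 0 < (enorm (chord m P))^-1.
    by rewrite invr_gt0 lt_neqAle enorm_ge0 andbT eq_sym enorm_eq0 chord_neq0.
  have E' : lens_act p j ((enorm (chord m P))^-1 *: chord m P) = r *: chord l P.
    by rewrite -zlE -Ej.
  have := midpoint_label_unique p_gt0 D e0 r0 E'.
  by rewrite -(intr_Zp_eq0 p_gt1) rmorphB subr_eq0 => /eqP.
have := @lens_space_hausdorff R p p_gt0; rewrite open_hausdorff => /(_ _ _ neq).
case=> -[V2 V1] /= [/set_mem V2z /set_mem V1z] [oV2 oV1 V12].
have n1 : nbhs (lens_proj2 p P) [set l' | A l' -> V1 (mu l')].
  by apply: cmu => //; apply: open_nbhs_nbhs.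
have /nbhs_pairP [d1 d10 H1] := continuous_lens_proj2 n1.
have n2 : nbhs (lens_proj p zm) V2 by apply: open_nbhs_nbhs.
have /nbhs_sphereP [e e0 H2] := continuous_lens_proj n2.
have [d2 d20 H3] := normal_chord_near m D e0.
exists (Num.min d1 d2) => [|Q]; first by rewrite lt_min d10.
rewrite lt_min => /andP[/H1 /= Q1 /H3 Q2] AQ [_ [z [zE [s s0 zs]]]].
have zV1 := Q1 AQ; rewrite -zE in zV1.
have zV2 : V2 (lens_proj p z) by apply: H2; rewrite (normal_chordP s0 zs).
by have : (V2 `&` V1) (lens_proj p z) by []; rewrite (eqP V12).
Qed.

(** Every pair belongs to exactly one member of the decomposition, and the midpoint
    of the selected geodesic determines the label.  Only finitely many labels have
    to be excluded by [separate_labels], which makes the label locally constant on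
    each member; the last property is local closedness. *)
Lemma decomposition_labelling k (A : 'I_k -> set (L * L)) :
  locally_compact_decomposition A ->
  (forall i, has_local_section (@minimizing_geodesics R p kappa) (A i)) ->
  exists (idx : S * S -> 'I_k) (lab : S * S -> 'Z_p), [/\
    forall a b P, idx (gact p a b P) = idx P,
    forall a b P, independent P -> lab (gact p a b P) = lab P + a%:~R - b%:~R,
    forall P m, independent P -> m%:~R = lab P -> short m P,
    forall P, independent P -> exists2 d, 0 < d &
      forall Q, pdist P Q < d -> independent Q -> idx Q = idx P -> lab Q = lab P &
    forall P, exists2 d, 0 < d & forall Q, pdist P Q < d ->
      (forall e, 0 < e -> exists2 Q', pdist Q Q' < e & idx Q' = idx P) -> idx Q = idx P].
Proof.
move=> [cov triv lc] secs.
have {secs} /choice [mu Hmu] i := local_section_midpoint (secs i).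
have /choice [idx Hidx] : forall P, exists i, A i (lens_proj2 p P).
  by move=> P; have : [set: L * L] (lens_proj2 p P) by []; rewrite -cov => -[i _ Ai]; exists i.
have idx_uniq P i : A i (lens_proj2 p P) -> idx P = i.
  by move=> Ai; apply: (triv _ _ I I); exists (lens_proj2 p P).
have idx_g a b P : idx (gact p a b P) = idx P.
  by apply: idx_uniq; rewrite lens_proj2_gact.
pose L0 m P := midpoint_label (mu (idx P) (lens_proj2 p P)) m P.
have ex P : independent P -> exists m, L0 m P.
  move=> D; have [H1 _] := Hmu (idx P); have [g [Gg gs ge gh]] := H1 _ (Hidx P).
  have anti m : \val P.1 + lens_act p m (\val P.2) != 0 by exact: chord_neq0.
  have [m [sm [z [zg [r r0 zr]]]]] := minimizer_midpoint kappa_gt0 (erefl _ : \val (@unit_half R) = 1 / 2) Gg gs ge anti.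
  by exists m; split=> //; exists z; rewrite zg gh; split=> //; exists r.
have ex' P : exists l : 'Z_p, forall m, independent P -> L0 m P -> m%:~R = l.
  have [D|D] := boolP (independent P); last by exists 0.
  by have [l Hl] := ex _ D; exists l%:~R => m _ Hm; exact: midpoint_label_mod Hm Hl.
have /choice [lab Hlab] := ex'.
exists idx, lab; split=> //.
- move=> a b P D; have [m Hm] := ex _ D.
  rewrite -(Hlab P m D Hm) -rmorphD -rmorphB; symmetry; apply: Hlab.
    by rewrite /independent /= /sact /= /lens_act dvec_rotl dvec_rotr -enorm_eq0 !enorm_rot enorm_eq0.
  by rewrite /L0 lens_proj2_gact idx_g; exact: midpoint_label_gact.
- move=> P m D E m'; have [l Hl] := ex _ D; move: E; rewrite -(Hlab P l D Hl) => /eqP.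
  rewrite -subr_eq0 -rmorphB intr_Zp_eq0 // => pml.
  have -> : lens_act p m (\val P.2) = lens_act p l (\val P.2).
    exact: lens_act_eqmod.
  by case: Hl => + _; apply.
- move=> P D; have [l Hl] := ex _ D.
  have sep m : exists d, 0 < d /\ (m%:~R != l%:~R :> 'Z_p -> forall Q, pdist P Q < d ->
      A (idx P) (lens_proj2 p Q) -> ~ midpoint_label (mu (idx P) (lens_proj2 p Q)) m Q).
    have [E|E] := eqVneq (m%:~R : 'Z_p) l%:~R; first by exists 1.
    have [d d0 Hd] := separate_labels (Hidx P) (Hmu (idx P)).2 D Hl E.
    by exists d.
  have /choice [d Hd] := sep.
  have [n np|e e0 He] := @finite_pos_min R (fun n => d n%:Z) p; first by have [] := Hd n%:Z.
  exists e => // Q PQ DQ iQ; have [m Hm] := ex _ DQ.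
  rewrite -(Hlab Q m DQ Hm) -(Hlab P l D Hl).
  have [n np nm] : exists2 n : nat, (n < p)%N & n%:~R = m%:~R :> 'Z_p.
    by exists (m%:~R : 'Z_p); [rewrite -[X in (_ < X)%N](Zp_cast p_gt1) | rewrite -pmulrn natr_Zp].
  have Hn : L0 n Q.
    have pnm : (p %| n%:Z - m)%Z by rewrite -(intr_Zp_eq0 p_gt1) rmorphB /= nm subrr.
    have E : lens_act p n (\val Q.2) = lens_act p m (\val Q.2).
      exact: lens_act_eqmod.
    by case: Hm => h1 h2; split; [move=> m'; rewrite E; exact: h1 | rewrite /chord E; exact: h2].
  rewrite -nm; apply/eqP/negPn/negP => nl; have [_ H] := Hd n%:Z.
  apply: (H nl Q); first exact: lt_le_trans PQ (He _ np).
    by rewrite -iQ.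
  by rewrite -iQ.
- move=> P.
  have hL := @lens_space_hausdorff R p p_gt0; have hLL := hausdorff_prod hL hL.
  have [V [oV VP HV]] := locally_compact_locally_closed hLL (lc (idx P)) (Hidx P).
  have nV : nbhs (lens_proj2 p P) V by apply: open_nbhs_nbhs.
  have /nbhs_pairP [d d0 Hd] := continuous_lens_proj2 nV.
  exists d => // Q /Hd /= VQ clQ; apply: idx_uniq; apply: HV => // W nW.
  have nVW : nbhs (lens_proj2 p Q) (V `&` W) by apply: filterI => //; apply: open_nbhs_nbhs.
  have /nbhs_pairP [e e0 He] := continuous_lens_proj2 nVW.
  have [Q' QQ' iQ'] := clQ e e0; have [VQ' WQ'] := He _ QQ'.
  by exists (lens_proj2 p Q'); split=> //; split=> //; rewrite -iQ'.
Qed.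
End Labels.

(** * The rank of a pair *)

Section TrigBounds.
Variable R : realType.

Lemma cos_lt_outside (a b : R) : 0 <= b <= pi -> b < a < 2 * pi - b -> cos a < cos b.
Proof.
move=> /andP[b0 bpi] /andP[ba a2].
have [api|pia] := leP a pi.
  by rewrite ltr_cos // in_itv /=; apply/andP; split; lra.
have -> : cos a = cos (2 * pi - a).
  have := @cosD2pi R (- a); rewrite cosN => <-; congr cos.
  by rewrite -(mulr_natl pi 2) addrC.
by rewrite ltr_cos ?in_itv /=; [lra | apply/andP; split; lra | apply/andP; split; lra].
Qed.

Lemma cos_le_outside (a b : R) : 0 <= b <= pi -> b <= a <= 2 * pi - b -> cos a <= cos b.
Proof.
move=> bpi /andP[ba a2]; have [->//|ab] := eqVneq a b.
have [->|ab'] := eqVneq a (2 * pi - b).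
  have := cosD2pi (- b); rewrite -(mulr_natl pi 2) addrC => ->; by rewrite cosN.
by apply/ltW/cos_lt_outside => //; rewrite !lt_neqAle eq_sym ab ab' ba.
Qed.

Lemma continuous_small (f : R -> R) e : {for 0, continuous f} -> f 0 < e ->
  exists2 d, 0 < d & forall t, `|t| < d -> f t < e.
Proof.
move=> cf fe; have /cf Hn : nbhs (f 0) [set r | r < e].
  by apply: open_nbhs_nbhs; split; [exact: open_lt | exact: fe].
have /nbhs_ballP [d /= d0 H] : nbhs (0:R) [set t | f t < e] by exact: Hn.
by exists d => // t td; apply: H; rewrite -ball_normE /ball_ /= sub0r normrN.
Qed.
End TrigBounds.

Section Lower.
Variables (R : realType) (p k : nat).
Hypothesis p_gt2 : (2 < p)%N.
Let p_gt1 : (1 < p)%N := ltnW p_gt2.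
Let p_gt0 : (0 < p)%N := ltnW p_gt1.
Let S := @sphere3 R.
Variables (idx : S * S -> 'I_k) (lab : S * S -> 'Z_p).
Hypothesis idx_gact : forall a b P, idx (gact p a b P) = idx P.
Hypothesis lab_gact : forall a b P, independent P -> lab (gact p a b P) = lab P + a%:~R - b%:~R.
Hypothesis lab_short : forall P m, independent P -> m%:~R = lab P -> short p m P.
Hypothesis lab_near : forall P, independent P -> exists2 d, 0 < d &
      forall Q, pdist P Q < d -> independent Q -> idx Q = idx P -> lab Q = lab P.
Hypothesis idx_near : forall P, exists2 d, 0 < d & forall Q, pdist P Q < d ->
      (forall e, 0 < e -> exists2 Q', pdist Q Q' < e & idx Q' = idx P) -> idx Q = idx P.

Definition adherent (P : S * S) : {set 'I_k} :=
  [set i | `[< forall e, 0 < e -> exists2 Q, pdist P Q < e & idx Q = i >]].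

Definition rk P := #|adherent P|.

Lemma adherentP P i : reflect (forall e, 0 < e -> exists2 Q, pdist P Q < e & idx Q = i) (i \in adherent P).
Proof. by rewrite inE; exact: asboolP. Qed.

Lemma idx_adherent P : idx P \in adherent P.
Proof. by apply/adherentP => e e0; exists P => //; rewrite pdistxx. Qed.

(** The set of members to which a point adheres is upper semicontinuous, because
    there are finitely many members. *)
Lemma adherent_near P : exists2 d, 0 < d & forall Q, pdist P Q < d -> adherent Q \subset adherent P.
Proof.
have ex (i : 'I_k) : exists e, 0 < e /\ (i \notin adherent P -> forall Q, pdist P Q < e -> idx Q <> i).
  have [iP|iP] := boolP (i \in adherent P); first by exists 1.
  have [e [e0 H]] : exists e, 0 < e /\ forall Q, pdist P Q < e -> idx Q <> i.
    apply/not_existsP => H; case/negP: iP; apply/adherentP => e e0.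
    have := H e; move/not_andP => [//|/existsNP [Q /not_implyP [PQ /contrapT iQ]]].
    by exists Q.
  by exists e.
have /choice [e He] := ex.
have [n nk|d d0 Hd] := @finite_pos_min R (fun n => if insub n is Some i then e i else 1) k.
  by rewrite insubT; have [] := He (Sub n nk).
exists (d / 2) => [|Q PQ]; first by rewrite divr_gt0.
apply/fintype.subsetP => i /adherentP Qi; apply/negPn/negP => iP.
have [Q' QQ' iQ'] := Qi (d / 2) (divr_gt0 d0 (ltr0n _ 2)).
have [_ H] := He i; apply: (H iP Q') => //.
apply: le_lt_trans (pdist_triangle Q P Q') _.
by have := Hd i (ltn_ord i); rewrite valK; lra.
Qed.

(** Equal ranks force equal sets of adherent members, so that [Q] adheres to the
    member of [P]; by local closedness it belongs to it. *)
Lemma rk_near P : independent P -> exists2 d, 0 < d & forall Q, pdist P Q < d -> independent Q ->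
  (rk Q <= rk P)%N /\ (rk Q = rk P -> lab Q = lab P).
Proof.
move=> D; have [d1 d10 H1] := adherent_near P; have [d2 d20 H2] := idx_near P.
have [d3 d30 H3] := lab_near D.
exists (Num.min d1 (Num.min d2 d3)) => [|Q]; first by rewrite !lt_min d10 d20.
rewrite !lt_min => /and3P[/H1 sub /H2 Q2 /H3 Q3] DQ; split; first exact: subset_leq_card.
move=> e; apply: Q3 => //; apply: Q2; apply/adherentP.
have -> : adherent Q = adherent P by apply/eqP; rewrite eqEcard sub -/(rk P) -e leqnn.
exact: idx_adherent.
Qed.

Lemma gactK a b : cancel (gact p a b) (@gact R p (- a) (- b)).
Proof.
by move=> [x y]; congr (_, _); apply/val_inj; rewrite !val_sact lens_actK.
Qed.

Lemma rk_gact a b P : rk (gact p a b P) = rk P.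
Proof.
have sub a' b' P' : adherent P' \subset adherent (gact p a' b' P').
  apply/fintype.subsetP => i /adherentP H; apply/adherentP => e e0; have [Q PQ iQ] := H e e0.
  by exists (gact p a' b' Q); rewrite ?pdist_gact ?idx_gact.
have le1 := subset_leq_card (sub a b P).
have le2 := subset_leq_card (sub (- a) (- b) (gact p a b P)).
rewrite gactK in le2; apply/eqP; rewrite eqn_leq /rk; apply/andP; split; [exact: le2 | exact: le1].
Qed.

(** Orthogonality for the Hermitian product. *)
Definition orthogonal_pair (P : S * S) := forall t, inner (\val P.1) (\val P.2 *m rot t) = 0.

Lemma orthogonal_pair_independent P : orthogonal_pair P -> independent P.
Proof.
move=> o; have := lagrange (\val P.1) (\val P.2); rewrite !sphereE o.
have -> : inner (\val P.1) (\val P.2) = 0 by rewrite -(o 0) rot0 mulmx1.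
by rewrite !expr0n /= !add0r mulr1 /independent -inner_eq0 => ->; rewrite oner_eq0.
Qed.

Lemma inner_self_rot (x : S) t : inner (\val x) (\val x *m rot t) = cos t.
Proof.
have := sphereE x; rewrite !innerE !(rotE _ _ _).1 !(rotE _ _ _).2 => E.
transitivity (cos t * (\val x ord0 ord0 * \val x ord0 ord0 + \val x ord0 ord_max * \val x ord0 ord_max
 + (\val x ord_max ord0 * \val x ord_max ord0 + \val x ord_max ord_max * \val x ord_max ord_max))).
  by ring.
by rewrite E mulr1.
Qed.

(** The vector [y] moved by the angle [e] towards the point of phase [t] on the
    fibre circle of [x]; the Hermitian product with [x] becomes [sin e e^(i t)]. *)
Definition tilt (P : S * S) (e t : R) : C2 R := cos e *: \val P.2 + sin e *: (\val P.1 *m rot t).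

Lemma orthogonal_pair_sym P t : orthogonal_pair P -> inner (\val P.2) (\val P.1 *m rot t) = 0.
Proof.
move=> o; rewrite -(inner_rot _ _ (- t)) -mulmxA rotD addrN rot0 mulmx1 innerC; exact: o.
Qed.

Lemma tilt_unit P e t : orthogonal_pair P -> inner (tilt P e t) (tilt P e t) = 1.
Proof.
move=> o; rewrite /tilt !(innerDl, innerDr, innerZl, innerZr) inner_rot !sphereE.
rewrite (innerC (\val P.1 *m _)) !orthogonal_pair_sym //.
by rewrite -[RHS](cos2Dsin2 e); ring.
Qed.

Definition tilted P (o : orthogonal_pair P) e t : S * S := (P.1, to_sphere (tilt_unit e t o)).

Lemma tilted_independent P (o : orthogonal_pair P) e t : cos e != 0 -> independent (tilted o e t).
Proof.
move=> ce; rewrite /independent /= /tilt dvecDr !dvecZr dvec_rotr dvecxx mul0mx scaler0 addr0.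
by rewrite scaler_eq0 negb_or ce; exact: orthogonal_pair_independent.
Qed.

Lemma tilted_inner P (o : orthogonal_pair P) e t m :
  inner (\val (tilted o e t).1) (lens_act p m (\val (tilted o e t).2))
   = sin e * cos (t + 2 * pi * m%:~R / p%:R).
Proof.
rewrite /= /tilt lens_actDv !lens_actZ innerDr !innerZr /lens_act (o _) mulr0 add0r.
by rewrite -mulmxA rotD inner_self_rot.
Qed.

Lemma tilted_near P (o : orthogonal_pair P) e t : 0 <= sin e ->
  pdist P (tilted o e t) <= (1 - cos e) + sin e.
Proof.
move=> s0; rewrite /pdist /= subrr enorm0 add0r /tilt.
have -> : \val P.2 - (cos e *: \val P.2 + sin e *: (\val P.1 *m rot t))
  = (1 - cos e) *: \val P.2 + (- sin e) *: (\val P.1 *m rot t).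
  by rewrite scalerBl scale1r scaleNr opprD addrA.
apply: le_trans (enormD _ _) _; rewrite !enormZ enorm_rot /enorm !sphereE sqrtr1 !mulr1.
by rewrite normrN ger0_norm ?(ger0_norm s0) // subr_ge0 cos_le1.
Qed.

Lemma tilted_dist P (o : orthogonal_pair P) e t s : 0 <= sin e <= 1 ->
  pdist (tilted o e t) (tilted o e (t + s)) <= Num.sqrt (2 - 2 * cos s).
Proof.
move=> /andP[s0 s1]; rewrite /pdist /= subrr enorm0 add0r /tilt.
have -> : cos e *: \val P.2 + sin e *: (\val P.1 *m rot t)
  - (cos e *: \val P.2 + sin e *: (\val P.1 *m rot (t + s)))
  = sin e *: (\val P.1 *m rot t - \val P.1 *m rot (t + s)).
  by rewrite scalerBr opprD addrACA subrr add0r.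
rewrite enormZ ger0_norm //; apply: (@le_trans _ _ (enorm (\val P.1 *m rot t - \val P.1 *m rot (t + s)))).
  by rewrite ler_piMl ?enorm_ge0.
rewrite /enorm (addrC t) -rotD mulmxA !(innerBl, innerBr) (innerC (\val P.1 *m rot s *m _)).
rewrite !inner_rot inner_self_rot sphereE ler_wsqrtr //; lra.
Qed.

(** Near an orthogonal pair with label [l], tilt [y] towards a phase of [x] for
    which the two shortest geodesics carry the labels [l + 1] and [l + 2]; a
    further small change of phase makes the one that was not chosen the only
    shortest.  The three choices belong to three members of the decomposition. *)
Lemma rk_ge3 P : orthogonal_pair P -> (3 <= rk P)%N.
Proof.
move=> o; have D := orthogonal_pair_independent o.
have [d1 d10 H1] := adherent_near P; have [d2 d20 H2] := lab_near D.
pose d := Num.min d1 d2; have d0 : 0 < d by rewrite lt_min d10.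
have pi0 := pi_gt0 R.
have [e [e0 e2 ed]] : exists e : R, [/\ 0 < e, e < pi / 2 & (1 - cos e) + sin e < d].
  have [r r0 Hr] : exists2 r, 0 < r & forall t, `|t| < r -> (1 - cos t) + sin t < d :> R.
    apply: (@continuous_small R (fun t => (1 - cos t) + sin t)); last by rewrite cos0 sin0 subrr addr0.
    apply: continuousD; last exact: continuous_sin.
    by apply: continuousB; [exact: cst_continuous | exact: continuous_cos].
  pose e := Num.min (r / 2) (pi / 4).
  have e0 : 0 < e by rewrite lt_min !divr_gt0.
  have er : e <= r / 2 by rewrite ge_min lexx.
  have ep : e <= pi / 4 by rewrite ge_min lexx orbT.
  exists e; split=> //; first lra.
  by apply: Hr; rewrite gtr0_norm //; lra.
have s0 : 0 < sin e by apply: sin_gt0_pi; apply/andP; split; lra.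
have s01 : 0 <= sin e <= 1 by rewrite ltW ?sin_le1.
have ce : cos e != 0 by rewrite gt_eqF // cos_gt0_pihalf //; apply/andP; split; lra.
pose u := pi / p%:R : R.
have p3 : 3 <= p%:R :> R by rewrite ler_nat.
have u0 : 0 < u by rewrite divr_gt0 //; lra.
have pu : p%:R * u = pi by rewrite /u mulrC divfK // gt_eqF //; lra.
have u3 : 3 * u <= pi by nra.
pose l := (lab P : nat)%:Z; have lE : l%:~R = lab P :> 'Z_p by exact: Zp_intr.
pose m0 := l + 1.
(* the phase makes [l + 1] and [l + 2] tie at [t = 0] *)
pose Q t := tilted o e (t - 2 * u * m0%:~R - u).
have near t : pdist P (Q t) < d by apply: le_lt_trans (tilted_near _ _ _) ed; exact: ltW.
have DQ t : independent (Q t) := tilted_independent _ _ ce.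
have val t m : inner (\val (Q t).1) (lens_act p m (\val (Q t).2)) = sin e * cos (2 * u * (m - m0)%:~R - u + t).
  rewrite tilted_inner; congr (_ * cos _); rewrite rmorphB /= /u; field.
  by rewrite gt_eqF //; lra.
have m00 : (m0 - m0)%:~R = 0 :> R by rewrite subrr.
have m01 : (m0 + 1 - m0)%:~R = 1 :> R by rewrite addrAC subrr add0r.
have best t m m' : m%:~R = lab (Q t) ->
   cos (2 * u * (m' - m0)%:~R - u + t) <= cos (2 * u * (m - m0)%:~R - u + t).
  by move=> /(lab_short (DQ t)) /(_ m'); rewrite !val ler_pM2l.
(* the label [l] is at cosine [cos (- 3 u + t)], the labels [l + 1] and [l + 2]
   at [cos (- u + t)] and [cos (u + t)] *)
have Nl t : cos (- (3 * u) + t) < cos (- u + t) \/ cos (- (3 * u) + t) < cos (u + t) -> lab (Q t) != lab P.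
  move=> H; apply/eqP => E; have b m' := best t l m' (etrans lE (esym E)).
  have := b m0; have := b (m0 + 1).
  have -> : (l - m0)%:~R = -1 :> R by rewrite /m0 opprD addrA subrr sub0r rmorphN.
  rewrite m00 m01 mulr0 sub0r mulr1 mulrN1.
  have -> : 2 * u - u + t = u + t by ring.
  have -> : - (2 * u) - u + t = - (3 * u) + t by ring.
  by case: H; lra.
have labQ1 : lab (Q 0) != lab P.
  apply: Nl; right; rewrite !addr0 cosN; apply: cos_lt_outside; apply/andP; split; lra.
(* [xget] picks a radius within which [lab_near] applies at [Q 0] *)
have [r r0 Hr] : exists2 r, 0 < r & forall t, `|t| < r -> Num.sqrt (2 - 2 * cos t) < xget 1 [set d | 0 < d /\ forall Q', pdist (Q 0) Q' < d -> independent Q' -> idx Q' = idx (Q 0) -> lab Q' = lab (Q 0)] :> R.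
  apply: (@continuous_small R (fun t => Num.sqrt (2 - 2 * cos t))).
    apply: (@continuous_comp_at R R R (fun t => 2 - 2 * cos t) (@Num.sqrt R)); last exact: sqrt_continuous.
    apply: continuousB; first exact: cst_continuous.
    by apply: continuousM; [exact: cst_continuous | exact: continuous_cos].
  rewrite cos0 mulr1 subrr sqrtr0; case: xgetP => [x _ []//|_]; exact: ltr01.
have {}Hr t : `|t| < r -> idx (Q t) = idx (Q 0) -> lab (Q t) = lab (Q 0).
  move=> /Hr; case: xgetP => [x _ [x0 Hx] tx|no _].
    apply: Hx => //; apply: le_lt_trans tx.
    have -> : Q t = tilted o e ((0 - 2 * u * m0%:~R - u) + t) by rewrite /Q; congr tilted; ring.
    exact: tilted_dist.
  by have [x x0 Hx] := lab_near (DQ 0); case: (no x).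
pose s := Num.min (r / 2) (u / 2).
have s_gt0 : 0 < s by rewrite lt_min; apply/andP; split; lra.
have sr : s <= r / 2 by rewrite ge_min lexx.
have su : s <= u / 2 by rewrite ge_min lexx orbT.
have three t : `|t| < r -> lab (Q t) != lab (Q 0) -> lab (Q t) != lab P -> (3 <= rk P)%N.
  move=> tr n0 n1.
  have i01 : idx (Q 0) != idx P.
    apply: contra_neq labQ1; apply: H2 => //; apply: lt_le_trans (near 0) _.
    by rewrite /d ge_min lexx orbT.
  have it1 : idx (Q t) != idx P.
    apply: contra_neq n1; apply: H2 => //; apply: lt_le_trans (near t) _.
    by rewrite /d ge_min lexx orbT.
  have it0 : idx (Q t) != idx (Q 0) by apply: contra_neq n0; exact: Hr.
  have inP t' : idx (Q t') \in adherent P.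
    have /H1 /fintype.subsetP : pdist P (Q t') < d1.
      by apply: lt_le_trans (near t') _; rewrite /d ge_min lexx.
    by apply; exact: idx_adherent.
  rewrite /rk cardE; apply: (@uniq_leq_size _ [:: idx P; idx (Q 0); idx (Q t)]).
    by rewrite /= !inE negb_or eq_sym i01 eq_sym it1 eq_sym it0.
  by move=> i; rewrite !inE mem_enum => /or3P[] /eqP ->; rewrite ?idx_adherent ?inP.
(* a decrease of the phase makes [l + 1] lose against [l + 2], an increase makes
   [l + 1] win *)
have [E|E] := eqVneq (lab (Q 0)) m0%:~R.
  apply: (three (- s)).
  - by rewrite normrN gtr0_norm //; lra.
  - rewrite E; apply/eqP => E'; have := best (- s) m0 (m0 + 1) (esym E').
    rewrite m00 m01 mulr0 sub0r mulr1.
    have -> : 2 * u - u - s = u - s by ring.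
    have -> : - u - s = - (u + s) by ring.
    rewrite cosN leNgt cos_lt_outside //; apply/andP; split; lra.
  - apply: Nl; right; have -> : - (3 * u) - s = - (3 * u + s) by ring.
    rewrite cosN; apply: cos_lt_outside; apply/andP; split; lra.
have labQs : lab (Q s) = m0%:~R.
  pose x := lab (Q s) - m0%:~R; have [/eqP|xn] := eqVneq x 0.
    by rewrite subr_eq0 => /eqP.
  pose j := (x : nat); have jx : j%:~R = x :> 'Z_p by exact: Zp_intr.
  have jp : (j < p)%N by rewrite -[X in (_ < X)%N](Zp_cast p_gt1); exact: ltn_ord.
  have j0 : (0 < j)%N by rewrite lt0n; apply: contra_neq xn => j0; apply/val_inj.
  have := best s (m0 + j) m0 _; rewrite rmorphD /= jx addrC subrK => /(_ erefl).
  have -> : (m0 + j - m0)%:~R = j%:R :> R by rewrite addrAC subrr add0r -pmulrn.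
  rewrite m00 mulr0 sub0r.
  have -> : - u + s = - (u - s) by ring.
  have j1 : 1 <= j%:R :> R by rewrite (ler_nat _ 1).
  have jp' : j%:R + 1 <= p%:R :> R by rewrite -[1]/(1%:R) -natrD ler_nat addn1.
  rewrite cosN leNgt cos_lt_outside //; apply/andP; split; nra.
apply: (three s).
- by rewrite gtr0_norm //; lra.
- by rewrite labQs eq_sym.
- rewrite labQs /m0 rmorphD /= lE -subr_eq0 addrAC subrr add0r.
  by have := intr_Zp_eq0 p_gt1 1 => ->; rewrite dvdzE /= dvdn1 gtn_eqF.
Qed.
End Lower.

(** * The family of orthogonal pairs *)

Section Lipschitz.
Variable R : realType.

Lemma lipschitz1_of_derive (f df : R -> R) : (forall x : R, is_derive x 1 f (df x)) ->
  (forall x, `|df x| <= 1) -> forall a b, `|f a - f b| <= `|a - b|.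
Proof.
move=> Hf H1; have wlog_case a b : a <= b -> `|f b - f a| <= `|b - a|.
  move=> ab; have [|c _ ->] := @MVT_segment R f df a b ab (fun x _ => Hf x).
    apply: continuous_subspaceT => x; apply: differentiable_continuous.
    by apply/derivable1_diffP; have [] := Hf x.
  by rewrite normrM ler_piMl.
move=> a b; have [ab|/ltW ba] := leP a b; last exact: wlog_case.
by rewrite distrC (distrC a); exact: wlog_case.
Qed.

Lemma cos_lipschitz (a b : R) : `|cos a - cos b| <= `|a - b|.
Proof.
apply: (lipschitz1_of_derive (df := fun x => - sin x)) => x.
by rewrite normrN sin_max.
Qed.

Lemma sin_lipschitz (a b : R) : `|sin a - sin b| <= `|a - b|.
Proof. by apply: (lipschitz1_of_derive (df := cos)) => x; exact: cos_max. Qed.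

Lemma mul_lipschitz (a b a' b' e f : R) : `|a - a'| <= e -> `|b - b'| <= f -> `|b| <= 1 -> `|a'| <= 1 ->
  `|a * b - a' * b'| <= e + f.
Proof.
move=> h1 h2 h3 h4.
have -> : a * b - a' * b' = (a - a') * b + a' * (b - b') by ring.
apply: le_trans (ler_normD _ _) _; rewrite !normrM.
have := normr_ge0 (a - a'); have := normr_ge0 (b - b'); nra.
Qed.
End Lipschitz.

Section Family.
Variables (R : realType) (p : nat).
Hypothesis p_gt0 : (0 < p)%N.
Let S := @sphere3 R.

(** The vector [(sin al e^(i ph), cos al)]. *)
Definition xvec (al ph : R) : C2 R := \matrix_(i, j)
  if i == ord0 then (if j == ord0 then sin al * cos ph else sin al * sin ph)
  else (if j == ord0 then cos al else 0).

(** The vector [e^(i th) (- cos al, sin al e^(- i ph))], orthogonal to [xvec al ph]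
    for the Hermitian product. *)
Definition yvec (al ph th : R) : C2 R := \matrix_(i, j)
  if i == ord0 then (if j == ord0 then - (cos al * cos th) else - (cos al * sin th))
  else (if j == ord0 then sin al * cos (th - ph) else sin al * sin (th - ph)).

Lemma xvec_unit al ph : inner (xvec al ph) (xvec al ph) = 1.
Proof.
have h1 := cos2Dsin2 al; have h2 := cos2Dsin2 ph.
rewrite innerE !mxE /=; transitivity (sin al ^+ 2 * (cos ph ^+ 2 + sin ph ^+ 2) + cos al ^+ 2); first by ring.
by rewrite h2 mulr1 addrC.
Qed.

Lemma yvec_unit al ph th : inner (yvec al ph th) (yvec al ph th) = 1.
Proof.
have h1 := cos2Dsin2 al; have h2 := cos2Dsin2 th; have h3 := cos2Dsin2 (th - ph).
rewrite innerE !mxE /=; transitivity (sin al ^+ 2 * (cos (th - ph) ^+ 2 + sin (th - ph) ^+ 2)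
  + cos al ^+ 2 * (cos th ^+ 2 + sin th ^+ 2)); first by ring.
by rewrite h2 h3 !mulr1 addrC.
Qed.

Definition family (al ph th : R) : S * S := (to_sphere (xvec_unit al ph), to_sphere (yvec_unit al ph th)).

Lemma yvec_rot al ph th t : yvec al ph th *m rot t = yvec al ph (th + t).
Proof.
apply: C2_eqP; rewrite ?(rotE _ _ _).1 ?(rotE _ _ _).2 !mxE /=;
by rewrite ?[th + t - ph]addrAC ?(cosD th t, sinD th t, cosD (th - ph) t, sinD (th - ph) t); ring.
Qed.

Lemma xvec_yvec al ph th : inner (xvec al ph) (yvec al ph th) = 0.
Proof.
have h : cos ph ^+ 2 + sin ph ^+ 2 = 1 := cos2Dsin2 ph.
rewrite innerE !mxE /=.
transitivity (sin al * cos al * (cos (th - ph) - (cos ph * cos th + sin ph * sin th))); first by ring.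
by rewrite cosB; ring.
Qed.

Lemma family_orthogonal al ph th : orthogonal_pair (family al ph th).
Proof. by move=> t; rewrite /= yvec_rot xvec_yvec. Qed.

Lemma sphere_pair_eq (P Q : S * S) : \val P.1 = \val Q.1 -> \val P.2 = \val Q.2 -> P = Q.
Proof. by case: P Q => [x y] [x' y'] /= h1 h2; congr (_, _); apply/val_inj. Qed.

Lemma family_shift al ph th : family al ph (th + 2 * pi / p%:R) = gact p 0 1 (family al ph th).
Proof.
apply: sphere_pair_eq; rewrite /= ?lens_act0 //.
by rewrite /lens_act yvec_rot mulr1.
Qed.

(** On [al = pi / 2] the pair is [((e^(i ph), 0), (0, e^(i (th - ph))))], so that
    turning [ph] is an instance of the action. *)
Lemma family_edge ph th : family (pi / 2) (ph + 2 * pi / p%:R) th = gact p 1 (-1) (family (pi / 2) ph th).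
Proof.
have e1 : 2 * pi * 1%:~R / p%:R = 2 * pi / p%:R :> R by rewrite mulr1.
have e2 : 2 * pi * (-1)%:~R / p%:R = - (2 * pi / p%:R) :> R by rewrite rmorphN mulrN1 mulNr.
apply: sphere_pair_eq; rewrite /= /lens_act ?e1 ?e2; set u := 2 * pi / p%:R.
  apply: C2_eqP; rewrite ?(rotE _ _ _).1 ?(rotE _ _ _).2 !mxE /= ?cos_pihalf ?sin_pihalf;
  by rewrite ?cosD ?sinD; ring.
rewrite yvec_rot; apply: C2_eqP; rewrite !mxE /= ?cos_pihalf ?sin_pihalf ?mul0r //.
  by rewrite !mul1r; congr cos; ring.
by rewrite !mul1r; congr sin; ring.
Qed.

Lemma family_centre ph th : family 0 ph th = family 0 0 th.
Proof.
apply: sphere_pair_eq; rewrite /=; apply: C2_eqP; rewrite !mxE /= ?cos0 ?sin0; ring.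
Qed.

Lemma family_periodic al ph th : family al (ph + 2 * pi) th = family al ph th.
Proof.
have c := cosD2pi ph; have s := sinD2pi ph; rewrite -mulr_natl in c s.
have c' t : cos (t - (ph + 2 * pi)) = cos (t - ph) :> R.
  by have := cosD2pi (t - (ph + 2 * pi)); rewrite -mulr_natl => <-; congr cos; ring.
have s' t : sin (t - (ph + 2 * pi)) = sin (t - ph) :> R.
  by have := sinD2pi (t - (ph + 2 * pi)); rewrite -mulr_natl => <-; congr sin; ring.
by apply: sphere_pair_eq; rewrite /=; apply: C2_eqP; rewrite !mxE /= ?c ?s ?c' ?s'.
Qed.

Lemma enorm_le_entries (z : C2 R) e : (forall i j, `|z i j| <= e) -> enorm z <= 2 * e.
Proof.
move=> H; have e0 : 0 <= e by apply: le_trans (H ord0 ord0).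
rewrite -[leRHS]ger0_norm ?mulr_ge0 // -sqrtr_sqr ler_wsqrtr // innerE.
have B i j : z i j * z i j <= e * e.
  by have := H i j; rewrite ler_norml => /andP[h1 h2]; nra.
have := B ord0 ord0; have := B ord0 ord_max; have := B ord_max ord0; have := B ord_max ord_max.
by rewrite expr2; lra.
Qed.

Lemma family_lipschitz al ph th al' ph' th' :
  pdist (family al ph th) (family al' ph' th') <= 4 * (`|al - al'| + `|ph - ph'| + `|th - th'|).
Proof.
set e := _ + _ + _.
have a0 := normr_ge0 (al - al'); have f0 := normr_ge0 (ph - ph'); have t0 := normr_ge0 (th - th').
have tp : `|(th - ph) - (th' - ph')| <= `|th - th'| + `|ph - ph'|.
  have -> : (th - ph) - (th' - ph') = (th - th') - (ph - ph') by ring.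
  exact: ler_normB.
have M (g h : R -> R) u u' w w' : (forall a b, `|g a - g b| <= `|a - b|) -> (forall a b, `|h a - h b| <= `|a - b|) ->
    (forall a, `|g a| <= 1) -> (forall a, `|h a| <= 1) -> `|g u * h w - g u' * h w'| <= `|u - u'| + `|w - w'|.
  by move=> hg hh g1 h1; apply: mul_lipschitz.
have C := @cos_lipschitz R; have C1 := @cos_max R; have Sn := @sin_lipschitz R; have S1 := @sin_max R.
have X : enorm (xvec al ph - xvec al' ph') <= 2 * e.
  apply: enorm_le_entries => i j; case: (ord2P i) => ->; case: (ord2P j) => ->; rewrite !mxE /=.
  - by apply: le_trans (M sin cos _ _ _ _ Sn C S1 C1) _; rewrite /e; lra.
  - by apply: le_trans (M sin sin _ _ _ _ Sn Sn S1 S1) _; rewrite /e; lra.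
  - by apply: le_trans (C _ _) _; rewrite /e; lra.
  - by rewrite subrr normr0 /e; lra.
have Y : enorm (yvec al ph th - yvec al' ph' th') <= 2 * e.
  apply: enorm_le_entries => i j; case: (ord2P i) => ->; case: (ord2P j) => ->; rewrite !mxE /=.
  - by rewrite -opprD normrN; apply: le_trans (M cos cos _ _ _ _ C C C1 C1) _; rewrite /e; lra.
  - by rewrite -opprD normrN; apply: le_trans (M cos sin _ _ _ _ C Sn C1 S1) _; rewrite /e; lra.
  - by apply: le_trans (M sin cos _ _ _ _ Sn C S1 C1) _; rewrite /e; lra.
  - by apply: le_trans (M sin sin _ _ _ _ Sn Sn S1 S1) _; rewrite /e; lra.
by rewrite /pdist /=; lra.
Qed.
End Family.

(** * Thickened levels and the lower bound *)

Section Thickening.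
Variables (R : realType) (p k : nat).
Hypothesis p_gt2 : (2 < p)%N.
Hypothesis k_lt6 : (k < 6)%N.
Let p_gt1 : (1 < p)%N := ltnW p_gt2.
Let p_gt0 : (0 < p)%N := ltnW p_gt1.
Let S := @sphere3 R.
Variables (idx : S * S -> 'I_k) (lab : S * S -> 'Z_p).
Hypothesis idx_gact : forall a b P, idx (gact p a b P) = idx P.
Hypothesis lab_gact : forall a b P, independent P -> lab (gact p a b P) = lab P + a%:~R - b%:~R.
Hypothesis lab_short : forall P m, independent P -> m%:~R = lab P -> short p m P.
Hypothesis lab_near : forall P, independent P -> exists2 d, 0 < d &
      forall Q, pdist P Q < d -> independent Q -> idx Q = idx P -> lab Q = lab P.
Hypothesis idx_near : forall P, exists2 d, 0 < d & forall Q, pdist P Q < d ->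
      (forall e, 0 < e -> exists2 Q', pdist Q Q' < e & idx Q' = idx P) -> idx Q = idx P.
Let rk := rk idx.

Definition good (d : R) (P : S * S) := orthogonal_pair P /\
  forall Q, orthogonal_pair Q -> pdist P Q < 3 * d -> rk Q = rk P -> lab Q = lab P.

Lemma exists_good P : orthogonal_pair P -> exists2 d, 0 < d & good d P.
Proof.
move=> o; have [d d0 H] := rk_near lab_near idx_near (orthogonal_pair_independent o).
exists (d / 3); first by rewrite divr_gt0.
split=> // Q oQ; rewrite mulrC divfK // => /H /(_ (orthogonal_pair_independent oQ)) [_]; apply.
Qed.

Lemma orthogonal_pair_gact a b (P : S * S) : orthogonal_pair P -> orthogonal_pair (gact p a b P).
Proof.
move=> o t; rewrite /= /lens_act -mulmxA rotD -(inner_rot _ _ (- (2 * pi * a%:~R / p%:R))).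
by rewrite -!mulmxA !rotD addrN rot0 mulmx1; exact: o.
Qed.

Lemma good_gact d a b P : good d P -> good d (gact p a b P).
Proof.
move=> [oP H]; split; first exact: orthogonal_pair_gact.
move=> Q oQ; have oQ' := @orthogonal_pair_gact (- a) (- b) Q oQ.
have EQ : Q = gact p a b (gact p (- a) (- b) Q).
  by rewrite -{1}(opprK a) -{1}(opprK b) gactK.
move: (gact p (- a) (- b) Q) oQ' EQ => Q' oQ' ->.
rewrite pdist_gact /rk !(rk_gact idx_gact) => PQ rQ.
rewrite !lab_gact; try exact: orthogonal_pair_independent.
by congr (_ + _ - _); apply: H.
Qed.

Variables (mesh : R).
Hypothesis mesh_gt0 : 0 < mesh.

(** The scale [d] may depend on [P]; only its lower bound [mesh] is uniform. *)
Definition centre (v P : S * S) := exists2 d, mesh <= d & good d P /\ pdist v P < d.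

Lemma centre_gact a b v P : centre v P -> centre (gact p a b v) (gact p a b P).
Proof.
by move=> [d ds [g vP]]; exists d => //; split; [exact: good_gact | rewrite pdist_gact].
Qed.

(** The distance between the centres is less than [d + e + mesh], hence less than
    three times the larger scale, on which its own centre is good. *)
Lemma centre_label u v P Q : pdist u v < mesh -> centre u P -> centre v Q -> rk P = rk Q -> lab P = lab Q.
Proof.
move=> uv [d ds [[oP gP] uP]] [e es [[oQ gQ] vQ]] r.
have PQ : pdist P Q < d + e + mesh.
  apply: le_lt_trans (pdist_triangle u P Q) _; rewrite (pdistC P).
  have := pdist_triangle v u Q; lra.
have [de|/ltW ed] := leP d e.
  by apply: gQ => //; rewrite pdistC; lra.
by symmetry; apply: gP => //; lra.
Qed.

Definition has_rank v r := `[< exists2 P, centre v P & rk P = r >].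

(** Any rule that depends only on the ranks of the centres of [v] would do; these
    are 3, 4 or 5 because there are at most five members. *)
Definition thick_level v : nat := if has_rank v 3 then 0 else if has_rank v 4 then 1 else 2.

Definition thick_label v : 'Z_p :=
  xget 0 [set l | exists2 P, centre v P & rk P = (thick_level v + 3)%N /\ lab P = l].

Lemma thick_levelP v : (exists P, centre v P) ->
  exists2 P, centre v P & rk P = (thick_level v + 3)%N /\ lab P = thick_label v.
Proof.
move=> [P0 c0].
have [P cP rP] : exists2 P, centre v P & rk P = (thick_level v + 3)%N.
  rewrite /thick_level; case: ifP => [/asboolP //|n3]; case: ifP => [/asboolP //|n4].
  exists P0 => //; have [d ds [[oP _] _]] := c0.
  have r3 := rk_ge3 p_gt2 lab_short lab_near oP.
  have r5 : (rk P0 <= 5)%N by apply: leq_trans (max_card _) _; rewrite card_ord.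
  have n3' : rk P0 <> 3%N by move=> e; move/negP: n3; apply; apply/asboolP; exists P0.
  have n4' : rk P0 <> 4%N by move=> e; move/negP: n4; apply; apply/asboolP; exists P0.
  by rewrite /rk in r3 r5 n3' n4' *; lia.
have : [set l | exists2 P, centre v P & rk P = (thick_level v + 3)%N /\ lab P = l] (lab P).
  by exists P.
by rewrite /thick_label; case: xgetP => [l _ //|no] => /no.
Qed.

Lemma thick_gact a b v : (exists P, centre v P) ->
  thick_level (gact p a b v) = thick_level v /\
  thick_label (gact p a b v) = thick_label v + a%:~R - b%:~R.
Proof.
move=> ex; have hr r : has_rank (gact p a b v) r = has_rank v r.
  apply/asbool_equiv_eq; split=> -[P cP rP].
    exists (gact p (- a) (- b) P); last by rewrite /rk (rk_gact idx_gact).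
    by rewrite -(@gactK _ p a b v); exact: centre_gact.
  by exists (gact p a b P); [exact: centre_gact | rewrite /rk (rk_gact idx_gact)].
have lev : thick_level (gact p a b v) = thick_level v by rewrite /thick_level !hr.
split=> //; have [P cP [rP <-]] := thick_levelP ex.
have ex' : exists P, centre (gact p a b v) P by exists (gact p a b P); exact: centre_gact.
have [Q cQ [rQ <-]] := thick_levelP ex'.
have oP : independent P by have [d _ [[oP _] _]] := cP; exact: orthogonal_pair_independent.
rewrite -lab_gact //; symmetry.
apply: (@centre_label (gact p a b v) (gact p a b v)) => //; first by rewrite pdistxx.
  exact: centre_gact.
by rewrite rQ lev -rP /rk (rk_gact idx_gact).
Qed.

Lemma thick_compatible u v : pdist u v < mesh -> (exists P, centre u P) -> (exists P, centre v P) ->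
  thick_level u = thick_level v -> thick_label u = thick_label v.
Proof.
move=> uv eu ev e; have [P cP [rP <-]] := thick_levelP eu; have [Q cQ [rQ <-]] := thick_levelP ev.
by apply: (centre_label uv cP cQ); rewrite rP rQ e.
Qed.

Lemma thick_level_lt3 v : (thick_level v < 3)%N.
Proof. by rewrite /thick_level; do 2?case: ifP. Qed.
End Thickening.

Section LowerBound.
Variables (R : realType) (p k : nat).
Hypothesis p_gt2 : (2 < p)%N.
Hypothesis k_lt6 : (k < 6)%N.
Let p_gt1 : (1 < p)%N := ltnW p_gt2.
Let p_gt0 : (0 < p)%N := ltnW p_gt1.
Let S := @sphere3 R.
Variables (idx : S * S -> 'I_k) (lab : S * S -> 'Z_p).
Hypothesis idx_gact : forall a b P, idx (gact p a b P) = idx P.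
Hypothesis lab_gact : forall a b P, independent P -> lab (gact p a b P) = lab P + a%:~R - b%:~R.
Hypothesis lab_short : forall P m, independent P -> m%:~R = lab P -> short p m P.
Hypothesis lab_near : forall P, independent P -> exists2 d, 0 < d &
      forall Q, pdist P Q < d -> independent Q -> idx Q = idx P -> lab Q = lab P.
Hypothesis idx_near : forall P, exists2 d, 0 < d & forall Q, pdist P Q < d ->
      (forall e, 0 < e -> exists2 Q', pdist Q Q' < e & idx Q' = idx P) -> idx Q = idx P.

Let box : set (R * R * R) := (`[0, pi / 2] `*` `[0, 4 * pi]) `*` `[0, 4 * pi].

Lemma box_compact : compact box.
Proof. by do !apply: compact_setX; exact: segment_compact. Qed.

Let fam (t : R * R * R) := @family R t.1.1 t.1.2 t.2.

(** A Lebesgue number of the compact parameter box for the covering by the balls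
    around good pairs.  The box is large enough for a full period of [ph] and one more
    step [2 pi / p]. *)
Lemma exists_mesh : exists2 mesh, 0 < mesh &
   forall t, box t -> exists P, centre idx lab mesh (fam t) P.
Proof.
have := (@compact_near_coveringP _ box).1 box_compact R (0^'+)
  (fun mesh t => exists P, centre idx lab mesh (fam t) P) _.
case=> [t _|mesh /= m0 H].
  have [d d0 gd] := exists_good lab_near idx_near (@family_orthogonal R t.1.1 t.1.2 t.2).
  pose e := d / 12; have e0 : 0 < e by rewrite divr_gt0.
  exists ((ball t.1.1 e `*` ball t.1.2 e) `*` ball t.2 e, [set r | r < d]) => /=.
    split; last by apply: nbhs_right_lt.
    exists ((ball t.1.1 e `*` ball t.1.2 e), ball t.2 e) => //=.
    split; last exact: nbhsx_ballx.
    by exists (ball t.1.1 e, ball t.1.2 e) => //=; split; exact: nbhsx_ballx.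
  move=> [[[s1 s2] s3] r] /= [[[b1 b2] b3] rd]; exists (fam t); exists d; first exact: ltW.
  split=> //; have B (x y : R) : ball x e y -> `|y - x| < e by rewrite -ball_normE /ball_ /= distrC.
  apply: le_lt_trans (family_lipschitz _ _ _ _ _ _) _.
  have := B _ _ b1; have := B _ _ b2; have := B _ _ b3; rewrite /e /=; lra.
exists (mesh / 2); first by rewrite divr_gt0.
apply: H.
- by rewrite /ball_ /= sub0r normrN gtr0_norm ?divr_gt0 //; lra.
- by rewrite divr_gt0.
Qed.

(** The thickened levels and labels on a grid finer than [mesh] satisfy the
    hypotheses of [no_equivariant_labelling]. *)
Lemma no_labelling : False.
Proof.
have [mesh m0 cov] := exists_mesh.
pose lev := thick_level idx lab mesh; pose lbl := thick_label idx lab mesh.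
have pi0 := pi_gt0 R.
have p3 : 3 <= p%:R :> R by rewrite ler_nat.
have pz : p%:R != 0 :> R by rewrite gt_eqF //; lra.
(* an upper bound for [4 (pi / 2 + u + u)], the Lipschitz constant in the grid
   coordinates *)
pose C : R := 32 * pi.
have C0 : 0 < C by rewrite mulr_gt0.
pose n := (Num.truncn (C / mesh)).+1.
have n0 : 0 < n%:R :> R by rewrite ltr0n.
have nz : n%:R != 0 :> R by rewrite gt_eqF.
have n1 : n%:R^-1 <= 1 :> R by rewrite invf_le1 // (ler_nat _ 1).
have Cn : C / n%:R < mesh.
  by rewrite ltr_pdivrMr // mulrC -ltr_pdivrMr // Num.Theory.truncnS_gt.
pose h : R := n%:R^-1; have h0 : 0 < h by rewrite invr_gt0.
have nh : n%:R * h = 1 by rewrite divff.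
pose al (a : nat) : R := pi / 2 * (a%:R * h).
pose u : R := 2 * pi / p%:R.
have u0 : 0 < u by rewrite divr_gt0 //; lra.
have pu : p%:R * u = 2 * pi by rewrite /u; field.
have u1 : u <= pi by nra.
pose ph (b : nat) : R := u * (b%:R * h).
pose F a b c := @family R (al a) (ph b) (ph c).
have al_n : al n = pi / 2 by rewrite /al nh mulr1.
have ph_n b : ph (n + b)%N = ph b + u by rewrite /ph natrD mulrDl nh; ring.
have in_box a b c : (a <= n)%N -> (b <= p * n + n)%N -> (c <= n)%N -> exists P, centre idx lab mesh (F a b c) P.
  move=> an bn cn; apply: (cov (al a, ph b, ph c)).
  have B m M : (m <= M)%N -> 0 <= m%:R * h <= M%:R * h.
    by move=> mM; rewrite ler_pM2r // ler_nat mM andbT mulr_ge0 // ltW.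
  have := B _ _ an; have := B _ _ bn; have := B _ _ cn.
  rewrite natrD natrM mulrDl -mulrA nh mulr1 => /andP[c1 c2] /andP[b1 b2] /andP[a1 a2].
  rewrite /box /al /ph /=; split; first split; rewrite /= in_itv /=; apply/andP; split; nra.
have ph_pn b : ph (p * n + b)%N = ph b + 2 * pi.
  by rewrite /ph natrD natrM mulrDl -mulrA nh mulr1 mulrDr [u * p%:R]mulrC pu addrC.
have F_mod a b c q : F a (q * (p * n) + b)%N c = F a b c.
  elim: q => [|q IH]; first by rewrite mul0n.
  by rewrite mulSn -addnA /F ph_pn family_periodic.
have in_box' a b c : (a <= n)%N -> (c <= n)%N -> exists P, centre idx lab mesh (F a b c) P.
  move=> an cn; rewrite (divn_eq b (p * n)) F_mod; apply: in_box => //.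
  apply: leq_trans (leq_addr _ _); apply/ltnW/ltn_pmod; by rewrite muln_gt0 p_gt0.
have shiftE a b P : (exists Q, centre idx lab mesh P Q) ->
    (lev (gact p a b P), lbl (gact p a b P)) = shift (a%:~R - b%:~R) (lev P, lbl P).
  move=> ex; have [e1 e2] := thick_gact p_gt2 k_lt6 idx_gact lab_gact lab_short lab_near m0 a b ex.
  by rewrite /lev /lbl e1 e2 /shift /= addrA.
pose v a b c := (lev (F a b c), lbl (F a b c)).
have F_edge b c : F n (n + b)%N c = gact p 1 (-1) (F n b c).
  by rewrite /F al_n ph_n family_edge.
have F_shift a b : F a b n = gact p 0 1 (F a b 0%N).
  by have := ph_n 0%N; rewrite addn0 /F => ->; rewrite -family_shift.
apply: (@no_equivariant_labelling p p_gt1 n v).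
- by move=> a b c; exact: thick_level_lt3.
- move=> a b c i j m i' j' m' an cn.
  have D : pdist (F (i + a) (j + b) (m + c))%N (F (i' + a) (j' + b) (m' + c))%N < mesh.
    apply: le_lt_trans Cn; apply: le_trans (family_lipschitz _ _ _ _ _ _) _.
    have bd (x y : bool) w M : 0 <= M -> `|M * ((x + w)%:R * h) - M * ((y + w)%:R * h)| <= M * h.
      move=> M0; have -> : M * ((x + w)%:R * h) - M * ((y + w)%:R * h) = (M * h) * (x%:R - y%:R).
        by rewrite !natrD; ring.
      rewrite normrM ger0_norm ?mulr_ge0 ?(ltW h0) // ler_piMr ?mulr_ge0 ?(ltW h0) //.
      by case: x y => [] []; rewrite ?subrr ?subr0 ?sub0r ?normrN ?normr0 ?normr1.
    have := bd i i' a (pi / 2) (divr_ge0 (ltW pi0) (ler0n _ 2)).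
    have := bd j j' b u (ltW u0); have := bd m m' c u (ltW u0).
    rewrite -/(al _) -/(al _) -!/(ph _) -/h /C => b1 b2 b3.
    have uh : u * h <= pi * h by rewrite ler_pM2r.
    have ph0 : 0 < pi * h by rewrite mulr_gt0.
    lra.
  have bn (x : bool) w : (w < n)%N -> (x + w <= n)%N.
    by case: x => *; rewrite ?add1n ?add0n // ltnW.
  move=> e.
  exact: (thick_compatible p_gt2 k_lt6 lab_short lab_near m0 D (in_box' _ _ _ (bn i a an) (bn m c cn))
    (in_box' _ _ _ (bn i' a an) (bn m' c cn)) e).
- by move=> a c an cn; rewrite /v -[(p * n)%N]mul1n -[X in F a X c]addn0 F_mod.
- by move=> b c cn; rewrite /v /F /al mul0r mulr0 family_centre [in RHS]family_centre.
- move=> b c cn; rewrite /v F_edge shiftE; last exact: in_box'.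
  by congr shift; rewrite rmorphN opprK.
- move=> a b an; rewrite /v F_shift shiftE; last exact: in_box'.
  by congr shift; rewrite sub0r.
- exact: p_gt2.
- by [].
Qed.
End LowerBound.

(** * Sectors and rays *)

Section Polar.
Variables (R : realType) (p : nat).
Hypothesis p_gt0 : (0 < p)%N.
Implicit Types (z : C2 R) (t : R).

(** Vectors of C^2 are used here through their first coordinate only. *)
Definition polar z t := exists2 r, 0 < r &
  z ord0 ord0 = r * cos t /\ z ord0 ord_max = r * sin t.

Definition coord_neq0 z := (z ord0 ord0 != 0) || (z ord0 ord_max != 0).

Lemma polar_exists z : coord_neq0 z -> exists t, polar z t.
Proof.
rewrite /coord_neq0; set a := z ord0 ord0; set b := z ord0 ord_max => nz.
have s0 : 0 < a ^+ 2 + b ^+ 2.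
  by rewrite lt_neqAle eq_sym addr_ge0 ?sqr_ge0 // andbT paddr_eq0 ?sqr_ge0 // !sqrf_eq0 negb_and.
pose r := Num.sqrt (a ^+ 2 + b ^+ 2); have r0 : 0 < r by rewrite sqrtr_gt0.
have rr : r ^+ 2 = a ^+ 2 + b ^+ 2 by rewrite sqr_sqrtr // ltW.
have ar : -1 <= a / r <= 1.
  by rewrite ler_pdivrMr // ler_pdivlMr //; apply/andP; split; nra.
have sb : sin (acos (a / r)) = `|b| / r.
  rewrite sin_acos // expr_div_n rr.
  have -> : 1 - a ^+ 2 / (a ^+ 2 + b ^+ 2) = (b / r) ^+ 2.
    by rewrite expr_div_n rr; field; rewrite gt_eqF.
  by rewrite sqrtr_sqr normrM normfV (gtr0_norm r0).
have ca : cos (acos (a / r)) = a / r by rewrite acosK // in_itv.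
have rn : r != 0 by rewrite gt_eqF.
have [b0|b0] := leP 0 b.
  exists (acos (a / r)), r => //; rewrite ca sb -/a -/b ger0_norm //.
  by split; field.
exists (- acos (a / r)), r => //; rewrite cosN sinN ca sb -/a -/b ltr0_norm //.
by split; field.
Qed.

Lemma polar_unique z t s : polar z t -> polar z s -> exists n : int, t - s = 2 * pi * n%:~R.
Proof.
move=> [r r0 [a1 b1]] [q q0 [a2 b2]]; apply: cos_eq1_int.
have H : cos (t - s) * (r * q) = r ^+ 2.
  rewrite cosB; transitivity ((r * cos t) * (q * cos s) + (r * sin t) * (q * sin s)); first by ring.
  rewrite -a1 -b1 -a2 -b2 -!expr2 a1 b1.
  by rewrite -[RHS]mulr1 -(cos2Dsin2 t); ring.
have rq : r = q.
  have : r ^+ 2 = q ^+ 2.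
    rewrite -[LHS]mulr1 -[RHS]mulr1 -{1}(cos2Dsin2 t) -(cos2Dsin2 s) !mulrDr -!exprMn.
    by rewrite -a1 -b1 -a2 -b2.
  by move/eqP; rewrite eqf_sqr => /orP[/eqP //|/eqP e]; lra.
by move: H; rewrite -rq -expr2 -[RHS]mul1r; apply: mulIf; rewrite expf_neq0 // gt_eqF.
Qed.

Lemma polar_rot z t s : polar z t -> polar (z *m rot s) (t + s).
Proof.
move=> [r r0 [a b]]; exists r => //; rewrite (rotE _ _ _).1 (rotE _ _ _).2 a b cosD sinD.
by split; ring.
Qed.

Lemma polar_near z t e : polar z t -> 0 < e ->
  nbhs z [set z' | exists2 t', polar z' t' & `|t' - t| < e].
Proof.
move=> pz e0; have := polar_rot (- t) pz; rewrite subrr => -[r r0]; rewrite cos0 sin0 mulr1 mulr0 => -[a0 b0].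
have cr : {for z, continuous (fun z' => z' *m rot (- t) : C2 R)}.
  by apply: continuous_rot; [exact: id | exact: cst_continuous].
pose f i j (z' : C2 R) := (z' *m rot (- t)) i j.
have cf i j : {for z, continuous (f i j)}.
  by apply: (continuous_comp_at cr (g := fun w : C2 R => w i j)); exact: continuous_entry.
have ca : {for z, continuous (fun z' => atan (f ord0 ord_max z' / f ord0 ord0 z'))}.
  apply: (@continuous_comp_at _ _ _ (fun z' => f ord0 ord_max z' / f ord0 ord0 z') (@atan R)); last exact: continuous_atan.
  apply: continuousM; first exact: cf.
  by apply: continuousV; [rewrite /f a0 gt_eqF | exact: cf].
have n1 : nbhs z [set z' | 0 < f ord0 ord0 z'].
  have : nbhs (f ord0 ord0 z) [set s | 0 < s].
    by apply: open_nbhs_nbhs; split; [exact: open_gt | rewrite /= /f a0].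
  by move/(cf ord0 ord0).
have n2 : nbhs z [set z' | `|atan (f ord0 ord_max z' / f ord0 ord0 z')| < e].
  have Z : atan (f ord0 ord_max z / f ord0 ord0 z) = 0 by rewrite {1}/f b0 mul0r atan0.
  have : nbhs (atan (f ord0 ord_max z / f ord0 ord0 z)) [set s | `|s| < e].
    rewrite Z; apply/nbhs_ballP; exists e => // s; rewrite -ball_normE /ball_ /= sub0r normrN //.
  by move/ca.
apply: filterS2 n1 n2 => z' /=; set a := f ord0 ord0 z'; set b := f ord0 ord_max z' => a1 h.
exists (t + atan (b / a)); last by rewrite addrAC subrr add0r.
suff : polar (z' *m rot (- t)) (atan (b / a)).
  by move/(polar_rot t); rewrite -mulmxA rotD addNr rot0 mulmx1 addrC.
have an : a != 0 by rewrite gt_eqF.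
have c0 : 0 < cos (atan (b / a)).
  by apply: cos_gt0_pihalf; rewrite atan_gtNpi2 atan_ltpi2.
have st : sin (atan (b / a)) = b / a * cos (atan (b / a)).
  have E : tan (atan (b / a)) = b / a := atanK (b / a).
  by rewrite -{2}E /tan divfK // gt_eqF.
have cn : cos (atan (b / a)) != 0 by rewrite gt_eqF.
exists (a / cos (atan (b / a))); first by rewrite divr_gt0.
split; first by rewrite divfK.
by rewrite st -/(f ord0 ord_max z') -/b; field; rewrite an.
Qed.

Let u : R := 2 * pi / p%:R.
Let pn0 : p%:R != 0 :> R. Proof. by rewrite pnatr_eq0 -lt0n. Qed.
Let u0 : 0 < u. Proof. by rewrite divr_gt0 ?ltr0n // mulr_gt0 ?pi_gt0. Qed.
Let pu : p%:R * u = 2 * pi. Proof. by rewrite /u; field. Qed.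

Definition sector z (n : int) := exists2 t, polar z t & u * n%:~R <= t < u * (n + 1)%:~R.

Definition ray z := exists n : int, polar z (u * n%:~R).

Lemma sector_exists z : coord_neq0 z -> exists n, sector z n.
Proof.
move=> /polar_exists [t pt]; exists (Num.floor (t / u)), t => //.
have /andP[h1 h2] := Num.Theory.floor_itv (t / u).
by rewrite mulrC -ler_pdivlMr // h1 mulrC -ltr_pdivrMr.
Qed.

Lemma sector_unique z n m : sector z n -> sector z m -> (p %| n - m)%Z.
Proof.
move=> [t pt /andP[t1 t2]] [s ps /andP[s1 s2]]; have [k E] := polar_unique pt ps.
have E' : t = s + u * (p%:Z * k)%:~R by rewrite rmorphM /= -pmulrn mulrA [u * _]mulrC pu -E; ring.
rewrite E' in t1 t2.
have h1 : (n < m + 1 + p%:Z * k)%R.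
  rewrite -(ltr_int R) -(ltr_pM2l u0); apply: le_lt_trans t1 _.
  by rewrite [(m + 1 + _)%:~R]rmorphD mulrDr ltrD2r.
have h2 : (m + p%:Z * k < n + 1)%R.
  rewrite -(ltr_int R) -(ltr_pM2l u0); apply: le_lt_trans t2.
  by rewrite [(m + _)%:~R]rmorphD mulrDr lerD2r.
have -> : n - m = k * p%:Z by lia.
exact: dvdz_mull.
Qed.

Lemma sector_act z n m : sector z n -> sector (lens_act p m z) (n + m).
Proof.
move=> [t pt /andP[t1 t2]]; exists (t + u * m%:~R).
  have -> : u * m%:~R = 2 * pi * m%:~R / p%:R by rewrite /u; field.
  exact: polar_rot.
rewrite addrAC [(n + m)%:~R]intrD [(n + 1 + m)%:~R]intrD.
by rewrite !(mulrDr u) lerD2r ltrD2r t1.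
Qed.

Lemma ray_act z m : ray z -> ray (lens_act p m z).
Proof.
move=> [n pn]; exists (n + m); rewrite intrD mulrDr.
have -> : u * m%:~R = 2 * pi * m%:~R / p%:R by rewrite /u; field.
exact: polar_rot.
Qed.

(** A half-open sector is a neighbourhood of its points off the boundary ray.  A
    point on the boundary ray has neighbours in the sector before it, but those
    are not on rays. *)
Lemma sector_near z n : sector z n ->
  nbhs z [set z' | (ray z' -> ray z) /\ ((ray z -> ray z') -> sector z' n)].
Proof.
move=> [t pt /andP[t1 t2]].
have int_of z' t' : polar z' t' -> ray z' -> exists k : int, t' = u * k%:~R.
  move=> p1 [k p2]; have [j E] := polar_unique p1 p2; exists (k + p%:Z * j).
  rewrite intrD mulrDr rmorphM /= -pmulrn mulrA [u * p%:R]mulrC pu -E; ring.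
have [tn|tn] := eqVneq t (u * n%:~R).
  have rz : ray z by exists n; rewrite -tn.
  have e0 : 0 < u / 2 by rewrite divr_gt0.
  apply: filterS (polar_near pt e0) => z' [t' pt' tt']; split=> // /(_ rz) rz'.
  have [k E] := int_of _ _ pt' rz'; exists t' => //.
  suff <- : k = n by rewrite E lexx ltr_pM2l // ltr_int ltrDl.
  move: tt'; rewrite tn E -mulrBr -intrB normrM (gtr0_norm u0) -ltr_pdivlMl // mulrA mulVf ?gt_eqF // mul1r.
  move=> h; have : `|(k - n)%:~R| < 1 :> R by apply: lt_trans h _; rewrite invf_lt1 ?ltr1n.
  by rewrite -intr_norm -[1]/(1%:~R) ltr_int; lia.
have tn' : u * n%:~R < t by rewrite lt_neqAle eq_sym tn.
pose e := Num.min (t - u * n%:~R) (u * (n + 1)%:~R - t).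
have e0 : 0 < e by rewrite lt_min !subr_gt0 tn'.
apply: filterS (polar_near pt e0) => z' [t' pt' tt'].
have [b1 b2] : u * n%:~R < t' /\ t' < u * (n + 1)%:~R.
  by move: tt'; rewrite lt_min ltr_norml ltr_norml => /andP[/andP[h1 _] /andP[_ h2]]; split; lra.
split; last by move=> _; exists t' => //; rewrite ltW.
move=> /(int_of _ _ pt') [k E]; move: b1 b2; rewrite E !ltr_pM2l // !ltr_int; lia.
Qed.
End Polar.

(** * The code and the chosen label *)

Section Code.
Variables (R : realType) (p : nat).
Hypothesis p_gt2 : (2 < p)%N.
Let p_gt1 : (1 < p)%N := ltnW p_gt2.
Let p_gt0 : (0 < p)%N := ltnW p_gt1.
Let pn0 : p%:R != 0 :> R. Proof. by rewrite pnatr_eq0 -lt0n. Qed.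
Let S := @sphere3 R.
Implicit Types (x y z : C2 R) (P Q : S * S).

(** The Hermitian product of [y] and [x], in the first coordinate. *)
Definition hvec x y : C2 R := \matrix_(i, j)
  if i == ord0 then (if j == ord0 then inner x y else - inner x (y *m rot (pi / 2))) else 0.

Lemma hvecE x y : hvec x y ord0 ord0 = inner x y /\ hvec x y ord0 ord_max = - inner x (y *m rot (pi / 2)).
Proof. by rewrite !mxE. Qed.

Lemma hvec_rotr x y t : hvec x (y *m rot t) = hvec x y *m rot t.
Proof.
have [d1 d2] := hvecE x (y *m rot t); have [e1 e2] := hvecE x y.
apply: C2_eqP; rewrite ?d1 ?d2 ?(rotE _ _ _).1 ?(rotE _ _ _).2 ?e1 ?e2 ?[X in X = _]mxE /=;
  rewrite ?[hvec x y ord_max _]mxE ?mul0r ?subr0 ?addr0 //.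
all: by rewrite !innerE !(rotE _ _ _).1 !(rotE _ _ _).2 ?(rotE _ _ _).1 ?cos_pihalf ?sin_pihalf; ring.
Qed.

Lemma hvec_rotl x y t : hvec (x *m rot t) y = hvec x y *m rot (- t).
Proof.
rewrite -hvec_rotr; apply: C2_eqP; rewrite ?(hvecE _ _).1 ?(hvecE _ _).2 ?mxE //=.
  by rewrite -(inner_rot x _ t) -mulmxA rotD addNr rot0 mulmx1.
rewrite -[in RHS](inner_rot x _ t) -!mulmxA !rotD.
by have -> : - t + (pi / 2 + t) = pi / 2 by ring.
Qed.

Lemma hvec_eq0 x y : ~~ coord_neq0 (hvec x y) -> forall t, inner x (y *m rot t) = 0.
Proof.
rewrite /coord_neq0 negb_or !negbK => /andP[/eqP h1 /eqP h2] t.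
by rewrite -(hvecE _ _).1 hvec_rotr (rotE _ _ _).1 h1 h2 !mul0r subr0.
Qed.

Definition swap z : C2 R := \matrix_(i, j) (if i == ord0 then z ord_max j else z ord0 j).

Lemma swapE z j : swap z ord0 j = z ord_max j /\ swap z ord_max j = z ord0 j.
Proof. by rewrite !mxE. Qed.

Lemma swap_rot z t : swap (z *m rot t) = swap z *m rot t.
Proof.
by apply: C2_eqP; rewrite ?(rotE _ _ _).1 ?(rotE _ _ _).2 ?(swapE _ _).1 ?(swapE _ _).2
  ?(rotE _ _ _).1 ?(rotE _ _ _).2.
Qed.

Lemma coord_neq0_rot z t : coord_neq0 (z *m rot t) = coord_neq0 z.
Proof.
apply: negb_inj; rewrite /coord_neq0 !negb_or !negbK (rotE _ _ _).1 (rotE _ _ _).2.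
apply/andP/andP => [[/eqP h1 /eqP h2]|[/eqP -> /eqP ->]]; last by rewrite !mul0r subrr addr0.
have c1 := cos2Dsin2 t.
have a0 : z ord0 ord0 = (z ord0 ord0 * cos t - z ord0 ord_max * sin t) * cos t
   + (z ord0 ord0 * sin t + z ord0 ord_max * cos t) * sin t.
  by rewrite -[LHS]mulr1 -c1; ring.
have b0 : z ord0 ord_max = - (z ord0 ord0 * cos t - z ord0 ord_max * sin t) * sin t
   + (z ord0 ord0 * sin t + z ord0 ord_max * cos t) * cos t.
  by rewrite -[LHS]mulr1 -c1; ring.
rewrite h1 h2 oppr0 !mul0r addr0 in a0 b0; by rewrite a0 b0 eqxx.
Qed.

Lemma coord_neq0_near z : coord_neq0 z -> nbhs z [set z' | coord_neq0 z'].
Proof.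
have H j : z ord0 j != 0 -> nbhs z [set z' : C2 R | z' ord0 j != 0].
  move=> zj; have : nbhs (z ord0 j) [set s : R | s != 0].
    by apply: open_nbhs_nbhs; split => //; exact: open_neq.
  by move/(@continuous_entry R ord0 j z).
by move=> /orP[] /H; apply: filterS => z' /= h; rewrite /coord_neq0 h ?orbT.
Qed.

(** The half step turns the tie between two shortest geodesics into a ray. *)
Definition hrot P : C2 R := hvec (\val P.1) (\val P.2) *m rot (pi / p%:R).
Definition det P : C2 R := dvec (\val P.1) (\val P.2).
Definition lead P : C2 R := if coord_neq0 (\val P.1) then \val P.1 else swap (\val P.1).

Definition codim (z : C2 R) : nat := `[< ray p z >].

(** Passing from [x_1 != 0] to [x_1 = 0] costs 2, which exceeds the gain of 1 that is
    possible in [codim (lead P)].  So the value 4, which occurs in both cases, does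
    not spoil semicontinuity: near a pair with [x_1 = 0] and code [4 + c + c'] the
    pairs with [x_1 != 0] have code at most [3 + c']. *)
Definition code P : nat :=
  if coord_neq0 (hrot P) then codim (hrot P)
  else ((if coord_neq0 (\val P.1) then 2 else 4) + codim (lead P) + codim (det P))%N.

(** In the orthogonal case every label is shortest, and [2 n - k] has the right
    equivariance, because [(a, b)] moves [n] by [a] and [k] by [a + b]. *)
Definition sector_label P (m : int) :=
  if coord_neq0 (hrot P) then sector p (hrot P) (- m)
  else exists n k, [/\ sector p (lead P) n, sector p (det P) k & m = 2 * n - k].

Lemma codim_le1 z : (codim z <= 1)%N. Proof. by rewrite /codim; case: asbool. Qed.

Lemma code_lt7 P : (code P < 7)%N.
Proof.
have := codim_le1 (hrot P); have := codim_le1 (lead P); have := codim_le1 (det P).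
by rewrite /code; case: ifP => _; [lia | case: ifP => _; lia].
Qed.

Lemma codim_act z m : codim (lens_act p m z) = codim z.
Proof.
rewrite /codim; congr nat_of_bool; apply/asbool_equiv_eq; split; last exact: ray_act.
by move=> /(ray_act p_gt0 (- m)); rewrite lens_actK.
Qed.

Lemma hrot_gact a b P : hrot (gact p a b P) = lens_act p (b - a) (hrot P).
Proof.
rewrite /hrot /= /lens_act hvec_rotl hvec_rotr -!mulmxA !rotD; congr (_ *m rot _).
by rewrite rmorphB /=; field.
Qed.

Lemma det_gact a b P : det (gact p a b P) = lens_act p (a + b) (det P).
Proof. by rewrite -lens_actD /det /= /lens_act dvec_rotr dvec_rotl. Qed.

Lemma coord_neq0_act m z : coord_neq0 (lens_act p m z) = coord_neq0 z.
Proof. exact: coord_neq0_rot. Qed.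

Lemma lead_gact a b P : lead (gact p a b P) = lens_act p a (lead P).
Proof.
rewrite /lead /= coord_neq0_act; case: ifP => // _; exact: swap_rot.
Qed.

Lemma code_gact a b P : code (gact p a b P) = code P.
Proof.
by rewrite /code hrot_gact det_gact lead_gact !codim_act !coord_neq0_act.
Qed.

Lemma sector_label_gact a b P m : sector_label P m -> sector_label (gact p a b P) (m + a - b).
Proof.
rewrite /sector_label hrot_gact det_gact lead_gact coord_neq0_act; case: ifP => _.
  have -> : - (m + a - b) = - m + (b - a) by ring.
  exact: sector_act.
move=> [n [k [h1 h2 ->]]]; exists (n + a), (k + (a + b)); split; try exact: sector_act.
ring.
Qed.

Lemma lead_neq0 P : coord_neq0 (lead P).
Proof.
rewrite /lead; case: ifP => // /negbT; rewrite /coord_neq0 negb_or !negbK => /andP[/eqP h1 /eqP h2].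
rewrite !(swapE _ _).1; apply/negPn/negP; rewrite negb_or !negbK => /andP[/eqP h3 /eqP h4].
by have := sphereE P.1; rewrite innerE h1 h2 h3 h4 !mul0r !addr0 => /esym/eqP; rewrite oner_eq0.
Qed.

Lemma det_neq0 P : ~~ coord_neq0 (hrot P) -> coord_neq0 (det P).
Proof.
rewrite coord_neq0_rot => /hvec_eq0 /orthogonal_pair_independent; apply: contraR.
rewrite /coord_neq0 negb_or !negbK => /andP[/eqP h1 /eqP h2].
have [_ _ h3 h4] := dvecE (\val P.1) (\val P.2).
by apply/eqP; apply: C2_eqP; rewrite ?h3 ?h4 -/(det P) ?h1 ?h2 !mxE.
Qed.

Lemma sector_label_exists P : exists m, sector_label P m.
Proof.
rewrite /sector_label; case: (boolP (coord_neq0 (hrot P))) => h.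
  by have [n Hn] := sector_exists p_gt0 h; exists (- n); rewrite opprK.
have [n Hn] := sector_exists p_gt0 (lead_neq0 P).
by have [k Hk] := sector_exists p_gt0 (det_neq0 h); exists (2 * n - k), n, k.
Qed.

Lemma sector_label_unique P m m' : sector_label P m -> sector_label P m' -> (p %| m - m')%Z.
Proof.
rewrite /sector_label; case: ifP => _.
  move=> h1 h2; have := sector_unique p_gt0 h2 h1.
  by have -> : - m' - - m = m - m' by ring.
move=> [n [k [h1 h2 ->]]] [n' [k' [h1' h2' ->]]].
have := sector_unique p_gt0 h1 h1'; have := sector_unique p_gt0 h2' h2 => d1 d2.
have -> : 2 * n - k - (2 * n' - k') = 2 * (n - n') + (k' - k) by ring.
by rewrite rpredD // dvdz_mull.
Qed.

Lemma continuous_hvec (T : topologicalType) (f g : T -> C2 R) t :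
  {for t, continuous f} -> {for t, continuous g} -> {for t, continuous (fun s => hvec (f s) (g s))}.
Proof.
move=> cf cg; apply: continuous_matrix => i j; case: (ord2P i) => ->; case: (ord2P j) => ->.
- rewrite (funext (fun s => (hvecE (f s) (g s)).1)); exact: continuous_inner.
- rewrite (funext (fun s => (hvecE (f s) (g s)).2)); apply: continuousN.
  exact: (continuous_inner cf (continuous_rot cg (@cst_continuous _ _ (pi / 2) t))).
- rewrite (_ : (fun s => _) = fun=> 0); first exact: cst_continuous.
  by apply/funext => s; rewrite mxE.
- rewrite (_ : (fun s => _) = fun=> 0); first exact: cst_continuous.
  by apply/funext => s; rewrite mxE.
Qed.

Lemma continuous_swap (T : topologicalType) (f : T -> C2 R) t :
  {for t, continuous f} -> {for t, continuous (fun s => swap (f s))}.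
Proof.
move=> cf; apply: continuous_matrix => i j; have ce i' : {for t, continuous (fun s => f s i' j)}.
  by apply: (continuous_comp_at cf (g := fun z : C2 R => z i' j)); exact: continuous_entry.
case: (ord2P i) => ->.
- rewrite (funext (fun s => (swapE (f s) j).1)); exact: ce.
- rewrite (funext (fun s => (swapE (f s) j).2)); exact: ce.
Qed.

Lemma continuous_hrot P : {for P, continuous hrot}.
Proof.
have [c1 c2] := continuous_pair_val P.
exact: (continuous_rot (continuous_hvec c1 c2) (@cst_continuous _ _ (pi / p%:R) P)).
Qed.

Lemma continuous_det P : {for P, continuous det}.
Proof. by have [c1 c2] := continuous_pair_val P; exact: (continuous_dvec c1 c2). Qed.

Lemma sector_near_codim (f : S * S -> C2 R) P n : {for P, continuous f} -> sector p (f P) n ->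
  nbhs P [set Q | (codim (f Q) <= codim (f P))%N /\ (codim (f Q) = codim (f P) -> sector p (f Q) n)].
Proof.
move=> cf /(sector_near p_gt0) /cf Hn.
have : nbhs P [set Q | (ray p (f Q) -> ray p (f P)) /\ ((ray p (f P) -> ray p (f Q)) -> sector p (f Q) n)].
  exact: Hn.
apply: filterS => Q /= [h1 h2]; rewrite /codim; split.
  by case: asboolP => // /h1 h; case: asboolP.
move=> e; apply: h2 => h; move: e; case: (asboolP (ray p (f P))) => // _.
by case: asboolP.
Qed.

(** Upper semicontinuity of [code], and local constancy of the label on its
    level sets: passing to a limit can only turn a non-zero coordinate into
    zero, or a sector into a ray. *)
Lemma code_near P m : sector_label P m -> nbhs P [set Q | (code Q <= code P)%N /\
  (code Q = code P -> sector_label Q m)].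
Proof.
have near_neq0 (f : S * S -> C2 R) : {for P, continuous f} -> coord_neq0 (f P) ->
    nbhs P [set Q | coord_neq0 (f Q)].
  by move=> cf /coord_neq0_near /cf.
have [c1 c2] := continuous_pair_val P.
have cs := continuous_swap c1.
rewrite /sector_label; case: (boolP (coord_neq0 (hrot P))) => hP.
  move=> sec; apply: filterS2 (near_neq0 _ (@continuous_hrot P) hP)
    (sector_near_codim (@continuous_hrot P) sec) => Q /= hQ [le eq].
  by rewrite /code hP hQ.
move=> [n [k [sl sd ->]]].
have nd := sector_near_codim (@continuous_det P) sd.
case: (boolP (coord_neq0 (\val P.1))) => xP.
  have lP : lead P = \val P.1 by rewrite /lead xP.
  rewrite lP in sl.
  apply: filterS3 (near_neq0 _ c1 xP) nd (sector_near_codim c1 sl) => Q /= xQ [le1 eq1] [le2 eq2].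
  have {}le2 : (codim (\val Q.1) <= codim (\val P.1))%N := le2.
  have {}eq2 : codim (\val Q.1) = codim (\val P.1) -> sector p (\val Q.1) n := eq2.
  have lQ : lead Q = \val Q.1 by rewrite /lead xQ.
  rewrite /code (negbTE hP) xP lP; case: ifP => hQ.
    by have := codim_le1 (hrot Q) => h; split; [lia | move=> e; exfalso; lia].
  rewrite xQ lQ; split; first lia.
  by move=> e; exists n, k; split=> //; [apply: eq2; lia | apply: eq1; lia].
have lP : lead P = swap (\val P.1) by rewrite /lead (negbTE xP).
rewrite lP in sl.
apply: filterS2 nd (sector_near_codim cs sl) => Q /= [le1 eq1] [le2 eq2].
have {}le2 : (codim (swap (\val Q.1)) <= codim (swap (\val P.1)))%N := le2.
have {}eq2 : codim (swap (\val Q.1)) = codim (swap (\val P.1)) -> sector p (swap (\val Q.1)) n := eq2.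
rewrite /code (negbTE hP) (negbTE xP) lP; case: ifP => hQ.
  by have := codim_le1 (hrot Q) => h; split; [lia | move=> e; exfalso; lia].
case: ifP => xQ.
  by have := codim_le1 (lead Q) => h; split; [lia | move=> e; exfalso; lia].
have lQ : lead Q = swap (\val Q.1) by rewrite /lead xQ.
rewrite lQ; split; first lia.
by move=> e; exists n, k; split=> //; [apply: eq2; lia | apply: eq1; lia].
Qed.

(** The other translates of [th] by multiples of [2 pi / p] are at least as far from
    [2 pi Z]. *)
Lemma cos_nearest (th : R) (k : int) : `|th| <= pi / p%:R ->
  cos (th + 2 * pi * k%:~R / p%:R) <= cos th.
Proof.
move=> thp; have pi0 := pi_gt0 R; pose u := pi / p%:R : R.
have u0 : 0 < u by rewrite divr_gt0 ?ltr0n.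
have pu : p%:R * u = pi by rewrite /u; field.
pose j := (k %% p%:Z)%Z; have pz : p%:Z != 0 by lia.
have j0 : 0 <= j by exact: modz_ge0.
have jp : j < p%:Z by apply: ltz_pmod; lia.
have -> : cos (th + 2 * pi * k%:~R / p%:R) = cos (th + 2 * u * j%:~R).
  have -> : th + 2 * pi * k%:~R / p%:R = (th + 2 * u * j%:~R) + 2 * pi * (k %/ p%:Z)%Z%:~R.
    rewrite {1}(divz_eq k p%:Z) -/j rmorphD rmorphM /= -pmulrn /u; field.
    exact: pn0.
  by have [c s] := @cos_2pi_int R (k %/ p%:Z)%Z; rewrite cosD c s mulr1 mulr0 subr0.
have [jz|jn] := eqVneq j 0; first by rewrite jz mulr0 addr0.
have j1 : 1 <= j%:~R :> R by rewrite -[1]/(1%:~R) ler_int; lia.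
have jp' : j%:~R + 1 <= p%:R :> R.
  by rewrite -[1]/(1%:~R) -intrD -[p%:R]/(p%:Z%:~R) ler_int; lia.
have p3 : 3 <= p%:R :> R by rewrite ler_nat.
have t0 := normr_ge0 th; move: thp; rewrite -/u => thp.
have /andP[a1 a2] : - u <= th <= u by rewrite -ler_norml.
have up : 3 * u <= pi by nra.
rewrite -[leRHS]cos_norm; apply: cos_le_outside; first by apply/andP; split; lra.
apply/andP; split; nra.
Qed.

(** Undoing the half step of [hrot], the sector of label [m] consists of the vectors
    that [z^m] turns to within [pi / p] of the positive real axis. *)
Lemma sector_label_short P m : sector_label P m -> short p m P.
Proof.
have innerH m' : inner (\val P.1) (lens_act p m' (\val P.2))
    = (hvec (\val P.1) (\val P.2) *m rot (2 * pi * m'%:~R / p%:R)) ord0 ord0.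
  by rewrite -hvec_rotr (hvecE _ _).1.
rewrite /sector_label; case: (boolP (coord_neq0 (hrot P))) => hP; last first.
  move=> _ m'; have o := hvec_eq0 (_ : ~~ coord_neq0 (hvec (\val P.1) (\val P.2))).
  by rewrite /lens_act !o // -(coord_neq0_rot _ (pi / p%:R)).
move=> [t pt /andP[t1 t2]] m'.
have pH := polar_rot (- (pi / p%:R)) pt.
rewrite /hrot -mulmxA rotD subrr rot0 mulmx1 in pH.
have [q q0 [e0 e0']] := pH.
have val k : inner (\val P.1) (lens_act p k (\val P.2)) = q * cos (t - pi / p%:R + 2 * pi * k%:~R / p%:R).
  by rewrite innerH (rotE _ _ _).1 e0 e0' (cosD (t - pi / p%:R)); ring.
rewrite !val ler_pM2l //.
have -> : t - pi / p%:R + 2 * pi * m'%:~R / p%:R = (t - pi / p%:R + 2 * pi * m%:~R / p%:R)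
   + 2 * pi * (m' - m)%:~R / p%:R by rewrite rmorphB /=; field.
apply: cos_nearest; rewrite ler_norml.
move: t1 t2; rewrite intrD rmorphN /=.
have -> : 2 * pi / p%:R * - m%:~R = - (2 * pi * m%:~R / p%:R) :> R by field.
have -> : 2 * pi / p%:R * (- m%:~R + 1%:~R) = - (2 * pi * m%:~R / p%:R) + 2 * (pi / p%:R) :> R by field.
by move=> h1 h2; apply/andP; split; lra.
Qed.
End Code.

(** * Continuity of the shortest arcs *)

Section Arc.
Variable R : realType.
Implicit Types x v : C2 R.

(** Half of the angle has tangent [|v - x| / |v + x|]; unlike the arc cosine of the
    inner product this uses only differences and sums of the two vectors. *)
Definition angle x v : R := 2 * atan (enorm (v - x) / enorm (v + x)).

(** If [v = x] any perpendicular unit vector would do; this one is equivariant. *)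
Definition direction x v : C2 R :=
  if v == x then x *m rot (pi / 2) else (sin (angle x v))^-1 *: (v - cos (angle x v) *: x).

Section Facts.
Variables x v : C2 R.
Hypotheses (xx : inner x x = 1) (vv : inner v v = 1) (xv : -1 < inner x v).

Let sum_gt0 : 0 < enorm (v + x).
Proof.
rewrite lt_neqAle enorm_ge0 andbT eq_sym -sqrf_eq0 sqr_enorm.
rewrite !(innerDl, innerDr) xx vv (innerC v x) gt_eqF //; have := xv; lra.
Qed.

Lemma cos_angle : cos (angle x v) = inner x v.
Proof.
have e1 : enorm (v - x) ^+ 2 = 2 - 2 * inner x v.
  by rewrite sqr_enorm !(innerBl, innerBr) xx vv (innerC v x); ring.
have e2 : enorm (v + x) ^+ 2 = 2 + 2 * inner x v.
  by rewrite sqr_enorm !(innerDl, innerDr) xx vv (innerC v x); ring.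
rewrite /angle mulr_natl cos_mulr2n cos_atan.
set T := _ / _; have T2 : T ^+ 2 = (2 - 2 * inner x v) / (2 + 2 * inner x v).
  by rewrite /T expr_div_n e1 e2.
rewrite exprVn sqr_sqrtr ?addr_ge0 ?sqr_ge0 // T2 -mulr_natl; field.
by apply/andP; split; rewrite gt_eqF //; have := xv; lra.
Qed.

Lemma angle_ge0 : 0 <= angle x v.
Proof.
by rewrite mulr_ge0 // -(atan0 R) le_atan // divr_ge0 ?enorm_ge0.
Qed.

Lemma angle_ltpi : angle x v < pi.
Proof. by have := atan_ltpi2 (enorm (v - x) / enorm (v + x)); rewrite /angle; lra. Qed.

Lemma sin_angle_gt0 : v != x -> 0 < sin (angle x v).
Proof.
move=> vx; apply: sin_gt0_pi; rewrite angle_ltpi andbT mulr_gt0 // -(atan0 R) lt_atan //.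
by rewrite divr_gt0 // lt_neqAle enorm_ge0 andbT eq_sym enorm_eq0 subr_eq0.
Qed.

Lemma direction_perp : inner x (direction x v) = 0.
Proof.
rewrite /direction; case: eqP => _; first exact: inner_perp.
by rewrite innerZr innerBr innerZr xx cos_angle; ring.
Qed.

Lemma direction_unit : inner (direction x v) (direction x v) = 1.
Proof.
rewrite /direction; case: eqVneq => [_|vx]; first by rewrite inner_rot.
have s0 := sin_angle_gt0 vx.
have E : inner (v - cos (angle x v) *: x) (v - cos (angle x v) *: x) = sin (angle x v) ^+ 2.
  by rewrite sin2cos2 !(innerBl, innerBr, innerZl, innerZr) xx vv (innerC v x) cos_angle; ring.
by rewrite innerZl innerZr E; field; rewrite gt_eqF.
Qed.

Lemma arc_end : great_arc x (direction x v) (angle x v) 1 = v.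
Proof.
rewrite great_arc1 /direction; case: eqVneq => [vx|vx].
  have -> : angle x v = 0 by rewrite /angle vx subrr enorm0 mul0r atan0 mulr0.
  by rewrite cos0 sin0 scale1r scale0r addr0.
have s0 := sin_angle_gt0 vx.
by rewrite scalerA divff ?gt_eqF // scale1r addrC subrK.
Qed.
End Facts.

Lemma angle_rot x v t : angle (x *m rot t) (v *m rot t) = angle x v.
Proof. by rewrite /angle -mulmxBl -mulmxDl !enorm_rot. Qed.

Lemma rot_inj t : injective (fun z : C2 R => z *m rot t).
Proof.
move=> z z' E; have := congr1 (fun w => w *m rot (- t)) E.
by rewrite -!mulmxA rotD addrN rot0 !mulmx1.
Qed.

Lemma direction_rot x v t : direction (x *m rot t) (v *m rot t) = direction x v *m rot t.
Proof.
rewrite /direction angle_rot (inj_eq (@rot_inj t)); case: ifP => _.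
  by rewrite -!mulmxA !rotD addrC.
by rewrite -scalemxAl mulmxBl -scalemxAl.
Qed.

Lemma great_arc_rot (a b : C2 R) w s t : great_arc (a *m rot t) (b *m rot t) w s = great_arc a b w s *m rot t.
Proof. by rewrite /great_arc mulmxDl -!scalemxAl. Qed.

Section Continuity.
Variables (T : topologicalType) (t : T).

Lemma continuous_great_arc (a b : T -> C2 R) (w s : T -> R) :
  {for t, continuous a} -> {for t, continuous b} -> {for t, continuous w} -> {for t, continuous s} ->
  {for t, continuous (fun z => great_arc (a z) (b z) (w z) (s z))}.
Proof.
move=> ca cb cw cs; have cws : {for t, continuous (fun z => w z * s z)} := continuousM cw cs.
have c1 : {for t, continuous (fun z => cos (w z * s z))}.
  by apply: (continuous_comp_at cws); exact: continuous_cos.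
have c2 : {for t, continuous (fun z => sin (w z * s z))}.
  by apply: (continuous_comp_at cws); exact: continuous_sin.
exact: (continuousD (continuousZ c1 ca) (continuousZ c2 cb)).
Qed.

Lemma continuous_angle (f g : T -> C2 R) : {for t, continuous f} -> {for t, continuous g} ->
  g t + f t != 0 -> {for t, continuous (fun z => angle (f z) (g z))}.
Proof.
move=> cf cg n0.
have cq : {for t, continuous (fun z => enorm (g z - f z) / enorm (g z + f z))}.
  apply: continuousM; first exact: (continuous_enorm (continuousB cg cf)).
  apply: continuousV; first by rewrite enorm_eq0.
  exact: (continuous_enorm (continuousD cg cf)).
apply: continuousM; first exact: cst_continuous.
by apply: (continuous_comp_at cq); exact: continuous_atan.
Qed.

(** The continuous branch of [direction]. *)
Definition direction_formula x v := (sin (angle x v))^-1 *: (v - cos (angle x v) *: x).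

Lemma continuous_direction (f g : T -> C2 R) : {for t, continuous f} -> {for t, continuous g} ->
  g t + f t != 0 -> sin (angle (f t) (g t)) != 0 ->
  {for t, continuous (fun z => direction_formula (f z) (g z))}.
Proof.
move=> cf cg n0 s0; have ca := continuous_angle cf cg n0.
have c1 : {for t, continuous (fun z => cos (angle (f z) (g z)))}.
  by apply: (continuous_comp_at ca); exact: continuous_cos.
have c2 : {for t, continuous (fun z => sin (angle (f z) (g z)))}.
  by apply: (continuous_comp_at ca); exact: continuous_sin.
apply: continuousZ; last exact: (continuousB cg (continuousZ c1 cf)).
exact: continuousV.
Qed.
End Continuity.
End Arc.

Section Upper.
Variables (R : realType) (p : nat).
Hypothesis p_gt2 : (2 < p)%N.
Let p_gt1 : (1 < p)%N := ltnW p_gt2.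
Let p_gt0 : (0 < p)%N := ltnW p_gt1.
Let S := @sphere3 R.
Let L := lens_space R p.
Implicit Types P Q : S * S.

Definition target (m : int) P : C2 R := lens_act p m (\val P.2).

Lemma target_unit m P : inner (target m P) (target m P) = 1.
Proof. by rewrite lens_act_inner sphereE. Qed.

Definition arc (m : int) P (t : R) : C2 R :=
  great_arc (\val P.1) (direction (\val P.1) (target m P)) (angle (\val P.1) (target m P)) t.

(** If [z^m y = - x] then [m + 1] would be better, since [z] is not 1. *)
Lemma short_not_antipodal m P : short p m P -> -1 < inner (\val P.1) (target m P).
Proof.
move=> sm; rewrite ltNge; apply/negP => z1.
have v0 : target m P + \val P.1 = 0.
  apply/eqP; rewrite -inner_eq0 !(innerDl, innerDr) target_unit sphereE (innerC (target m P)).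
  have := unit_inner_bound (sphereE P.1) (target_unit m P) => z2; apply/eqP; nra.
have vE : target m P = - \val P.1 by apply/eqP; rewrite -addr_eq0 v0.
have := sm (m + 1); rewrite -lens_actD -/(target m P) vE -scaleN1r lens_actZ !innerZr sphereE.
rewrite inner_self_rot => h.
have c1 : cos (2 * pi * 1%:~R / p%:R) = 1 :> R.
  by apply/eqP; rewrite eq_le cos_le1; lra.
have := @lens_act_fix R p p_gt0 1 (\val P.1) (sphere_neq0 _).
have -> : lens_act p 1 (\val P.1) = \val P.1.
  rewrite /lens_act; have -> : rot (2 * pi * 1%:~R / p%:R) = 1%:M :> 'M[R]_2; last by rewrite mulmx1.
  by have [n ->] := cos_eq1_int c1; exact: rot_2pi_int.
by move=> /(_ erefl); rewrite dvdzE /= dvdn1 => /eqP; lia.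
Qed.

Lemma arc_dvd m m' P t : (p %| m - m')%Z -> arc m P t = arc m' P t.
Proof. by move=> d; rewrite /arc /target (lens_act_eqmod p_gt0 _ d). Qed.

(** Equivariance makes the projection of the arc depend on the classes of the
    points only. *)
Lemma arc_gact m a b P t : arc (m + a - b) (gact p a b P) t = lens_act p a (arc m P t).
Proof.
have E : target (m + a - b) (gact p a b P) = lens_act p a (target m P).
  by rewrite /target /= !lens_actD; congr lens_act; ring.
by rewrite /arc E /= /lens_act angle_rot direction_rot great_arc_rot.
Qed.

Lemma arc_unit m P t : short p m P -> inner (arc m P t) (arc m P t) = 1.
Proof.
move=> sm; have na := short_not_antipodal sm; have xx := sphereE P.1; have vv := target_unit m P.
exact: (great_arc_inner _ t xx (direction_unit xx vv na) (direction_perp xx vv na)).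
Qed.

Lemma continuous_target m P : {for P, continuous (target m)}.
Proof.
have [c1 c2] := continuous_pair_val P.
exact: (continuous_rot c2 (@cst_continuous _ _ (2 * pi * m%:~R / p%:R : R) P)).
Qed.

Lemma target_sum_neq0 m P : -1 < inner (\val P.1) (target m P) -> target m P + \val P.1 != 0.
Proof.
move=> na; rewrite -inner_eq0 !(innerDl, innerDr) target_unit sphereE (innerC (target m P)).
by rewrite gt_eqF //; have := na; lra.
Qed.

Lemma not_antipodal_near m P : -1 < inner (\val P.1) (target m P) ->
  exists2 d, 0 < d & forall Q, pdist P Q < d -> -1 < inner (\val Q.1) (target m Q).
Proof.
move=> na; have [c1 _] := continuous_pair_val P.
have ci := continuous_inner c1 (@continuous_target m P).
have /ci Hn : nbhs (inner (\val P.1) (target m P)) [set r | -1 < r].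
  by apply: open_nbhs_nbhs; split; [exact: open_gt | exact: na].
have /nbhs_pairP [d d0 H] : nbhs P [set Q : S * S | -1 < inner (\val Q.1) (target m Q)] by exact: Hn.
by exists d.
Qed.

Lemma enorm_direction m P : -1 < inner (\val P.1) (target m P) ->
  enorm (direction (\val P.1) (target m P)) = 1.
Proof. by move=> na; rewrite /enorm direction_unit ?sphereE ?target_unit ?sqrtr1. Qed.

(** Where the target is [x] itself the direction has no limit; continuity comes
    from the angle tending to 0. *)
Lemma arc_near_constant m P t e : target m P = \val P.1 -> 0 < e ->
  exists2 d, 0 < d & forall Q s, pdist P Q < d -> 0 <= s <= 1 ->
    enorm (arc m Q s - arc m P t) < e.
Proof.
move=> vx e0; have [c1 c2] := continuous_pair_val P; have cv := @continuous_target m P.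
have xx := sphereE P.1.
have na : -1 < inner (\val P.1) (target m P) by rewrite vx xx; lra.
have ca := continuous_angle c1 cv (target_sum_neq0 na).
have a0 : angle (\val P.1) (target m P) = 0.
  by rewrite /angle vx subrr enorm0 mul0r atan0 mulr0.
have /ca Hn : nbhs (angle (\val P.1) (target m P)) [set r | `|r| < e / 4].
  rewrite a0; apply/nbhs_ballP; exists (e / 4) => /=; first by rewrite divr_gt0.
  by move=> r; rewrite -ball_normE /ball_ /= sub0r normrN.
have /nbhs_pairP [d d0 H] : nbhs P [set Q : S * S | `|angle (\val Q.1) (target m Q)| < e / 4] by exact: Hn.
have [d1 d10 H1] := not_antipodal_near na.
exists (Num.min d (Num.min d1 (e / 4))) => [|Q s]; first by rewrite !lt_min d0 d10 divr_gt0.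
rewrite !lt_min => /and3P[/H aQ /H1 naQ PQ] /andP[s0 s1].
have {}aQ : `|angle (\val Q.1) (target m Q)| < e / 4 := aQ.
have arcP : arc m P t = \val P.1.
  by rewrite /arc a0 /great_arc mul0r cos0 sin0 scale1r scale0r addr0.
have nb := enorm_direction naQ; have nx : enorm (\val Q.1) = 1 by rewrite /enorm sphereE sqrtr1.
rewrite arcP /arc; move: (angle _ _) (direction _ _) aQ nb => w b aQ nb.
rewrite /great_arc.
have -> : cos (w * s) *: \val Q.1 + sin (w * s) *: b - \val P.1
  = (\val Q.1 - \val P.1) + ((cos (w * s) - cos 0) *: \val Q.1 + (sin (w * s) - sin 0) *: b).
  by rewrite cos0 sin0 subr0 scalerBl scale1r; apply/matrixP => i j; rewrite !mxE; ring.
have ws : `|w * s - 0| <= `|w|.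
  by rewrite subr0 normrM (ger0_norm s0) ler_piMr.
have h1 : enorm (\val Q.1 - \val P.1) <= pdist P Q.
  by rewrite -enormN opprB /pdist lerDl enorm_ge0.
have h2 : enorm ((cos (w * s) - cos 0) *: \val Q.1) <= `|w|.
  by rewrite enormZ nx mulr1; exact: le_trans (cos_lipschitz _ _) ws.
have h3 : enorm ((sin (w * s) - sin 0) *: b) <= `|w|.
  by rewrite enormZ nb mulr1; exact: le_trans (sin_lipschitz _ _) ws.
have h4 := enormD (\val Q.1 - \val P.1) ((cos (w * s) - cos 0) *: \val Q.1 + (sin (w * s) - sin 0) *: b).
have h5 := enormD ((cos (w * s) - cos 0) *: \val Q.1) ((sin (w * s) - sin 0) *: b).
lra.
Qed.

Lemma nbhs_pair_realP (P : S * S) (t : R) (U : set ((S * S) * R)) : nbhs (P, t) U ->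
  exists2 d, 0 < d & forall Q s, pdist P Q < d -> `|t - s| < d -> U (Q, s).
Proof.
case=> -[V W] /= [/nbhs_pairP [d1 d10 H1] /nbhs_ballP [d2 /= d20 H2]] VWU.
exists (Num.min d1 d2) => [|Q s]; first by rewrite lt_min d10.
rewrite !lt_min => /andP[PQ _] /andP[_ ts]; apply: VWU; split => /=; first exact: H1.
by apply: H2; rewrite -ball_normE.
Qed.

Lemma arc_near_generic m P t e : -1 < inner (\val P.1) (target m P) ->
  target m P != \val P.1 -> 0 < e ->
  exists2 d, 0 < d & forall Q s, pdist P Q < d -> `|t - s| < d ->
    enorm (arc m Q s - arc m P t) < e.
Proof.
move=> na vx e0; have [c1 c2] := continuous_pair_val P; have cv := @continuous_target m P.
have xx := sphereE P.1; have vv := target_unit m P.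
pose T := ((S * S) * R)%type; pose z0 : T := (P, t).
have cfst : {for z0, continuous (fun z : T => z.1)} by exact: cvg_fst.
have k1 : {for z0, continuous (fun z : T => \val z.1.1 : C2 R)} := continuous_comp_at cfst c1.
have kv : {for z0, continuous (fun z : T => target m z.1)} := continuous_comp_at cfst cv.
have ks : {for z0, continuous (fun z : T => z.2)} by exact: cvg_snd.
have n0 := target_sum_neq0 na.
have s0 : sin (angle (\val z0.1.1) (target m z0.1)) != 0.
  by rewrite gt_eqF // sin_angle_gt0.
have ka := continuous_angle k1 kv n0.
have kd := continuous_direction k1 kv n0 s0.
have kg := continuous_great_arc k1 kd ka ks.
pose G (z : T) : C2 R := great_arc (\val z.1.1) (direction_formula (\val z.1.1) (target m z.1)) (angle (\val z.1.1) (target m z.1)) z.2.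
have cG : {for z0, continuous G} := kg.
have ce := continuous_enorm (continuousB cG (@cst_continuous _ _ (G z0) z0)).
have /ce Hn : nbhs (enorm (G z0 - G z0)) [set r | r < e].
  by apply: open_nbhs_nbhs; split; [exact: open_lt | rewrite /= subrr enorm0].
have [d d0 H] := @nbhs_pair_realP P t [set z | enorm (G z - G z0) < e] Hn.
have v0 : 0 < enorm (target m P - \val P.1).
  by rewrite lt_neqAle enorm_ge0 andbT eq_sym enorm_eq0 subr_eq0.
have [d1 d10 H1] := pdist_continuous (continuousB cv c1) v0.
exists (Num.min d d1) => [|Q s]; first by rewrite lt_min d0.
rewrite !lt_min => /andP[PQ /H1 vQ] /andP[ts _].
have vQ' : target m Q != \val Q.1.
  have : enorm ((target m Q - \val Q.1) - (target m P - \val P.1)) < enorm (target m P - \val P.1) := vQ.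
  by apply: contraTneq => ->; rewrite subrr sub0r enormN ltxx.
by have := H Q s PQ ts; rewrite /G /= /arc /direction (negbTE vx) (negbTE vQ').
Qed.

Lemma arc_near m P t e : -1 < inner (\val P.1) (target m P) -> 0 < e ->
  exists2 d, 0 < d & forall Q s, pdist P Q < d -> `|t - s| < d -> 0 <= s <= 1 ->
    enorm (arc m Q s - arc m P t) < e.
Proof.
move=> na e0; have [vx|vx] := eqVneq (target m P) (\val P.1).
  by have [d d0 H] := arc_near_constant t vx e0; exists d => // Q s PQ _; exact: H.
by have [d d0 H] := arc_near_generic t na vx e0; exists d => // Q s PQ ts _; exact: H.
Qed.
End Upper.

(** * The seven strata and their sections *)

Lemma compact_set_type (X : topologicalType) (A K : set X) :
  compact K -> K `<=` A -> compact (\val @^-1` K : set A).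
Proof.
move=> cK KA F FF FK.
have [x [Kx clx]] := cK (\val @ F) _ FK.
exists (SigSub (mem_set (KA _ Kx))); split=> //= U V FU /nbhs_set_typeP [W [oW Wx WV]].
have [||_ [[y Uy <-] Wy]] := clx [set \val y | y in U] W.
- by apply: (@filterS _ F FF U _ _ FU) => y Uy; exists y.
- exact: open_nbhs_nbhs.
by exists y; split=> //; exact: WV.
Qed.

Section SphereCompact.
Variable R : realType.

(** The sphere is the image of a closed subset of a cube in R^4. *)
Lemma compact_sphere3 : compact (@sphere3 R).
Proof.
pose B := [set v : 'rV[R]_(2 * 2) | forall i, [set` `[-1, 1]] (v ord0 i)].
have cB : compact B.
  have := @rV_compact R (2 * 2) (fun=> [set` `[-1, 1]]) (fun i => @segment_compact R (-1) 1).
  by [].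
pose f (v : 'rV[R]_(2 * 2)) : C2 R := vec_mx v.
have cf : continuous f.
  move=> v; apply: continuous_matrix => i j.
  rewrite (_ : (fun s => _) = fun s : 'rV[R]_(2 * 2) => s ord0 (mxvec_index i j)); last first.
    by apply/funext => s; rewrite /f mxE.
  exact: coord_continuous.
pose D := [set v | inner (f v) (f v) = 1].
have cD : closed D.
  apply: (@preimage_closed _ _ (fun v => inner (f v) (f v)) [set 1]); last exact: closed_eq.
  by move=> v _; exact: (continuous_inner (cf v) (cf v)).
have DB : D `<=` B.
  move=> v Dv i /=; rewrite in_itv /= -ler_norml.
  case/mxvec_indexP: i => a b; have := enorm_entry (f v) a b.
  by rewrite /enorm Dv sqrtr1 /f mxE.
have := continuous_compact (continuous_subspaceT cf) (subclosed_compact cD cB DB).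
congr compact; apply/seteqP; split=> [_ [v Dv <-]//|z zz]; exists (mxvec z); last exact: mxvecK.
by rewrite /D /= /f mxvecK.
Qed.

Lemma compact_pairs : compact [set: @sphere3 R * @sphere3 R].
Proof.
have cS : compact [set: @sphere3 R].
  have := compact_set_type compact_sphere3 (@subset_refl _ _).
  congr compact; apply/seteqP; split=> // x _; exact: sphereE.
by rewrite -setXTT; exact: compact_setX.
Qed.
End SphereCompact.

Section Strata.
Variables (R : realType) (p : nat).
Hypothesis p_gt2 : (2 < p)%N.
Let p_gt1 : (1 < p)%N := ltnW p_gt2.
Let p_gt0 : (0 < p)%N := ltnW p_gt1.
Let S := @sphere3 R.
Let L := lens_space R p.
Implicit Types P Q : S * S.

Definition stratum (i : 'I_7) : set (L * L) :=
  [set l | exists2 P, lens_proj2 p P = l & code p P = i].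

Lemma stratumP (i : 'I_7) P : stratum i (lens_proj2 p P) <-> code p P = i.
Proof.
split=> [[Q /lens_proj2P [a [b ->]] <-]|e]; last by exists P.
exact: code_gact.
Qed.

Lemma stratum_cover : \bigcup_i stratum i = setT.
Proof.
apply/seteqP; split=> // l _; have [P <-] := lens_proj2_surj l.
by exists (Ordinal (code_lt7 p_gt2 P)) => //; apply/stratumP.
Qed.

Lemma stratum_disjoint : trivIset setT stratum.
Proof.
move=> i j _ _ [l [[P <- Pi] /stratumP Pj]]; apply/val_inj.
by rewrite /= -Pi -Pj.
Qed.

(** By semicontinuity [P] has a compact neighbourhood on which the code is at most
    that of [P]; the stratum is there the set where the code is at least that
    value, which is closed, again by semicontinuity. *)
Lemma stratum_locally_compact (i : 'I_7) : locally_compact [set: stratum i].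
Proof.
move=> l _; rewrite withinET; have [P Pl Pi] := set_mem (valP l).
have [m Pm] := sector_label_exists p_gt2 P.
have /nbhs_pairP [d d0 Hd] := code_near p_gt2 Pm.
pose K := [set Q | pdist P Q <= d / 2 /\ (i <= code p Q)%N].
have cK : compact K.
  apply: subclosed_compact (@compact_pairs R) _ => // Q clQ; split.
    rewrite leNgt; apply/negP => PQ.
    have nQ : nbhs Q [set Q' | pdist Q Q' < pdist P Q - d / 2].
      by apply/nbhs_pairP; exists (pdist P Q - d / 2); rewrite ?subr_gt0.
    have [Q' [[PQ' _] QQ']] := clQ _ nQ; have {}QQ' : pdist Q Q' < pdist P Q - d / 2 := QQ'.
    by have := pdist_triangle Q' P Q; rewrite (pdistC Q'); lra.
  have [n Qn] := sector_label_exists p_gt2 Q.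
  have [Q' [[_ iQ'] [Q'Q _]]] := clQ _ (code_near p_gt2 Qn).
  exact: leq_trans iQ' Q'Q.
have KA : lens_proj2 p @` K `<=` stratum i.
  move=> _ [Q [PQ iQ] <-]; apply/stratumP; apply/eqP; rewrite eqn_leq iQ andbT -Pi.
  have := Hd Q; case=> //; apply: le_lt_trans PQ _; lra.
have cK' : compact (lens_proj2 p @` K).
  apply: continuous_compact => //; apply: continuous_subspaceT; exact: continuous_lens_proj2.
exists (\val @^-1` (lens_proj2 p @` K)); last first.
  split; first exact: compact_set_type.
  have hL := @lens_space_hausdorff R p p_gt0.
  have clK := compact_closed (hausdorff_prod hL hL) cK'.
  apply: preimage_closed => // x _; exact: initial_continuous.
have nP : nbhs P [set Q | pdist P Q < d / 2].
  by apply/nbhs_pairP; exists (d / 2); rewrite ?divr_gt0.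
apply/nbhs_set_typeP; have := @lens_proj2_nbhs R p P _ nP; rewrite Pl nbhsE => -[V [oV Vl] VK].
exists V; split=> // b /VK [Q PQ Qb]; exists Q => //; split; first exact: ltW.
have [Q' Q'b Q'i] := set_mem (valP b).
have /lens_proj2P [a [c ->]] : lens_proj2 p Q' = lens_proj2 p Q by rewrite Q'b Qb.
by rewrite (code_gact p_gt2) Q'i.
Qed.
End Strata.

Section Sections.
Variables (R : realType) (p : nat) (kappa : R).
Hypotheses (p_gt2 : (2 < p)%N) (kappa_gt0 : 0 < kappa).
Let p_gt1 : (1 < p)%N := ltnW p_gt2.
Let p_gt0 : (0 < p)%N := ltnW p_gt1.
Let S := @sphere3 R.
Let L := lens_space R p.
Implicit Types P Q : S * S.

Definition short_arc m P (sm : short p m P) (t : R) : S := to_sphere (arc_unit p_gt2 t sm).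

Lemma val_short_arc m P (sm : short p m P) t : \val (short_arc sm t) = arc p m P t.
Proof. by []. Qed.

Lemma short_arc_minimizing m P (sm : short p m P) :
  @minimizing_geodesics R p kappa (fun t => lens_proj p (short_arc sm (\val t))).
Proof.
have xx := sphereE P.1; have vv := target_unit p m P.
have na := short_not_antipodal p_gt2 sm.
apply: (@great_arc_minimizing R p kappa kappa_gt0 (short_arc sm) (\val P.1)
  (direction (\val P.1) (target p m P)) (angle (\val P.1) (target p m P)) xx
  (direction_unit xx vv na) (direction_perp xx vv na)).
- by rewrite angle_ge0 ltW // angle_ltpi.
- by [].
move=> k; rewrite cos_angle //.
have -> : emb (short_arc sm) 1 = target p m P by exact: arc_end.
by rewrite lens_actD; exact: sm.
Qed.

Lemma short_arc0 m P (sm : short p m P) : lens_proj p (short_arc sm 0) = lens_proj p P.1.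
Proof. by congr lens_proj; apply/val_inj; exact: great_arc0. Qed.

Lemma short_arc1 m P (sm : short p m P) : lens_proj p (short_arc sm 1) = lens_proj p P.2.
Proof.
apply/esym/lens_projP; exists m; apply/esym; apply: arc_end (sphereE _) (target_unit p m P) _.
exact: short_not_antipodal.
Qed.

(** Representatives and labels are chosen arbitrarily; different choices give the
    same curve in the lens space.  Near [P] one may therefore choose pairs near [P]
    with the label of [P] itself, and use the continuity of the arcs with a fixed
    label. *)
Lemma stratum_section (i : 'I_7) : has_local_section (@minimizing_geodesics R p kappa) (stratum (p := p) i).
Proof.
have /choice [rep repE] := @lens_proj2_surj R p.
have /choice [lbl lblP] := @sector_label_exists R p p_gt2.
pose A := stratum (p := p) i : set (L * L).
pose crv P := short_arc (sector_label_short p_gt2 (lblP P)).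
pose F (z : A * @unit_interval R) : L := lens_proj p (crv (rep (\val z.1)) (\val z.2)).
have repi (l : A) : code p (rep (\val l)) = i.
  by apply/(stratumP p_gt2); rewrite repE; exact: (set_mem (valP l)).
have crvE (l : L * L) Q m (sm : short p m Q) t : lens_proj2 p Q = l -> sector_label p Q m ->
    lens_proj p (crv (rep l) t) = lens_proj p (short_arc sm t).
  move=> Ql Qm; have /lens_proj2P [a [b EQ]] : lens_proj2 p (rep l) = lens_proj2 p Q by rewrite repE.
  apply/lens_projP; exists a.
  rewrite /crv !val_short_arc; have := arc_gact p (lbl (rep l)) a b (rep l) t; rewrite -EQ => <-.
  apply: arc_dvd => //.
  by apply: (sector_label_unique p_gt2 _ Qm); rewrite EQ; exact: (sector_label_gact p_gt2).
have cF : continuous F.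
  move=> [l t] U nU; set P := rep (\val l); have Pm := lblP P.
  have na := short_not_antipodal p_gt2 (sector_label_short p_gt2 Pm).
  have /nbhs_sphereP [e e0 He] := continuous_lens_proj nU.
  have [d d0 Hd] := arc_near (\val t) na e0.
  have /nbhs_pairP [c c0 Hc] := code_near p_gt2 Pm.
  have nP : nbhs P [set Q | pdist P Q < Num.min c d].
    by apply/nbhs_pairP; exists (Num.min c d); rewrite ?lt_min ?c0.
  have := @lens_proj2_nbhs R p P _ nP; rewrite repE => nl.
  have nl' : nbhs l [set b : A | exists2 Q, pdist P Q < Num.min c d & lens_proj2 p Q = \val b].
    apply/nbhs_set_typeP; move: nl; rewrite nbhsE => -[V [oV Vl] VK].
    by exists V; split=> // b /VK.
  have nt : nbhs t [set s : @unit_interval R | `|\val t - \val s| < d].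
    have : nbhs (\val t) [set s : R | `|\val t - s| < d].
      by apply/nbhs_ballP; exists d.
    by move/(@initial_continuous _ _ _ t).
  exists ([set b : A | exists2 Q, pdist P Q < Num.min c d & lens_proj2 p Q = \val b],
     [set s : @unit_interval R | `|\val t - \val s| < d]); first by split.
  move=> [b s] /= [[Q PQ Qb] ts].
  move: PQ; rewrite lt_min => /andP[/Hc [_ Qm] PQ].
  have Qi : code p Q = i.
    by apply/(stratumP p_gt2); rewrite Qb; exact: (set_mem (valP b)).
  have {}Qm : sector_label p Q (lbl P) by apply: Qm; rewrite Qi /P repi.
  have sm := sector_label_short p_gt2 Qm.
  rewrite /F /= (crvE _ Q _ sm _ Qb Qm); apply: He.
  apply: Hd PQ ts _; have := set_mem (valP s); rewrite /unit_interval /= in_itv /=.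
  by [].
pose G (l : A) : {compact-open, @unit_interval R -> L} := fun t => F (l, t).
have cG : continuous G := continuous_curry_fun cF.
have Gmin l : @minimizing_geodesics R p kappa (G l).
  exact: (short_arc_minimizing (sector_label_short p_gt2 (lblP (rep (\val l))))).
exists (fun l => SigSub (mem_set (Gmin l))).
  by apply: continuous_comp_initial; exact: cG.
move=> l; rewrite /endpoints /path_start /path_end /G /F /crv /=.
rewrite short_arc0 short_arc1 -[LHS]/(lens_proj2 p (rep (\val l))).
exact: repE.
Qed.
End Sections.

Theorem theorem5p8 (R : realType) (p : nat) (hp : (3 <= p)%N)
    (kappa : R) (hkappa : 0 < kappa) :
  (6%:R%:E <= GC (@minimizing_geodesics R p kappa) <= 7%:R%:E)%E.
Proof.
apply/andP; split.
  apply: le_ereal_inf_tmp => _ [k [A dA sA] <-]; rewrite lee_fin ler_nat.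
  rewrite leqNgt; apply/negP => k6.
  have [idx [lab [h1 h2 h3 h4 h5]]] := decomposition_labelling (ltnW hp) hkappa dA sA.
  exact: (no_labelling hp k6 h1 h2 h3 h4 h5).
apply: ereal_inf_lbound; exists 7%N => //; exists (@stratum R p).
  split; [exact: stratum_cover | exact: stratum_disjoint | exact: stratum_locally_compact].
by move=> i; exact: stratum_section.
Qed.
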